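(* Assume the setup below, and suppose there exist constants $C''>0$ and $\tau>\tfrac32$ such that $\max_{n\in\{0,1\}}a(m,n)\le C''|m|^{-\tau}$ for all $m\in\mathbb Z\setminus\{0\}$. Then for $\mu$-almost every $\omega\in\Omega$, the operator $J_\omega$ has purely pure point spectrum.
   Context: Setup: $r:\mathbb R\to[0,\infty)$ is bounded, measurable, compactly supported, with $\int_{\mathbb R} r(x)\,dx=1$. $(d_n)_{n\in\mathbb Z}$ is a fixed sequence of positive reals and $r_n(x)=d_n^{-1}r(d_n^{-1}x)$. $c\in\ell^\infty(\mathbb Z)$ is real. $a\in\ell^\infty(\mathbb Z)$ is real with $a(n)\ge\delta>0$ for all $n$. $\Omega=\mathbb R^{\mathbb Z}$ and $\mu$ is the product probability measure $d\mu(\omega)=\prod_{n} r_n(\omega(n)-c(n))\,d\omega(n)$. $(J_\omega\phi)(n)=a(n)\phi(n+1)+a(n-1)\phi(n-1)+\omega(n)\phi(n)$ on $\ell^2(\mathbb Z)$. For $m,n\in\mathbb Z$, $a(m,n)=\int_\Omega\sup_{t\in\mathbb R}|\langle\delta_m,e^{-itJ_\omega}\delta_n\rangle|\,d\mu(\omega)$. *)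

(* Defs.v *)
From HB Require Import structures.
From mathcomp Require Import all_boot all_order all_algebra.
From mathcomp Require Import all_classical all_reals all_analysis.
Set Implicit Arguments. Unset Strict Implicit. Unset Printing Implicit Defensive.
Import Order.TTheory GRing.Theory Num.Theory.
Import numFieldNormedType.Exports.
Local Open Scope classical_set_scope.
Local Open Scope ring_scope.

Section JacobiDefs.
Context {R : realType}.

Definition cylinders : set (set (int -> R)) :=
  fun A => exists (n : int) (B : set R), measurable B /\ A = [set w | B (w n)].

Definition Omega := g_sigma_algebraType cylinders.

Definition rn (r : R -> R) (d : int -> R) (n : int) (x : R) : R :=
  (d n)^-1 * r ((d n)^-1 * x).

(** mu is the product measure prod_n r_n(w(n) - c(n)) dw(n): it is
    characterised (uniquely, by the pi-lambda theorem) by its values on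
    finite-dimensional cylinders. *)
Definition is_product_law (r : R -> R) (d c : int -> R)
    (mu : set Omega -> \bar R) : Prop :=
  forall (S : seq int) (B : int -> set R),
    uniq S -> (forall n, measurable (B n)) ->
    mu [set w : Omega | forall n, n \in S -> B n (w n)] =
    (\prod_(n <- S)
       Rintegral (@lebesgue_measure R) (B n) (fun x => rn r d n (x - c n)))%:E.

Definition Japp (a w : int -> R) (phi : int -> R) : int -> R :=
  fun n => a n * phi (n + 1) + a (n - 1) * phi (n - 1) + w n * phi n.

Definition l2n2 (f : int -> R) : \bar R :=
  \esum_(n in [set: int]) ((f n) ^+ 2)%:E.

Definition in_l2 (f : int -> R) : Prop := (l2n2 f < +oo)%E.

Definition delta (n : int) : int -> R := fun k => (k == n)%:R.

(** (u, v) with psi(t) = u(t) + i v(t) is a strong (l^2-differentiable) solution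
    of i psi'(t) = J_w psi(t), psi(0) = delta_n, with psi(t) in the domain of J_w.
    Equivalently u' = J v, v' = - J u. *)
Definition schrod_sol (a w : int -> R) (n : int) (u v : R -> int -> R) : Prop :=
  [/\ u 0 = delta n, v 0 = (fun _ => 0),
      (forall t : R, [/\ in_l2 (u t), in_l2 (v t),
                     in_l2 (Japp a w (u t)) & in_l2 (Japp a w (v t))]),
      (forall (t : R) (eps : R), 0 < eps -> exists2 dl : R, 0 < dl & forall h : R,
          0 < `|h| < dl ->
          (l2n2 (fun k => (u (t + h) k - u t k) / h - Japp a w (v t) k)%R < eps%:E)%E)
    & (forall (t : R) (eps : R), 0 < eps -> exists2 dl : R, 0 < dl & forall h : R,
          0 < `|h| < dl ->
          (l2n2 (fun k => (v (t + h) k - v t k) / h + Japp a w (u t) k)%R < eps%:E)%E)].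

(** |<delta_m, e^{-itJ_w} delta_n>| : the modulus of the m-th coordinate of the
    (unique) solution above. *)
Definition evol_amp (a w : int -> R) (m n : int) (t : R) : R :=
  let uv := xget ((fun _ _ => 0), (fun _ _ => 0)) [set uv | schrod_sol a w n uv.1 uv.2] in
  Num.sqrt ((uv.1 t m) ^+ 2 + (uv.2 t m) ^+ 2).

Definition avg_sup_amp (mu : set Omega -> \bar R) (a : int -> R) (m n : int) : \bar R :=
  \int[mu]_(w in [set: Omega]) ereal_sup [set (evol_amp a w m n t)%:E | t in [set: R]].

Definition eigvec (a w : int -> R) (phi : int -> R) : Prop :=
  [/\ in_l2 phi, exists n, phi n != 0 & exists E : R, forall n, Japp a w phi n = E * phi n].

Definition pure_point (a w : int -> R) : Prop :=
  forall psi : int -> R, in_l2 psi -> forall eps : R, 0 < eps ->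
    exists s : seq (R * (int -> R)),
      (forall p, p \in s -> eigvec a w p.2) /\
      (l2n2 (fun k => psi k - \sum_(p <- s) p.1 * p.2 k)%R < eps%:E)%E.

End JacobiDefs.

(* Main.v *)
(**
Summing the decay estimate over [m] gives, for almost every potential,
[sum_m sup_t |psi_t(m)|^2 < oo] for the orbits [psi_t = exp(-itJ) delta_n] with
[n = 0, 1]; this requires the amplitude to be measurable, which follows by
exhibiting it as a limit of the amplitudes of finite truncations of [J].

For such an orbit the time average [K] of the rank-one operators
[|psi_t><psi_t|] is compact and commutes with [J].  If [K] were nonzero on the
orthogonal complement of the eigenvectors of [J], its top eigenspace there would
be invariant under [J] and compact, and maximising the form of [J] on it would
produce an eigenvector of [J] orthogonal to all eigenvectors.  Hence the averaged
squared distance from [psi_t] to the span of the eigenvectors vanishes; this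
distance is constant in [t], so the whole orbit lies in the closed span.  As [a]
does not vanish, the three-term recurrence carries this over from [n = 0, 1] to
all [n], so the eigenvectors span a dense subspace.
*)
Require Import Defs.
From HB Require Import structures.
From mathcomp Require Import all_boot all_order all_algebra.
From mathcomp Require Import all_classical all_reals all_analysis.
From mathcomp Require Import measurable_realfun.
From mathcomp Require Import ring lra zify.
Import Order.TTheory GRing.Theory Num.Theory.
Import numFieldNormedType.Exports.
Set Implicit Arguments. Unset Strict Implicit. Unset Printing Implicit Defensive.
Local Open Scope classical_set_scope.
Local Open Scope ring_scope.

(** * Square-summable sequences over the integers *)

Section L2.
Context {R : realType}.
Implicit Types (f g h x y z : int -> R) (L : nat) (c : R).

(** For a fixed [w] the potential is an arbitrary real sequence, so [J] is unbounded, and the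
    argument works without functional calculus or spectral resolution. [evol_amp] refers to a chosen
    strong solution, so it carries information only once that solution is known to exist and to be
    unique. Complex numbers are replaced by the pair (u, v) with psi = u + i v. Boundedness of [a]
    enters through Green's formula: the boundary terms vanish, which gives both symmetry of [J] on
    its maximal domain and conservation of the norm. Time averages use a finitely additive mean on
    all bounded functions, built to annihilate derivatives; commutation of [K] with [J] then becomes
    the vanishing mean of a derivative. The price is that the mean does not commute with infinite
    sums, so each exchange rests on a tail estimate uniform in time. Amplitudes are at most 1, so
    summability of their suprema also bounds the sum of the squares; the exponent 3/2 is met by an
    elementary telescoping bound for the sum of k^(-3/2). *)

Definition wsum f L : R := \sum_(0 <= k < L) (f (Posz k) + f (Negz k)).

Lemma wsumS f L : wsum f L.+1 = wsum f L + (f (Posz L) + f (Negz L)).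
Proof. by rewrite /wsum big_nat_recr. Qed.

Lemma wsum0 f : wsum f 0 = 0.
Proof. by rewrite /wsum big_nil. Qed.

Lemma eq_wsum f g L : f =1 g -> wsum f L = wsum g L.
Proof. by move=> fg; apply: eq_bigr => k _; rewrite !fg. Qed.

Lemma wsumD f g L : wsum (fun m => f m + g m) L = wsum f L + wsum g L.
Proof. by rewrite /wsum -big_split /=; apply: eq_bigr => k _; rewrite addrACA. Qed.

Lemma wsumZ c f L : wsum (fun m => c * f m) L = c * wsum f L.
Proof. by rewrite /wsum mulr_sumr; apply: eq_bigr => k _; rewrite mulrDr. Qed.

Lemma wsumB f g L : wsum (fun m => f m - g m) L = wsum f L - wsum g L.
Proof.
rewrite -mulN1r -wsumZ -wsumD; apply: eq_wsum => m; by rewrite mulN1r.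
Qed.

Lemma ler_wsum f g L : (forall m, f m <= g m) -> wsum f L <= wsum g L.
Proof. by move=> fg; apply: ler_sum => k _; rewrite lerD. Qed.

Lemma wsum_ge0 f L : (forall m, 0 <= f m) -> 0 <= wsum f L.
Proof. by move=> f0; apply: sumr_ge0 => k _; rewrite addr_ge0. Qed.

Lemma wsum_nd f L L' : (forall m, 0 <= f m) -> (L <= L')%N ->
  wsum f L <= wsum f L'.
Proof.
move=> f0 LL'; rewrite /wsum (big_cat_nat _ LL')//= lerDl.
by apply: sumr_ge0 => k _; rewrite addr_ge0.
Qed.

(** [Negz k] is -(k+1), so the window summed by [wsum f L] is [-L, L). *)
Lemma wsum_mem f L : (forall m, 0 <= f m) -> forall m,
  (m < Posz L) && (- Posz L <= m) -> f m <= wsum f L.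
Proof.
move=> f0 m /andP[mL Lm].
have [k kL fk] : exists2 k : nat, (k < L)%N & f m <= f (Posz k) + f (Negz k).
  case: m mL Lm => k kL Lk; exists k.
  - by rewrite ltz_nat in kL.
  - by rewrite lerDl.
  - by move: Lk; rewrite NegzE lerN2 lez_nat.
  - by rewrite lerDr.
apply: (le_trans fk); apply: le_trans (wsum_nd f0 kL).
by rewrite wsumS lerDr wsum_ge0.
Qed.

Definition sq f : int -> R := fun m => f m ^+ 2.

(** Uniform bounds on finite windows keep the analysis in real arithmetic; [in_l2P] identifies this
    with finiteness of the extended-real sum. *)
Definition l2 f := exists C, forall L, wsum (sq f) L <= C.

(** [limn] has a default value when the windows diverge, hence the [l2] hypotheses on the algebraic
    laws below. *)
Definition dot f g : R := limn (wsum (fun m => f m * g m)).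

Lemma sq_ge0 f m : 0 <= sq f m.
Proof. exact: sqr_ge0. Qed.
Hint Resolve sq_ge0 : core.

Lemma l2D f g : l2 f -> l2 g -> l2 (f + g).
Proof.
move=> [C fC] [D gD]; exists (2 * C + 2 * D) => L.
apply: (@le_trans _ _ (2 * wsum (sq f) L + 2 * wsum (sq g) L)); last first.
  by rewrite lerD// ler_pM2l.
rewrite -!wsumZ -wsumD; apply: ler_wsum => m.
rewrite /sq -[(f + g) m]/(f m + g m).
have := sqr_ge0 (f m - g m); nra.
Qed.

Lemma l2Z c f : l2 f -> l2 (c *: f).
Proof.
move=> [C fC]; exists (c ^+ 2 * C) => L.
have -> : wsum (sq (c *: f)) L = c ^+ 2 * wsum (sq f) L.
  by rewrite -wsumZ; apply: eq_wsum => m; rewrite /sq -exprMn.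
by rewrite ler_wpM2l// sqr_ge0.
Qed.

Lemma l20 : l2 (0 : int -> R).
Proof.
exists 0 => L; rewrite /wsum big1// => k _.
by rewrite /sq /= expr0n /= addr0.
Qed.

Lemma l2N f : l2 f -> l2 (- f).
Proof. by move=> /(l2Z (-1)); rewrite scaleN1r. Qed.

Lemma l2B f g : l2 f -> l2 g -> l2 (f - g).
Proof. by move=> lf /l2N; exact: l2D. Qed.

Lemma wsum_sq_cvg f : l2 f -> cvgn (wsum (sq f)).
Proof.
move=> [C fC]; apply: nondecreasing_is_cvgn.
  by move=> L L' LL'; exact: wsum_nd.
by exists C => _ [L _ <-].
Qed.

Lemma dotff f : dot f f = limn (wsum (sq f)).
Proof. by []. Qed.

(** Polarisation: f g is a combination of squares, whose window sums are monotone and bounded. *)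
Lemma dot_cvg f g : l2 f -> l2 g -> wsum (fun m => f m * g m) @ \oo --> dot f g.
Proof.
move=> lf lg; rewrite /dot.
have -> : wsum (fun m => f m * g m) = fun L => 2^-1 *
   (wsum (sq (f + g)) L - wsum (sq f) L - wsum (sq g) L).
  apply/funext => L; rewrite -!wsumB -wsumZ; apply: eq_wsum => m.
  by rewrite /sq -[(f + g) m]/(f m + g m); field.
have /cvg_ex[s1 h1] := wsum_sq_cvg (l2D lf lg).
have /cvg_ex[s2 h2] := wsum_sq_cvg lf.
have /cvg_ex[s3 h3] := wsum_sq_cvg lg.
apply: (@cvgP _ _ (2^-1 * (s1 - s2 - s3))).
by apply: cvgM; [exact: cvg_cst|apply: cvgB => //; exact: cvgB].
Qed.

Lemma wsum_le_dot f L : l2 f -> wsum (sq f) L <= dot f f.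
Proof.
move=> lf; apply: nondecreasing_cvgn_le; last exact: wsum_sq_cvg.
by move=> L1 L2 LL; exact: wsum_nd.
Qed.

Lemma l2_bound f C : (forall L, wsum (sq f) L <= C) -> l2 f /\ dot f f <= C.
Proof.
move=> fC; have lf : l2 f by exists C.
by split=> //; rewrite dotff limr_le//; [exact: wsum_sq_cvg|exact: nearW].
Qed.

Lemma dot_ge0 f : l2 f -> 0 <= dot f f.
Proof. by move=> lf; rewrite -(wsum0 (sq f)); exact: wsum_le_dot. Qed.

Lemma dotC f g : dot f g = dot g f.
Proof. by rewrite /dot; under eq_fun do rewrite mulrC. Qed.

Lemma dotDl f g h : l2 f -> l2 g -> l2 h -> dot (f + g) h = dot f h + dot g h.
Proof.
move=> lf lg lh; apply/cvg_lim => //.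
rewrite (_ : wsum _ = fun L => wsum (fun m => f m * h m) L +
   wsum (fun m => g m * h m) L).
  by apply: cvgD; exact: dot_cvg.
by apply/funext => L; rewrite -wsumD; apply: eq_wsum => m; rewrite -mulrDl.
Qed.

Lemma dotZl c f h : l2 f -> l2 h -> dot (c *: f) h = c * dot f h.
Proof.
move=> lf lh; apply/cvg_lim => //.
rewrite (_ : wsum _ = fun L => c * wsum (fun m => f m * h m) L).
  by apply: cvgM; [exact: cvg_cst|exact: dot_cvg].
by apply/funext => L; rewrite -wsumZ; apply: eq_wsum => m; rewrite mulrA.
Qed.

Lemma dotDr f g h : l2 f -> l2 g -> l2 h -> dot h (f + g) = dot h f + dot h g.
Proof. by move=> *; rewrite !(dotC h) dotDl. Qed.

Lemma dotZr c f h : l2 f -> l2 h -> dot h (c *: f) = c * dot h f.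
Proof. by move=> *; rewrite !(dotC h) dotZl. Qed.

Lemma dotNl f h : l2 f -> l2 h -> dot (- f) h = - dot f h.
Proof. by move=> *; rewrite -scaleN1r dotZl// mulN1r. Qed.

Lemma dotBl f g h : l2 f -> l2 g -> l2 h -> dot (f - g) h = dot f h - dot g h.
Proof. by move=> *; rewrite dotDl ?dotNl//; exact: l2N. Qed.

Lemma dotBr f g h : l2 f -> l2 g -> l2 h -> dot h (f - g) = dot h f - dot h g.
Proof. by move=> *; rewrite !(dotC h) dotBl. Qed.

Lemma dot0l h : dot 0 h = 0.
Proof.
rewrite /dot (_ : wsum _ = cst 0) ?lim_cst//.
by apply/funext => L; rewrite /wsum big1// => k _; rewrite !mul0r addr0.
Qed.

Lemma dotBB f g : l2 f -> l2 g ->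
  dot (f - g) (f - g) = dot f f - 2 * dot f g + dot g g.
Proof.
move=> lf lg; rewrite dotBl ?dotBr//; last exact: l2B.
by rewrite (dotC g f); ring.
Qed.

Lemma dotDD f g : l2 f -> l2 g ->
  dot (f + g) (f + g) = dot f f + 2 * dot f g + dot g g.
Proof.
move=> lf lg; rewrite dotDl ?dotDr//; last exact: l2D.
by rewrite (dotC g f); ring.
Qed.

Lemma dotZZ c f : l2 f -> dot (c *: f) (c *: f) = c ^+ 2 * dot f f.
Proof. by move=> lf; rewrite dotZl ?dotZr//; [ring | exact: l2Z]. Qed.

Lemma coord_le_dot f m : l2 f -> f m ^+ 2 <= dot f f.
Proof.
move=> lf; apply: le_trans (wsum_le_dot (`|m|.+1)%N lf).
rewrite -[_ ^+ 2]/(sq f m); apply: wsum_mem => //.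
by apply/andP; split; lia.
Qed.

Lemma dot_eq0 f : l2 f -> dot f f <= 0 -> f = 0.
Proof.
move=> lf f0; apply/funext => m; apply/eqP; rewrite -sqrf_eq0.
by rewrite eq_le sqr_ge0 andbT (le_trans (coord_le_dot m lf)).
Qed.

End L2.

Section L2more.
Context {R : realType}.
Implicit Types (f g h x y z : int -> R) (L : nat) (c : R).
Hint Resolve sq_ge0 : core.

Lemma l2n2E f :
  l2n2 f = (\sum_(k <oo) (f (Posz k) ^+ 2 + f (Negz k) ^+ 2)%:E)%E.
Proof.
have f0 m : (0 <= (f m ^+ 2)%:E)%E by rewrite lee_fin sqr_ge0.
rewrite /l2n2 (esumID (range Posz)) ?setTI; last by move=> i _; exact: f0.
have -> : ~` range Posz = range Negz.
  apply/seteqP; split=> [[k|k] /=|_ [k _ <-] /= [l _] //].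
    by case; exists k.
  by move=> _; exists k.
rewrite !esum_image; last 2 first.
- by move=> i j _ _ [].
- by move=> i j _ _ [].
rewrite -!nneseries_esumT// -nneseriesD//.
Qed.

Lemma wsum_le_l2n2 f L : ((wsum (sq f) L)%:E <= l2n2 f)%E.
Proof.
rewrite l2n2E /wsum -sumEFin; apply: nneseries_lim_ge => n _ _.
by rewrite lee_fin addr_ge0 ?sqr_ge0.
Qed.

Lemma l2n2_le f C : (forall L, wsum (sq f) L <= C) -> (l2n2 f <= C%:E)%E.
Proof.
move=> fC; rewrite l2n2E; apply: lime_le.
  by apply: is_cvg_nneseries => n _ _; rewrite lee_fin addr_ge0 ?sqr_ge0.
by apply: nearW => L; rewrite sumEFin lee_fin; exact: fC.
Qed.

Lemma in_l2P f : in_l2 f <-> l2 f.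
Proof.
split=> [|[C fC]]; last exact: le_lt_trans (l2n2_le fC) (ltry _).
rewrite /in_l2 => foo; exists (fine (l2n2 f)) => L.
have f0 : (0 <= l2n2 f)%E by apply: esum_ge0 => m _; rewrite lee_fin sqr_ge0.
rewrite -lee_fin fineK; first exact: wsum_le_l2n2.
by rewrite ge0_fin_numE.
Qed.

Lemma l2n2_dot f : l2 f -> l2n2 f = (dot f f)%:E.
Proof.
move=> lf; apply/eqP; rewrite eq_le; apply/andP; split.
  by apply: l2n2_le => L; exact: wsum_le_dot.
have /in_l2P foo := lf.
have f0 : (0 <= l2n2 f)%E by apply: esum_ge0 => m _; rewrite lee_fin sqr_ge0.
have E : l2n2 f = (fine (l2n2 f))%:E by rewrite fineK// ge0_fin_numE.
rewrite E lee_fin; apply: (proj2 (l2_bound _)) => L.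
by rewrite -lee_fin -E wsum_le_l2n2.
Qed.

Lemma dot_CS f g : l2 f -> l2 g -> dot f g ^+ 2 <= dot f f * dot g g.
Proof.
move=> lf lg; have [g0|g0] := eqVneq (dot g g) 0.
  by rewrite (dot_eq0 lg) ?g0// dotC !dot0l expr0n mulr0.
have gp : 0 < dot g g by rewrite lt_neqAle eq_sym g0 dot_ge0.
have := dot_ge0 (l2B (l2Z (dot g g) lf) (l2Z (dot f g) lg)).
rewrite dotBB; try exact: l2Z.
rewrite !dotZZ// dotZl ?dotZr//; last exact: l2Z.
have -> : dot g g ^+ 2 * dot f f - 2 * (dot g g * (dot f g * dot f g)) +
   dot f g ^+ 2 * dot g g = dot g g * (dot f f * dot g g - dot f g ^+ 2) by ring.
by rewrite pmulr_rge0// subr_ge0.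
Qed.

Lemma dot_norm f g A B : l2 f -> l2 g -> 0 <= A -> 0 <= B ->
  dot f f <= A ^+ 2 -> dot g g <= B ^+ 2 -> `|dot f g| <= A * B.
Proof.
move=> lf lg A0 B0 fA gB; rewrite -ler_sqr ?nnegrE ?mulr_ge0// real_normK ?num_real//.
by rewrite (le_trans (dot_CS lf lg))// exprMn ler_pM// dot_ge0.
Qed.

Lemma wsum_tail f g L L' eta : 0 < eta -> (L <= L')%N ->
  `|wsum (fun m => f m * g m) L' - wsum (fun m => f m * g m) L| <=
  eta * (wsum (sq f) L' - wsum (sq f) L) +
  eta^-1 * (wsum (sq g) L' - wsum (sq g) L).
Proof.
move=> e0 LL'.
have E h : wsum h L' - wsum h L = \sum_(L <= k < L') (h (Posz k) + h (Negz k)).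
  by rewrite /wsum (big_cat_nat _ LL')//= addrAC subrr add0r.
rewrite !E (le_trans (ler_norm_sum _ _ _))// !mulr_sumr -big_split/=.
apply: ler_sum => k _.
have P (s t : R) : `|s * t| <= eta * s ^+ 2 + eta^-1 * t ^+ 2.
  have e1 : 0 < eta^-1 by rewrite invr_gt0.
  have e2 : eta * eta^-1 = 1 by rewrite divff// gt_eqF.
  have h1 := mulr_ge0 (ltW e1) (sqr_ge0 (eta * s - t)).
  have h2 := mulr_ge0 (ltW e1) (sqr_ge0 (eta * s + t)).
  have h3 : 0 <= eta * s ^+ 2 by rewrite mulr_ge0 ?sqr_ge0// ltW.
  have h4 : 0 <= eta^-1 * t ^+ 2 by rewrite mulr_ge0 ?sqr_ge0// ltW.
  have E1 : eta^-1 * (eta * s - t) ^+ 2 =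
    (eta * eta^-1) * eta * s ^+ 2 - 2 * (eta * eta^-1) * s * t + eta^-1 * t ^+ 2 by ring.
  have E2 : eta^-1 * (eta * s + t) ^+ 2 =
    (eta * eta^-1) * eta * s ^+ 2 + 2 * (eta * eta^-1) * s * t + eta^-1 * t ^+ 2 by ring.
  rewrite E1 e2 in h1; rewrite E2 e2 in h2.
  rewrite ler_norml; apply/andP; split; nra.
apply: le_trans (ler_normD _ _) _.
have := P (f k%:Z) (g k%:Z); have := P (f (Negz k)) (g (Negz k)).
rewrite /sq; lra.
Qed.

(** Weighted AM-GM with a free weight. Only the tail of [g] occurs: taking [eta] small and then [L]
    large makes the error uniform over bounded [f]. *)
Lemma dot_tail f g L eta : l2 f -> l2 g -> 0 < eta ->
  `|dot f g - wsum (fun m => f m * g m) L| <=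
  eta * dot f f + eta^-1 * (dot g g - wsum (sq g) L).
Proof.
move=> lf lg e0.
have c1 : (fun L' => `|wsum (fun m => f m * g m) L' - wsum (fun m => f m * g m) L|)
   @ \oo --> `|dot f g - wsum (fun m => f m * g m) L|.
  by apply: cvg_norm; apply: cvgB; [exact: dot_cvg | exact: cvg_cst].
apply: (cvgr_to_le c1); exists L => // L' /= LL'.
apply: le_trans (wsum_tail _ _ e0 LL') _.
rewrite lerD ?ler_pM2l ?invr_gt0//.
  by rewrite (le_trans _ (wsum_le_dot L' lf))// gerBl wsum_ge0.
by rewrite lerB// wsum_le_dot.
Qed.

Lemma wsum_delta m f L : wsum (fun k => delta m k * f k) L =
  if (m < Posz L) && (- Posz L <= m) then f m else 0.
Proof.
elim: L => [|L IH]; first by rewrite wsum0; case: ifP => //; lia.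
rewrite wsumS IH /delta; have [mL|mL] := eqVneq (Posz L) m.
  rewrite -mL mul1r (_ : (Negz L == Posz L) = false)//= mul0r addr0.
  case: ifP; first by lia.
  by move=> _; case: ifP; [rewrite add0r|lia].
have [mL'|mL'] := eqVneq (Negz L) m.
  rewrite -mL' mul0r mul1r add0r.
  case: ifP; first by lia.
  by move=> _; case: ifP; [rewrite add0r|lia].
rewrite !mul0r !addr0; case: ifP; case: ifP => //; lia.
Qed.

Lemma sq_delta m : sq (@delta R m) = fun k => delta m k * 1.
Proof.
apply/funext => k; rewrite /sq /delta; case: (_ == _) => /=.
  by rewrite expr1n mulr1.
by rewrite expr0n mul0r.
Qed.

Lemma l2_delta m : l2 (@delta R m).
Proof.
by exists 1 => L; rewrite sq_delta wsum_delta; case: ifP => // _; exact: ler01.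
Qed.

Lemma dot_delta m f : dot (delta m) f = f m.
Proof.
apply: lim_near_cst => //; exists (`|m|.+1)%N => // L /= mL.
by rewrite wsum_delta; case: ifP => //; lia.
Qed.

Lemma dot_deltar m f : dot f (delta m) = f m.
Proof. by rewrite dotC dot_delta. Qed.

(** * Coordinatewise and weak limits *)

Section WindowLimit.
Context {I : Type} {F : set_system I} {FF : ProperFilter F}.
Context (x_ : I -> int -> R) (xl : int -> R).
Context (x_cvg : forall m, x_ i m @[i --> F] --> xl m).

Lemma wsum_cvg L : wsum (x_ i) L @[i --> F] --> wsum xl L.
Proof.
elim: L => [|L IH].
  by under eq_fun do rewrite wsum0; rewrite wsum0; exact: cvg_cst.
under eq_fun do rewrite wsumS; rewrite wsumS.
by apply: cvgD => //; apply: cvgD.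
Qed.

End WindowLimit.

Section WeakLimits.
Context {I : Type} {F : set_system I} {FF : ProperFilter F}.
Context (x_ : I -> int -> R) (xl : int -> R) (C : R).
Context (x_cvg : forall m, x_ i m @[i --> F] --> xl m).

(** Each window is a finite sum and passes to the limit. The bound is asked only eventually for each
    window, the form in which it is available for differences of a minimising sequence. *)
Lemma l2_fatou_near : (forall L, \forall i \near F, wsum (sq (x_ i)) L <= C) ->
  l2 xl /\ dot xl xl <= C.
Proof.
move=> xC; apply: l2_bound => L.
have c : wsum (sq (x_ i)) L @[i --> F] --> wsum (sq xl) L.
  by apply: wsum_cvg => m; apply: cvgM.
by apply: (cvgr_to_le c); exact: xC.
Qed.

Context (x_l2 : forall i, l2 (x_ i)).
Context (x_C : forall i, dot (x_ i) (x_ i) <= C).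

Lemma l2_fatou : l2 xl /\ dot xl xl <= C.
Proof.
apply: l2_fatou_near => L; apply: nearW => i.
by apply: le_trans (x_C i); exact: wsum_le_dot.
Qed.

(** On norm-bounded families coordinatewise convergence is weak convergence: the tail of [y] is
    small, and finitely many coordinates remain. *)
Lemma weak_cvg y : l2 y -> dot (x_ i) y @[i --> F] --> dot xl y.
Proof.
move=> ly; have [lx xC] := l2_fatou.
have C0 : 0 <= C by apply: le_trans xC; exact: dot_ge0.
apply/cvgrPdist_le => e e0.
(* The budget is e/4 + e/8 for the tail at [x_ i], the same at [xl], and e/8 for the window: 7e/8 in
   total. *)
pose eta := e / (4 * (C + 1)).
have eta0 : 0 < eta by rewrite divr_gt0// mulr_gt0// ltr_wpDl.
have etaC : eta * C <= e / 4.
  rewrite /eta invfM mulrA -mulrA ler_piMr//; first by rewrite divr_ge0 ?ltW.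
  by rewrite mulrC ler_pdivrMr ?mul1r ?lerDl// ltr_wpDl.
have [L hL] : exists L, eta^-1 * (dot y y - wsum (sq y) L) <= e / 8.
  have : (fun L => eta^-1 * (dot y y - wsum (sq y) L)) @ \oo -->
     eta^-1 * (dot y y - dot y y).
    apply: cvgM; first exact: cvg_cst.
    by apply: cvgB; [exact: cvg_cst| exact: dot_cvg].
  rewrite subrr mulr0 => /cvgr_le /(_ (e / 8)) [|L _ hL]; first by rewrite divr_gt0.
  by exists L; apply: hL => /=.
have T z : l2 z -> dot z z <= C -> `|dot z y - wsum (fun m => z m * y m) L| <= e / 4 + e / 8.
  move=> lz zC; apply: le_trans (dot_tail L lz ly eta0) _.
  by rewrite lerD// (le_trans _ etaC)// ler_pM2l.
have cw : wsum (fun m => x_ i m * y m) L @[i --> F] --> wsum (fun m => xl m * y m) L.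
  by apply: wsum_cvg => m; apply: cvgM => //; exact: cvg_cst.
have e8 : 0 < e / 8 by rewrite divr_gt0.
move/cvgrPdist_le : cw => /(_ _ e8); apply: filterS => i.
have := T _ lx xC; have := T _ (x_l2 i) (x_C i).
rewrite !ler_norml; lra.
Qed.

End WeakLimits.

End L2more.
#[global] Hint Resolve sq_ge0 l2_delta : core.

(** * The Jacobi operator *)

Section JSym.
Context {R : realType}.
Context (a w : int -> R) (aM : R) (a_bd : forall n, `|a n| <= aM).
Implicit Types (x y z : int -> R).

Lemma JappD x y : Japp a w (x + y) = Japp a w x + Japp a w y.
Proof. by apply/funext => n; rewrite /Japp !fctE; ring. Qed.

Lemma JappZ c x : Japp a w (c *: x) = c *: Japp a w x.
Proof. by apply/funext => n; rewrite /Japp !fctE /= /GRing.scale /=; ring. Qed.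

Lemma JappN x : Japp a w (- x) = - Japp a w x.
Proof. by rewrite -scaleN1r JappZ scaleN1r. Qed.

Lemma JappB x y : Japp a w (x - y) = Japp a w x - Japp a w y.
Proof. by rewrite JappD JappN. Qed.

Definition wronsk x y m := a m * (x m * y (m + 1) - y m * x (m + 1)).

(** Green's formula: [w] cancels and the rest telescopes to the discrete Wronskian on the two edges
    crossing the boundary of [-(L+1), L]. [Negz L.+1] is -(L+2), the left end of the left edge. *)
Lemma wsum_wronsk x y L :
  wsum (fun m => x m * Japp a w y m - y m * Japp a w x m) L.+1 =
  wronsk x y (Posz L) - wronsk x y (Negz L.+1).
Proof.
have E m : x m * Japp a w y m - y m * Japp a w x m =
    wronsk x y m - wronsk x y (m - 1).
  by rewrite /Japp /wronsk subrK; ring.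
have N k : (Negz k - 1 = Negz k.+1)%R by lia.
elim: L => [|L IH].
  rewrite wsumS wsum0 !E N (_ : Posz 0 - 1 = Negz 0); first by ring.
  by lia.
rewrite wsumS IH !E N (_ : Posz L.+1 - 1 = Posz L); first by ring.
by lia.
Qed.

Lemma wronsk_le x y m : `|wronsk x y m| <=
  aM * (x m ^+ 2 + x (m + 1) ^+ 2 + y m ^+ 2 + y (m + 1) ^+ 2).
Proof.
rewrite /wronsk normrM ler_pM//.
have := sqr_ge0 (x m - y (m + 1)); have := sqr_ge0 (x m + y (m + 1)).
have := sqr_ge0 (y m - x (m + 1)); have := sqr_ge0 (y m + x (m + 1)).
have h1 := sqr_ge0 (x m); have h2 := sqr_ge0 (y m).
have h3 := sqr_ge0 (x (m + 1)); have h4 := sqr_ge0 (y (m + 1)).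
rewrite ler_norml => *; apply/andP; split; nra.
Qed.

(** The boundary Wronskians are at most [aM] times terms of convergent series, hence tend to zero.
    This gives symmetry on the whole maximal domain, whatever the growth of [w]. *)
Lemma Japp_sym x y : l2 x -> l2 y -> l2 (Japp a w x) -> l2 (Japp a w y) ->
  dot (Japp a w x) y = dot x (Japp a w y).
Proof.
move=> lx ly lJx lJy.
have c : wsum (fun m => x m * Japp a w y m - y m * Japp a w x m) @ \oo -->
    dot x (Japp a w y) - dot y (Japp a w x).
  rewrite [X in X @ _](_ : _ = fun L => wsum (fun m => x m * Japp a w y m) L -
    wsum (fun m => y m * Japp a w x m) L); last by apply/funext => L; exact: wsumB.
  by apply: cvgB; exact: dot_cvg.
apply/eqP; rewrite eq_sym -subr_eq0 (dotC _ y); apply/eqP.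
rewrite -(cvg_lim _ c)//; apply: cvg_lim => //.
pose d k := sq x (Posz k) + sq x (Negz k) + (sq y (Posz k) + sq y (Negz k)).
have d0 : d @ \oo --> 0.
  rewrite -(addr0 0); apply: cvgD.
    exact: (@cvg_series_cvg_0 _ _ (fun k => sq x (Posz k) + sq x (Negz k)) (wsum_sq_cvg lx)).
  exact: (@cvg_series_cvg_0 _ _ (fun k => sq y (Posz k) + sq y (Negz k)) (wsum_sq_cvg ly)).
have d1 : d n.+1 @[n --> \oo] --> 0 by rewrite (cvg_shiftS d).
have a0 : 0 <= aM by apply: le_trans (a_bd 0).
rewrite -(cvg_shiftS (wsum _)); apply/norm_cvg0P.
have D : (fun n => aM * (d n + d n.+1)) @ \oo --> 0.
  rewrite -(mulr0 aM); apply: cvgM; first exact: cvg_cst.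
  by rewrite -(addr0 0); apply: cvgD.
apply: (squeeze_cvgr _ (cvg_cst 0) D); apply: nearW => L.
rewrite normr_ge0/= wsum_wronsk.
apply: le_trans (ler_normB _ _) _.
apply: le_trans (lerD (wronsk_le _ _ _) (wronsk_le _ _ _)) _.
rewrite -mulrDr ler_wpM2l// /d /sq.
rewrite (_ : Negz L.+1 + 1 = Negz L); last by lia.
rewrite (_ : Posz L + 1 = Posz L.+1); last by lia.
have P k : (0 <= x k ^+ 2) /\ (0 <= y k ^+ 2) by rewrite !sqr_ge0.
have [] := P (Posz L); have [] := P (Posz L.+1).
have [] := P (Negz L); have [] := P (Negz L.+1).
lra.
Qed.

End JSym.

(** * Ultralimits and invariant means *)

Section Ultra.
Context {R : realType}.

Lemma ultra_cvg_near {I : Type} {U : set_system I} {UU : UltraFilter U}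
    (x : I -> R) C :
  U [set i | `|x i| <= C] -> cvg (x @ U).
Proof.
move=> xC.
have UC : (x @ U) [set` `[- C, C]%R].
  by apply: (@filterS _ U _ _ _ _ xC) => i /=; rewrite in_itv /= -ler_norml.
have [p [_ pc]] := @segment_compact R (- C) C (x @ U) _ UC.
apply: (@cvgP _ _ p) => B Bp.
have [//|nB] := in_ultra_setVsetC (x @^-1` B) UU.
by have [q [/= nBq Bq]] := pc (~` B) B nB Bp.
Qed.

Lemma ultra_cvg {I : Type} (U : set_system I) (UU : UltraFilter U) (x : I -> R) C :
  (forall i, `|x i| <= C) -> cvg (x @ U).
Proof. by move=> xC; apply: (ultra_cvg_near (C := C)); exact: filterE. Qed.

Lemma ultra_noo : exists U : set_system nat, UltraFilter U /\ \oo `<=` U.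
Proof. exact: ultraFilterLemma. Qed.

(** If convergence failed, the bad indices would generate with [\oo] a proper filter, and an
    ultrafilter above it would contradict the hypothesis. This turns ultralimits that do not depend
    on the ultrafilter into ordinary limits. *)
Lemma cvg_ultra (x : nat -> R) (l : R) :
  (forall U : set_system nat, UltraFilter U -> \oo `<=` U -> x @ U --> l) ->
  x @ \oo --> l.
Proof.
move=> H; apply/cvgrPdist_lt => e e0; apply: contrapT => nH.
pose A := [set n | ~ (`|l - x n| < e)].
have PW : ProperFilter (within A \oo).
  apply: Build_ProperFilter_ex => B BA.
  apply: contrapT => nB; apply: nH.
  move: BA; rewrite /within /=; apply: filterS => n AB; apply: contrapT => An.
  by apply: nB; exists n; exact: AB.
have [U [UU WU]] := ultraFilterLemma PW.
have UA : U A by apply: WU; exact: withinT.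
have /H : \oo `<=` U by move=> B Boo; apply: WU; rewrite /within /=; apply: filterS Boo.
move=> /cvgrPdist_lt/(_ e e0) UB.
by have [n [/= ? ?]] := filter_ex (filterI UA UB).
Qed.

End Ultra.

(** * A mean on bounded functions that annihilates derivatives *)

Section Mean.
Context {R : realType}.
Implicit Types F G f g : R -> R.

Definition bnd f := exists C, forall t, `|f t| <= C.

Lemma bndD f g : bnd f -> bnd g -> bnd (fun t => f t + g t).
Proof.
move=> [C fC] [D gD]; exists (C + D) => t.
by rewrite (le_trans (ler_normD _ _))// lerD.
Qed.

Lemma bndM f g : bnd f -> bnd g -> bnd (fun t => f t * g t).
Proof.
move=> [C fC] [D gD]; exists (C * D) => t.
by rewrite normrM ler_pM.
Qed.

Lemma bndZ c f : bnd f -> bnd (fun t => c * f t).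
Proof. by move=> [C fC]; exists (`|c| * C) => t; rewrite normrM ler_wpM2l. Qed.

Lemma bndB f g : bnd f -> bnd g -> bnd (fun t => f t - g t).
Proof.
move=> bf /(bndZ (-1)) /(bndD bf) [C h]; exists C => t.
by have := h t; rewrite mulN1r.
Qed.

(* Uniform second order Taylor bound: all that is needed for Riemann sums
   of F' to be averaged away. *)
Definition taylor2 F G := [/\ bnd F, bnd G &
  exists C, forall t h, 0 <= h <= 1 -> `|F (t + h) - F t - h * G t| <= C * h ^+ 2].

Lemma taylor2B F F' G G' : taylor2 F F' -> taylor2 G G' ->
  taylor2 (fun t => F t - G t) (fun t => F' t - G' t).
Proof.
move=> [bF bF' [C hC]] [bG bG' [D hD]]; split; try exact: bndB.
exists (C + D) => t h h01.
rewrite (_ : _ - _ - _ = F (t + h) - F t - h * F' t - (G (t + h) - G t - h * G' t)).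
  by rewrite (le_trans (ler_normB _ _))// mulrDl lerD ?hC ?hD.
by ring.
Qed.

Lemma taylor2M F F' G G' : taylor2 F F' -> taylor2 G G' ->
  taylor2 (fun t => F t * G t) (fun t => F' t * G t + F t * G' t).
Proof.
move=> [bF bF' [C hC]] [bG bG' [D hD]]; split; first exact: bndM.
  by apply: bndD; exact: bndM.
case: bF bF' bG bG' => [B1 h1] [B2 h2] [B3 h3] [B4 h4].
(* With Taylor remainders p and q, the remainder of the product is p G + F q + (p + h F')(q + h G');
   h <= 1 turns each factor of the last term into O(h). *)
exists (C * B3 + B1 * D + (C + B2) * (D + B4)) => t h /andP[h0 h1'].
have b1 := hC t h; have b2 := hD t h; rewrite h0 h1' in b1 b2.
have {}b1 := b1 isT; have {}b2 := b2 isT.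
set p := F (t + h) - F t - h * F' t in b1; set q := G (t + h) - G t - h * G' t in b2.
rewrite (_ : _ - _ - _ = p * G t + F t * q + (p + h * F' t) * (q + h * G' t));
  last by rewrite /p /q; ring.
have hh : h ^+ 2 <= h by rewrite expr2 ler_piMr.
have C0 : 0 <= C by have := hC 0 1; rewrite ler01 lexx expr1n mulr1 => /(_ isT); apply: le_trans.
have D0 : 0 <= D by have := hD 0 1; rewrite ler01 lexx expr1n mulr1 => /(_ isT); apply: le_trans.
have P1 : `|p + h * F' t| <= h * (C + B2).
  apply: le_trans (ler_normD _ _) _; rewrite mulrDr lerD//.
    by rewrite (le_trans b1)// mulrC ler_wpM2r.
  by rewrite normrM ger0_norm// ler_wpM2l.
have P2 : `|q + h * G' t| <= h * (D + B4).
  apply: le_trans (ler_normD _ _) _; rewrite mulrDr lerD//.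
    by rewrite (le_trans b2)// mulrC ler_wpM2r.
  by rewrite normrM ger0_norm// ler_wpM2l.
apply: le_trans (ler_normD _ _) _; rewrite [leRHS]mulrDl lerD//; last first.
  rewrite normrM (_ : _ * _ * h ^+ 2 = h * (C + B2) * (h * (D + B4))); last by ring.
  exact: ler_pM.
apply: le_trans (ler_normD _ _) _; rewrite [leRHS]mulrDl lerD// normrM.
  by rewrite mulrAC ler_pM.
by rewrite -mulrA ler_pM.
Qed.

(* Riemann sums of mesh 1/N over [0, N] divided by N, with N shifted by one. *)
Definition avg f (N : nat) : R :=
  (N.+1%:R ^+ 2)^-1 * \sum_(j < N.+1 ^ 2) f (j%:R / N.+1%:R).

Lemma avg_le f C N : (forall t, f t <= C) -> avg f N <= C.
Proof.
move=> fC; rewrite /avg mulrC ler_pdivrMr ?exprn_gt0//.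
apply: le_trans (ler_sum _ (fun j _ => fC _)) _.
by rewrite sumr_const card_ord -[C *+ _]mulr_natr natrX.
Qed.

Lemma avgD f g N : avg (fun t => f t + g t) N = avg f N + avg g N.
Proof. by rewrite /avg big_split mulrDr. Qed.

Lemma avgZ c f N : avg (fun t => c * f t) N = c * avg f N.
Proof. by rewrite /avg -mulr_sumr mulrCA. Qed.

Lemma avg_bnd f C N : (forall t, `|f t| <= C) -> `|avg f N| <= C.
Proof.
move=> fC; rewrite ler_norml; apply/andP; split.
  rewrite lerNl -mulN1r -avgZ; apply: avg_le => t.
  by rewrite mulN1r (le_trans (ler_norm _))// normrN.
by apply: avg_le => t; rewrite (le_trans (ler_norm _)).
Qed.

(** With mesh 1/n each summand G is n times an increment of [F] up to C/n. The n^2 increments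
    telescope to at most 2 B n, and division by n^2 leaves (2 B + C)/n. *)
Lemma avg_deriv F G : taylor2 F G -> avg G @ \oo --> 0.
Proof.
move=> [[B FB] _ [C hC]].
apply/norm_cvg0P.
have D : (fun n => (2 * B + C) * harmonic n) @ \oo --> 0.
  rewrite -(mulr0 (2 * B + C)); apply: cvgM; first exact: cvg_cst.
  exact: cvg_harmonic.
apply: (squeeze_cvgr _ (cvg_cst 0) D); apply: nearW => N.
rewrite normr_ge0/= /avg /harmonic /=.
set n : R := N.+1%:R; have n0 : 0 < n by rewrite /n ltr0n.
have nn : n != 0 by rewrite gt_eqF.
have K (k : nat) : `|\sum_(j < k) G (j%:R / n) - n * (F (k%:R / n) - F 0)| <= k%:R * (C / n).
  elim: k => [|k IH]; first by rewrite big_ord0 mul0r subrr mulr0 subr0 normr0 mul0r.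
  rewrite big_ord_recr/= -natr1 mulrDl.
  have h01 : 0 <= n^-1 <= 1.
    by rewrite invr_ge0 ltW//= invf_le1// /n ler1n.
  have := hC (k%:R / n) _ h01.
  rewrite div1r; set x := k%:R / n in IH *; set s := \sum_(j < k) _ in IH *.
  move=> T.
  rewrite (_ : _ - _ = (s - n * (F x - F 0)) - n * (F (x + n^-1) - F x - n^-1 * G x)).
    rewrite (le_trans (ler_normB _ _))// mulrDl lerD// mul1r.
    rewrite normrM gtr0_norm// (_ : C / n = n * (C * n^-1 ^+ 2)) ?ler_pM2l//.
    by field.
  by field.
have := K (N.+1 ^ 2)%N; set S := \sum_(_ < _) _.
rewrite natrX -/n => T.
have n2 : 0 < n ^+ 2 by rewrite exprn_gt0.
rewrite normrM gtr0_norm ?invr_gt0// mulrC ler_pdivrMr//.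
have -> : (2 * B + C) / n * n ^+ 2 = n * (2 * B) + n ^+ 2 * (C / n) by field.
rewrite -[S](subrK (n * (F (n ^+ 2 / n) - F 0))).
apply: le_trans (ler_normD _ _) _; rewrite addrC lerD//.
rewrite normrM gtr0_norm// ler_pM2l//.
by rewrite (le_trans (ler_normB _ _))// mulr_natl mulr2n lerD.
Qed.

(** An ultrafilter limit of Riemann averages is linear on all bounded functions at once, so no
    integrability of the integrands has to be checked. *)
Lemma mean_exists : exists M : (R -> R) -> R,
  [/\ forall f g, bnd f -> bnd g -> M (fun t => f t + g t) = M f + M g,
      forall c f, bnd f -> M (fun t => c * f t) = c * M f,
      forall f C, bnd f -> (forall t, f t <= C) -> M f <= C &
      forall F G, taylor2 F G -> M G = 0].
Proof.
have [U [UU Uoo]] := ultra_noo.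
have c f : bnd f -> avg f @ U --> lim (avg f @ U).
  by move=> [C fC]; apply: (@ultra_cvg _ _ _ UU _ C) => N; exact: avg_bnd.
exists (fun f => lim (avg f @ U)); split.
- move=> f g bf bg; apply: cvg_lim => //.
  rewrite (_ : avg _ = fun N => avg f N + avg g N).
    by apply: cvgD; exact: c.
  by apply/funext => N; rewrite avgD.
- move=> k f bf; apply: cvg_lim => //.
  rewrite (_ : avg _ = fun N => k * avg f N).
    by apply: cvgM; [exact: cvg_cst | exact: c].
  by apply/funext => N; rewrite avgZ.
- move=> f C bf fC; apply: limr_le; first exact: c.
  by apply: nearW => N; exact: avg_le.
- move=> F G /avg_deriv h; apply: cvg_lim => //.
  exact: (cvg_trans (cvg_app _ Uoo) h).
Qed.

End Mean.

(** * Maximisers of weakly continuous forms and orthogonal projection *)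

Section Hilbert.
Context {R : realType}.
Implicit Types (x y z s : int -> R) (L : nat) (c : R).

(** The first-order condition at an extremum of a quadratic form; it is tested at t = -b/K with K =
    |k| + 1. *)
Lemma lin_quad_eq0 (b k : R) : (forall t, 0 <= 2 * t * b + t ^+ 2 * k) -> b = 0.
Proof.
move=> H; apply/eqP; rewrite -sqrf_eq0 eq_le sqr_ge0 andbT.
pose K := `|k| + 1.
have K0 : 0 < K by rewrite ltr_wpDl.
have kK : k <= K by rewrite (le_trans (ler_norm _))// lerDl.
have := H (- b / K).
rewrite (_ : 2 * _ * b + _ = (b ^+ 2 / K) * (- 2 + k / K)); last first.
  by field; rewrite gt_eqF.
move=> h.
have h1 : k / K <= 1 by rewrite ler_pdivrMr// mul1r.
have h2 : - 2 + k / K <= - 1 by lra.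
have h3 : 0 <= b ^+ 2 / K by rewrite divr_ge0 ?sqr_ge0// ltW.
have h4 : b ^+ 2 / K <= 0 by nra.
by rewrite ler_pdivrMr ?mul0r in h4.
Qed.

Lemma ultra_pointwise (U : set_system nat) (UU : UltraFilter U)
    (x_ : nat -> int -> R) C :
  (forall i, l2 (x_ i)) -> (forall i, dot (x_ i) (x_ i) <= C) ->
  exists x, forall m, x_ i m @[i --> U] --> x m.
Proof.
move=> xl xC; exists (fun m => lim (x_ i m @[i --> U])) => m.
apply: (@ultra_cvg _ _ _ UU _ (1 + C)) => i.
have h := le_trans (coord_le_dot m (xl i)) (xC i).
have h1 : x_ i m ^+ 2 = `|x_ i m| ^+ 2 by rewrite real_normK ?num_real.
rewrite h1 in h; have := sqr_ge0 (`|x_ i m| - 1); nra.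
Qed.

(* The form attains its supremum on the weakly compact unit ball, and a
   maximiser is an eigenvector. *)
Lemma eigen_max (B : set (int -> R)) (A : (int -> R) -> (int -> R)) x1 :
  (forall x, B x -> l2 x) ->
  (forall x y, B x -> B y -> B (x + y)) ->
  (forall c x, B x -> B (c *: x)) ->
  (forall x, B x -> B (A x)) ->
  (forall x y, B x -> B y -> A (x + y) = A x + A y) ->
  (forall c x, B x -> A (c *: x) = c *: A x) ->
  (forall x y, B x -> B y -> dot (A x) y = dot x (A y)) ->
  (forall (U : set_system nat) (x_ : nat -> int -> R) x, UltraFilter U ->
     (forall i, B (x_ i)) -> (forall i, dot (x_ i) (x_ i) <= 1) ->
     (forall m, x_ i m @[i --> U] --> x m) ->
     B x /\ dot (A (x_ i)) (x_ i) @[i --> U] --> dot (A x) x) ->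
  B x1 -> 0 < dot (A x1) x1 ->
  exists y lam, [/\ B y, y <> 0, 0 < lam & A y = lam *: y].
Proof.
move=> Bl BD BZ AB AD AZ As Bc Bx1 q1.
have AlB x : B x -> l2 (A x) by move=> /AB/Bl.
pose q x := dot (A x) x.
have qZ c x : B x -> q (c *: x) = c ^+ 2 * q x.
  move=> Bx; rewrite /q AZ// dotZl ?dotZr; first by ring.
  all: try exact: Bl; try exact: AlB; try by apply: l2Z; exact: Bl.
have [U [UU Uoo]] := ultra_noo.
have lims (x_ : nat -> int -> R) : (forall i, B (x_ i)) ->
    (forall i, dot (x_ i) (x_ i) <= 1) ->
    exists x, [/\ B x, dot x x <= 1 & q (x_ i) @[i --> U] --> q x].
  move=> xB xn; have xl i := Bl _ (xB i).
  have [x xc] := ultra_pointwise UU xl xn.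
  have [Bx qx] := Bc _ _ _ UU xB xn xc.
  by exists x; split=> //; have [] := l2_fatou xc xl xn.
pose E := [set q x | x in [set x | B x /\ dot x x <= 1]].
have Bx0 : B 0 by rewrite -(scale0r x1); exact: BZ.
have E0 : E (q 0) by exists 0 => //; split=> //; rewrite dot0l ler01.
(* A sequence on which the form exceeds every k would still have a finite limit of the form along
   [U]. *)
have Eub : has_ubound E.
  apply: contrapT => nE.
  have /choice[x_ hx] : forall k : nat, exists x, [/\ B x, dot x x <= 1 & k%:R < q x].
    move=> k; apply: contrapT => nk; apply: nE; exists k%:R => _ [x [Bx nx] <-].
    by rewrite leNgt; apply/negP => h; apply: nk; exists x.
  have [||x [Bx nx qx]] := lims x_.
  - by move=> i; case: (hx i).
  - by move=> i; case: (hx i).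
  have /cvgr_lt/(_ (q x + 1)) := qx; rewrite ltrDl ltr01 => /(_ isT) h.
  have h2 : U [set k : nat | q x + 1 <= k%:R].
    by apply: Uoo; exact: nbhs_infty_ger.
  have [k [/= k1 k2]] := filter_ex (filterI h h2).
  have [_ _] := hx k; rewrite ltNge (le_trans (ltW k1))//.
pose lam := sup E.
have Esup : has_sup E by split => //; exists (q 0).
have le_lam x : B x -> dot x x <= 1 -> q x <= lam.
  by move=> Bx nx; apply: ub_le_sup => //; exists x.
have scal x : B x -> q x <= lam * dot x x.
  move=> Bx; have lx := Bl _ Bx.
  have [x0|x0] := eqVneq (dot x x) 0.
    by rewrite /q (dot_eq0 lx) ?x0// dotC !dot0l mulr0.
  have xp : 0 < dot x x by rewrite lt_neqAle eq_sym x0 dot_ge0.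
  pose c := (Num.sqrt (dot x x))^-1.
  have c2 : c ^+ 2 * dot x x = 1.
    by rewrite /c exprVn sqr_sqrtr ?(ltW xp)// mulVf.
  have := le_lam (c *: x) (BZ _ _ Bx); rewrite dotZZ// qZ// c2 lexx => /(_ isT) h.
  by rewrite -[q x]mulr1 -c2 mulrCA mulrA ler_pM2r.
have lam0 : 0 < lam.
  have l1 := Bl _ Bx1; have := lt_le_trans q1 (scal _ Bx1).
  rewrite ltNge => /negP h; rewrite ltNge; apply/negP => h'.
  by apply: h; exact: mulr_le0_ge0 h' (dot_ge0 l1).
have /choice[x_ hx] : forall k : nat, exists x,
    [/\ B x, dot x x <= 1 & lam - k.+1%:R^-1 < q x].
  move=> k; have k0 : 0 < k.+1%:R^-1 :> R by rewrite invr_gt0.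
  by have [_ [x [Bx nx] <-] h] := sup_adherent k0 Esup; exists x.
have [||y [By ny qy]] := lims x_.
- by move=> i; case: (hx i).
- by move=> i; case: (hx i).
have lamy : lam <= q y.
  have c : lam - n.+1%:R^-1 @[n --> U] --> lam - 0.
    apply: cvgB; first exact: cvg_cst.
    exact: (cvg_trans (cvg_app _ Uoo) cvg_harmonic).
  rewrite -[lam]subr0; apply: (ler_cvg_to c qy); apply: nearW => n.
  by case: (hx n) => _ _ /ltW.
exists y, lam; split=> //.
  move=> y0; move: lamy; rewrite /q y0 dotC dot0l leNgt => /negP; exact.
(* Perturbing the maximiser along this residual makes the first variation equal to [dot z z], which
   must therefore vanish. *)
pose z := lam *: y - A y.
have ly := Bl _ By; have lAy := AlB _ By.
have Bz : B z by rewrite /z -scaleN1r; apply: BD; apply: BZ => //; exact: AB.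
have lz := Bl _ Bz; have lAz := AlB _ Bz.
suff z0 : dot z z = 0.
  by apply/esym/eqP; rewrite -subr_eq0; apply/eqP; apply: dot_eq0; rewrite ?z0.
rewrite {1}/z dotBl//; last exact: l2Z.
rewrite dotZl//; clearbody z; apply: (@lin_quad_eq0 _ (lam * dot z z - q z)) => t.
have Btz : B (t *: z) by exact: BZ.
have := scal (y + t *: z) (BD _ _ By Btz).
rewrite dotDD//; last exact: l2Z.
rewrite dotZZ// dotZr// /q AD// AZ//.
rewrite dotDl ?dotDr ?dotZl ?dotZr//; try exact: l2D; try exact: l2Z; last first.
  by apply: l2D => //; exact: l2Z.
rewrite (dotC (A z) y) -As// => h.
have h2 : lam * dot y y <= dot (A y) y.
  by rewrite (le_trans _ lamy)// ler_piMr// ltW.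
rewrite /q; have -> : 2 * t * (lam * dot y z - dot (A y) z) + t ^+ 2 * (lam * dot z z - dot (A z) z)
 = (lam * (dot y y + 2 * (t * dot y z) + t ^+ 2 * dot z z) - (dot (A y) y + t * dot (A y) z +
    (t * dot (A y) z + t * (t * dot (A z) z)))) + (dot (A y) y - lam * dot y y) by ring.
by rewrite addr_ge0 ?subr_ge0.
Qed.

(** [S] need not be closed: [x] is the ultralimit of the residuals y - s of a minimising sequence,
    and y - x is only approximated from [S]. *)
Lemma projection (S : set (int -> R)) y :
  (forall x, S x -> l2 x) -> S 0 ->
  (forall x y, S x -> S y -> S (x + y)) ->
  (forall c x, S x -> S (c *: x)) -> l2 y ->
  exists x, [/\ l2 x, forall s, S s -> dot x s = 0 &
    forall e, 0 < e -> exists2 s, S s & dot (y - x - s) (y - x - s) < e].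
Proof.
move=> Sl S0 SD SZ ly.
pose E := [set dot (y - s) (y - s) | s in S].
have lys s : S s -> l2 (y - s) by move=> Ss; apply: l2B => //; exact: Sl.
have Einf : has_inf E.
  split; first by exists (dot (y - 0) (y - 0)), 0.
  by exists 0 => _ [s Ss <-]; apply: dot_ge0; exact: lys.
pose d := inf E.
have dle s : S s -> d <= dot (y - s) (y - s).
  by move=> Ss; apply: ge_inf; [case: Einf|exists s].
have /choice[s_ hs] : forall k : nat, exists s, S s /\
    dot (y - s) (y - s) < d + k.+1%:R^-1.
  move=> k; have k0 : 0 < k.+1%:R^-1 :> R by rewrite invr_gt0.
  by have [_ [s Ss <-] h] := inf_adherent k0 Einf; exists s.
have [x_ xE] : exists x_ : nat -> int -> R, forall k, x_ k = y - s_ k by exists (fun k => y - s_ k).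
have xl k : l2 (x_ k) by rewrite xE; apply: lys; case: (hs k).
have k1 (k : nat) : k.+1%:R^-1 <= 1 :> R by rewrite invf_le1// ler1n.
have xC k : dot (x_ k) (x_ k) <= d + 1.
  by case: (hs k) => _ /ltW h; rewrite xE (le_trans h)// lerD2l.
have [U [UU Uoo]] := ultra_noo.
have [x xc] := ultra_pointwise UU xl xC.
have [lx _] := l2_fatou xc xl xC.
(* Parallelogram law: the midpoint of two almost minimising elements cannot beat the infimum [d], so
   their residuals are close. *)
have par k l : dot (x_ k - x_ l) (x_ k - x_ l) <= 2 * (k.+1%:R^-1 + l.+1%:R^-1).
  have [Sk hk] := hs k; have [Sl' hl] := hs l.
  have := dle (2^-1 *: (s_ k + s_ l)) (SZ _ _ (SD _ _ Sk Sl')).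
  have -> : y - 2^-1 *: (s_ k + s_ l) = 2^-1 *: (x_ k + x_ l).
    by apply/funext => m; rewrite !xE !fctE /= /GRing.scale /=; field.
  rewrite dotZZ; last exact: l2D.
  rewrite dotDD// dotBB// => h.
  rewrite -xE in hk; rewrite -xE in hl.
  have e4 : (2^-1 : R) ^+ 2 = 4^-1 by rewrite exprVn; congr (_^-1); ring.
  rewrite e4 in h.
  have {}h : 4 * d <= dot (x_ k) (x_ k) + 2 * dot (x_ k) (x_ l) + dot (x_ l) (x_ l).
    by rewrite mulrC -ler_pdivlMr// mulrC.
  move: h hk hl; move: (k.+1%:R^-1) (l.+1%:R^-1) => p q; lra.
(* Letting l run along [U] with l >= k turns 2 (1/(k+1) + 1/(l+1)) into at most 4/(k+1). *)
have strong k : dot (x_ k - x) (x_ k - x) <= 4 * k.+1%:R^-1.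
  apply: (proj2 (@l2_fatou_near _ _ U _ (fun l => x_ k - x_ l) _ _ _ _)).
    by move=> m; apply: cvgB; [exact: cvg_cst|exact: xc].
  move=> L; apply: Uoo; exists k => // l /= kl.
  rewrite (le_trans (wsum_le_dot L (l2B (xl k) (xl l))))//.
  rewrite (le_trans (par k l))//.
  have : l.+1%:R^-1 <= k.+1%:R^-1 :> R by rewrite lef_pV2 ?posrE// ler_nat.
  move: (k.+1%:R^-1) (l.+1%:R^-1) => p q; lra.
exists x; split=> // [s Ss|e e0].
  have ls := Sl _ Ss.
  have w := weak_cvg xc xl xC ls.
  suff : - dot x s = 0 by move/eqP; rewrite oppr_eq0 => /eqP.
  apply: (@lin_quad_eq0 _ (dot s s)) => t.
  have c : 2 * t * (- dot (x_ k) s) + t ^+ 2 * dot s s + k.+1%:R^-1 @[k --> U] -->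
     2 * t * (- dot x s) + t ^+ 2 * dot s s + 0.
    apply: cvgD; last exact: (cvg_trans (cvg_app _ Uoo) cvg_harmonic).
    apply: cvgD; last exact: cvg_cst.
    by apply: cvgM; [exact: cvg_cst|apply: cvgN; exact: w].
  rewrite -[leRHS]addr0; apply: (cvgr_to_ge c); apply: nearW => k.
  have [Sk hk] := hs k.
  have := dle (s_ k + t *: s) (SD _ _ Sk (SZ _ _ Ss)).
  have -> : y - (s_ k + t *: s) = x_ k - t *: s by rewrite xE opprD addrA.
  rewrite dotBB//; last exact: l2Z.
  rewrite dotZr// dotZZ// => h; rewrite -xE in hk.
  move: h hk; move: (k.+1%:R^-1) => p; lra.
have /cvgr_lt/(_ (e / 4)) := @cvg_harmonic R.
rewrite divr_gt0// => /(_ isT)[k _ /(_ k (leqnn _)) /= hk].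
exists (s_ k); first by case: (hs k).
have -> : y - x - s_ k = x_ k - x by rewrite xE addrAC.
by rewrite (le_lt_trans (strong k))// mulrC -ltr_pdivlMr.
Qed.

End Hilbert.

(** * Conservation and uniqueness for the Schroedinger equation *)

Section Derive.
Context {R : realType}.
Implicit Types (f df : R -> R).

Lemma is_derive_eps f (t l : R) :
  (forall eps, 0 < eps -> exists2 dl : R, 0 < dl & forall h, 0 < `|h| < dl ->
     `|(f (t + h) - f t) / h - l| <= eps) -> is_derive t 1 f l.
Proof.
move=> H.
have c : h^-1 *: ((f \o shift t) (h *: 1) - f t) @[h --> 0^'] --> l.
  apply/cvgrPdist_le => e e0; have [dl dl0 hd] := H _ e0.
  near=> h.
  have h0 : h != 0 by near: h; exact: nbhs_dnbhs_neq.
  have hdl : `|h| < dl.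
    near: h; apply: dnbhs0_lt; exact: dl0.
  have := hd h; rewrite normr_gt0 h0 hdl => /(_ isT).
  have -> : h^-1 *: ((f \o shift t) (h *: 1) - f t) = (f (t + h) - f t) / h.
    by rewrite /shift /= /GRing.scale /= mulr1 (addrC h) mulrC.
  by rewrite distrC.
split; first by apply: cvgP; exact: c.
exact: cvg_lim c.
Unshelve. all: by end_near. Qed.

Lemma is_derive_mvt f df (s t : R) : s <= t ->
  (forall x : R, is_derive x (1:R) f (df x)) ->
  exists2 c, s <= c <= t & f t - f s = df c * (t - s).
Proof.
move=> st H.
have [|c] := MVT_segment st (fun x _ => H x).
  apply: continuous_subspaceT => x; apply: differentiable_continuous.
  by apply/derivable1_diffP; have [] := H x.
by rewrite in_itv /= => cst E; exists c.
Qed.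

Lemma is_derive_bound f df (s t K : R) : s <= t ->
  (forall x : R, is_derive x (1:R) f (df x)) ->
  (forall x, s <= x <= t -> `|df x| <= K) -> `|f t - f s| <= K * (t - s).
Proof.
move=> st H HK; have [c cst ->] := is_derive_mvt st H.
by rewrite normrM (ger0_norm (_ : 0 <= t - s)) ?subr_ge0// ler_wpM2r ?HK// subr_ge0.
Qed.

Lemma is_derive_wsum (f : R -> int -> R) (df : int -> R) (t : R) L :
  (forall m, is_derive t 1 (fun t => f t m) (df m)) ->
  is_derive t 1 (fun t => wsum (f t) L) (wsum df L).
Proof.
move=> H; elim: L => [|L IH].
  by rewrite wsum0; under eq_fun do rewrite wsum0; exact: is_derive_cst.
rewrite wsumS; under eq_fun do rewrite wsumS.
by apply: is_deriveD; apply: is_deriveD.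
Qed.

Lemma is_derive_sq f (t d : R) : is_derive t 1 f d ->
  is_derive t 1 (fun t => f t ^+ 2) (2 * f t * d).
Proof.
move=> H; rewrite (_ : (fun t => f t ^+ 2) = f * f); last first.
  by apply/funext => x; rewrite expr2.
apply: is_derive_eq (is_deriveM H H) _.
by rewrite /GRing.scale /=; ring.
Qed.

Lemma arch_le0 (x y : R) : (forall K : nat, K%:R * x <= y) -> x <= 0.
Proof.
move=> H; rewrite leNgt; apply/negP => x0.
have y0 : 0 <= y by have := H 0%N; rewrite mul0r.
have := H (Num.bound (y / x)); rewrite -ler_pdivlMr// leNgt.
by rewrite archi_boundP// divr_ge0// ltW.
Qed.

End Derive.

Section Conservation.
Context {R : realType}.
Context (a w : int -> R) (aM : R) (a_bd : forall n, `|a n| <= aM).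
Implicit Types (p q : R -> int -> R).

Definition coord_sol p q := forall (t : R) (m : int),
  is_derive t 1 (fun t => p t m) (Japp a w (q t) m) /\
  is_derive t 1 (fun t => q t m) (- Japp a w (p t) m).

Definition energy_at p q t := fun m : int => sq (p t) m + sq (q t) m.

Lemma energy_ge0 p q t m : 0 <= energy_at p q t m.
Proof. by rewrite addr_ge0 ?sqr_ge0. Qed.

Lemma is_derive_energy p q (t : R) L : coord_sol p q ->
  is_derive t 1 (fun t => wsum (energy_at p q t) L.+1)
    (2 * (wronsk a (p t) (q t) (Posz L) - wronsk a (p t) (q t) (Negz L.+1))).
Proof.
move=> S; rewrite -(wsum_wronsk a w) -wsumZ; apply: is_derive_wsum => m.
have [hp hq] := S t m.
apply: is_derive_eq (is_deriveD (is_derive_sq hp) (is_derive_sq hq)) _.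
by ring.
Qed.

(* Boundary terms averaged over many windows are negligible, because the norm
   stays bounded. *)
Lemma energy_le p q (C D s t : R) : coord_sol p q ->
  (forall x L, Num.min s t <= x <= Num.max s t -> wsum (energy_at p q x) L <= C) ->
  (forall L, wsum (energy_at p q s) L <= D) -> forall L, wsum (energy_at p q t) L <= D.
Proof.
move=> S HC HD L0.
pose G K x := \sum_(L0 <= L < L0 + K) wsum (energy_at p q x) L.+1.
pose dG K x := \sum_(L0 <= L < L0 + K)
   (2 * (wronsk a (p x) (q x) (Posz L) - wronsk a (p x) (q x) (Negz L.+1))).
have GdG (K : nat) (x : R) : is_derive x 1 (G K) (dG K x).
  elim: K => [|K IH].
    rewrite /G /dG addn0 big_geq//; under eq_fun do rewrite big_geq//.
    exact: is_derive_cst.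
  rewrite /G /dG addnS big_nat_recr ?leq_addr//=.
  under eq_fun do rewrite big_nat_recr ?leq_addr//=.
  by apply: is_deriveD => //; exact: is_derive_energy.
have aM0 : 0 <= aM by apply: le_trans (a_bd 0).
(* Different windows have their boundary edges at different sites, so the sum of all boundary terms
   is controlled by twice the total energy, uniformly in [K]. Dividing by [K] then removes it. *)
have dGb K x : Num.min s t <= x <= Num.max s t -> `|dG K x| <= 4 * aM * C.
  move=> xst; rewrite (le_trans (ler_norm_sum _ _ _))//.
  pose e k := energy_at p q x (Posz k) + energy_at p q x (Negz k).
  apply: (@le_trans _ _ (\sum_(L0 <= L < L0 + K) (2 * aM * (e L + e L.+1)))).
    apply: ler_sum => L _; rewrite normrM ger0_norm// -mulrA ler_pM2l//.
    apply: le_trans (ler_normB _ _) _.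
    apply: le_trans (lerD (wronsk_le a_bd _ _ _) (wronsk_le a_bd _ _ _)) _.
    rewrite -mulrDr ler_wpM2l// /e /energy_at /sq.
    rewrite (_ : Negz L.+1 + 1 = Negz L); last by lia.
    rewrite (_ : Posz L + 1 = Posz L.+1); last by lia.
    lra.
  rewrite -mulr_sumr big_split/= (_ : 4 * aM * C = 2 * aM * (C + C)); last by ring.
  rewrite ler_wpM2l ?mulr_ge0//.
  have e0 k : 0 <= e k by rewrite addr_ge0 ?energy_ge0.
  have sub i j : \sum_(i <= k < j) e k <= C.
    apply: le_trans (HC x j xst).
    have [ij|ji] := leqP i j.
      rewrite /wsum [leRHS](big_cat_nat (leq0n i) ij)//= lerDr; apply: sumr_ge0 => k _; exact: e0.
    by rewrite big_geq ?wsum_ge0//; [move=> m; exact: energy_ge0|exact: ltnW].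
  rewrite lerD//; apply: le_trans (sub L0.+1 (L0 + K).+1).
  by rewrite big_add1.
have GB K : `|G K t - G K s| <= 4 * aM * C * `|t - s|.
  have [st|ts] := leP s t.
    rewrite (ger0_norm (_ : 0 <= t - s)) ?subr_ge0//.
    apply: (is_derive_bound st (GdG K)) => x xst; apply: dGb.
    by rewrite min_l ?max_r.
  have st0 : 0 <= s - t by rewrite subr_ge0 ltW.
  rewrite distrC (distrC t) (ger0_norm st0).
  apply: (is_derive_bound (ltW ts) (GdG K)) => x xst.
  by apply: dGb; rewrite (min_r (ltW ts)) (max_l (ltW ts)).
rewrite -subr_le0; apply: (@arch_le0 _ _ (4 * aM * C * `|t - s|)) => K.
have nat_const (x : R) : K%:R * x = \sum_(L0 <= L < L0 + K) x.
  by rewrite big_const_nat addKn iter_addr addr0 mulr_natl.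
have h1 : K%:R * wsum (energy_at p q t) L0 <= G K t.
  rewrite nat_const; apply: ler_sum_nat => i /andP[Li _]; apply: wsum_nd.
    by move=> m; exact: energy_ge0.
  exact: leqW.
have h2 : G K s <= K%:R * D.
  by rewrite nat_const; apply: ler_sum => i _; exact: HD.
have := le_trans (ler_norm _) (GB K); rewrite mulrBr; lra.
Qed.

End Conservation.

(** * Uniqueness of strong solutions *)

Section Uniqueness.
Context {R : realType}.
Context (a w : int -> R) (aM : R) (a_bd : forall n, `|a n| <= aM).

Lemma coord_le_l2n2 (f : int -> R) m c : (l2n2 f < c%:E)%E -> f m ^+ 2 <= c.
Proof.
move=> fc; rewrite -lee_fin; apply: le_trans (ltW fc).
apply: le_trans (wsum_le_l2n2 f (`|m|.+1)%N); rewrite lee_fin.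
apply: (@wsum_mem _ (sq f)) => [k|]; first exact: sq_ge0.
by apply/andP; split; lia.
Qed.

Lemma sqr_le_norm (x e : R) : 0 <= e -> x ^+ 2 <= e ^+ 2 -> `|x| <= e.
Proof.
by move=> e0 h; rewrite -ler_sqr ?nnegrE// real_normK ?num_real.
Qed.

Lemma schrod_coord n u v : schrod_sol a w n u v -> coord_sol a w u v.
Proof.
move=> [_ _ _ Hu Hv] t m; split; apply: is_derive_eps => e e0.
  have [dl dl0 h] := Hu t _ (exprn_gt0 2 e0); exists dl => // k /h /(coord_le_l2n2 m).
  by move/(sqr_le_norm (ltW e0)).
have [dl dl0 h] := Hv t _ (exprn_gt0 2 e0); exists dl => // k /h /(coord_le_l2n2 m).
by move/(sqr_le_norm (ltW e0)); rewrite opprK.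
Qed.

Lemma derivable_locally_bounded (f : R -> int -> R) (g : R -> int -> R) (t : R) :
  in_l2 (f t) -> in_l2 (g t) ->
  (forall eps, 0 < eps -> exists2 dl : R, 0 < dl & forall h : R, 0 < `|h| < dl ->
     (l2n2 (fun k => (f (t + h) k - f t k) / h - g t k)%R < eps%:E)%E) ->
  exists2 dl : R, 0 < dl & exists C, forall s, `|s - t| < dl ->
    forall L, wsum (sq (f s)) L <= C.
Proof.
move=> /in_l2P[C fC] /in_l2P[D gD] /(_ 1 ltr01)[dl dl0 H].
have C0 : 0 <= C by have := fC 0%N; rewrite wsum0.
have D0 : 0 <= D by have := gD 0%N; rewrite wsum0.
exists (Num.min dl 1); first by rewrite lt_min dl0 ltr01.
exists (2 * C + 4 * D + 4) => s; rewrite lt_min => /andP[sd s1] L.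
have [->|st] := eqVneq s t; first by have := fC L; lra.
pose h := s - t; have h0 : h != 0 by rewrite subr_eq0.
have := H h; rewrite normr_gt0 h0 sd => /(_ isT).
set r := (fun k => _) => r1.
have hs : t + h = s by rewrite /h; ring.
have E k : f s k = f t k + h * (g t k + r k) by rewrite /r hs; field.
apply: (@le_trans _ _ (wsum (fun k => 2 * sq (f t) k + (4 * sq (g t) k + 4 * sq r k)) L)).
  apply: ler_wsum => k; rewrite /sq E.
  have hh : h ^+ 2 <= 1 by rewrite -real_normK ?num_real// expr_le1// ltW.
  have := sqr_ge0 (f t k - h * (g t k + r k)).
  have h2 := sqr_ge0 (g t k - r k).
  have h3 : h ^+ 2 * (g t k + r k) ^+ 2 <= (g t k + r k) ^+ 2.
    by rewrite ler_piMl ?sqr_ge0.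
  nra.
rewrite !wsumD !wsumZ.
have rL : wsum (sq r) L <= 1.
  by rewrite -lee_fin; apply: le_trans (ltW r1); exact: wsum_le_l2n2.
have := fC L; have := gD L; lra.
Qed.

(** [energy_le] presupposes a norm bound on the time interval. Differentiability in l2 gives one
    near each time, and compactness makes it uniform. *)
Lemma schrod_locbdd n u v : schrod_sol a w n u v -> forall s t : R,
  exists C, forall x L, s <= x <= t -> wsum (energy_at u v x) L <= C.
Proof.
move=> [_ _ Hl Hu Hv] s t.
have /compact_near_coveringP := @segment_compact R s t.
move=> /(_ nat \oo (fun N x => forall L, wsum (energy_at u v x) L <= N%:R) _) [].
  move=> x _; have [l1 l2 l3 l4] := Hl x.
  have [d1 d10 [C1 h1]] := @derivable_locally_bounded u (fun t => Japp a w (v t)) x l1 l4 (Hu x).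
  have l3' : in_l2 (- Japp a w (u x)) by apply/in_l2P/l2N/in_l2P.
  have [|d2 d20 [C2 h2]] := @derivable_locally_bounded v (fun t => - Japp a w (u t)) x l2 l3' _.
    move=> e e0; have [d d0 h] := Hv x _ e0; exists d => // k /h hk.
    rewrite (_ : l2n2 _ = l2n2 (fun k0 : int =>
      (v (x + k) k0 - v x k0) / k + Japp a w (u x) k0))//.
    by congr l2n2; apply/funext => m; rewrite opprK.
  exists ([set y | `|y - x| < Num.min d1 d2], [set N : nat | C1 + C2 <= N%:R]).
    split; last exact: nbhs_infty_ger.
    apply/nbhs_ballP; exists (Num.min d1 d2); first by rewrite /= lt_min d10 d20.
    by move=> y; rewrite /ball /= distrC.
  move=> [y N] /= [yd CN] L; move: yd; rewrite lt_min => /andP[yd1 yd2].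
  by rewrite /energy_at wsumD (le_trans _ CN)// lerD// ?h1 ?h2.
move=> N _ /(_ N (leqnn N)) H; exists N%:R => x L xst; apply: H.
by rewrite /= in_itv.
Qed.

(** The difference of two solutions solves the equation with zero initial energy, which [energy_le]
    propagates to time t. *)
Lemma schrod_unique n u1 v1 u2 v2 :
  schrod_sol a w n u1 v1 -> schrod_sol a w n u2 v2 -> u1 = u2 /\ v1 = v2.
Proof.
move=> s1 s2.
pose p t := u1 t - u2 t; pose q t := v1 t - v2 t.
have c1 := schrod_coord s1; have c2 := schrod_coord s2.
have S : coord_sol a w p q.
  move=> t m; have [a1 b1] := c1 t m; have [a2 b2] := c2 t m.
  rewrite /p /q !JappB; split; first exact: is_deriveB.
  by rewrite (_ : - _ = - Japp a w (u1 t) m - - Japp a w (u2 t) m);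
    [exact: is_deriveB | rewrite !fctE; ring].
suff H t L : wsum (energy_at p q t) L <= 0.
  have Z t m : p t m = 0 /\ q t m = 0.
    have := H t (`|m|.+1)%N.
    have : energy_at p q t m <= wsum (energy_at p q t) (`|m|.+1)%N.
      by apply: wsum_mem => [k|]; [exact: energy_ge0|apply/andP; split; lia].
    rewrite /energy_at /sq => h1 h2; have h3 := le_trans h1 h2.
    have := sqr_ge0 (p t m); have := sqr_ge0 (q t m) => h4 h5.
    by split; apply/eqP; rewrite -sqrf_eq0 eq_le ?h4 ?h5 andbT; lra.
  split; apply/funext => t; apply/funext => m; apply/eqP; rewrite -subr_eq0.
    by apply/eqP; case: (Z t m).
  by apply/eqP; case: (Z t m).
have [C1 h1] := schrod_locbdd s1 (Num.min 0 t) (Num.max 0 t).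
have [C2 h2] := schrod_locbdd s2 (Num.min 0 t) (Num.max 0 t).
apply: (energy_le a_bd (C := 2 * C1 + 2 * C2) (s := 0) S).
  move=> x L' xt; apply: (@le_trans _ _
    (wsum (fun m => 2 * energy_at u1 v1 x m + 2 * energy_at u2 v2 x m) L')).
    apply: ler_wsum => m; rewrite /energy_at /sq /p /q !fctE.
    have := sqr_ge0 (u1 x m + u2 x m); have := sqr_ge0 (v1 x m + v2 x m); nra.
  by rewrite wsumD !wsumZ lerD// ler_pM2l// ?h1 ?h2.
move=> L'; rewrite (_ : wsum _ _ = wsum (fun=> 0 * 0) L'); first by rewrite wsumZ mul0r.
case: s1 => e1 e2 _ _ _; case: s2 => e3 e4 _ _ _.
by apply: eq_wsum => m; rewrite /energy_at /sq /p /q e1 e2 e3 e4 !subrr !expr0n mul0r addr0.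
Qed.

End Uniqueness.

(** * Truncated dynamics and existence *)

Section Egf.
Context {R : realType}.
Implicit Types (b c : nat -> R) (t : R).

(** The exponential generating function sum of b_k t^k / k!: differentiating in t shifts [b], so it
    solves linear equations coefficientwise. *)
Definition egf b t : R := limn (pseries (fun k => b k / k`!%:R) t).

Definition geo_bnd b := exists D C, [/\ 0 <= D, 0 <= C & forall k, `|b k| <= D * C ^+ k].

Lemma geo_bnd_shift b : geo_bnd b -> geo_bnd (fun k => b k.+1).
Proof.
move=> [D [C [D0 C0 H]]]; exists (D * C), C; split=> //; first exact: mulr_ge0.
by move=> k; rewrite -mulrA -exprS.
Qed.

Lemma egf_cvgP b t : geo_bnd b -> cvgn (pseries (fun k => b k / k`!%:R) t).
Proof.
move=> [D [C [D0 C0 H]]]; apply: normed_cvg.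
apply: (@series_le_cvg _ _ (fun k => D * exp_coeff (C * `|t|) k)).
- by move=> k /=.
- by move=> k; apply: mulr_ge0 => //; apply: exp_coeff_ge0; exact: mulr_ge0.
- move=> k; rewrite /exp_coeff /= !normrM normrX normfV normr_nat exprMn.
  rewrite (_ : D * _ = D * C ^+ k * k`!%:R^-1 * `|t| ^+ k); last by ring.
  by rewrite ler_wpM2r ?exprn_ge0// ler_wpM2r ?invr_ge0.
- rewrite (_ : series _ = fun N => D * series (exp_coeff (C * `|t|)) N).
    have /cvg_ex[l hl] := is_cvg_series_exp_coeff (C * `|t|).
    by apply: (@cvgP _ _ (D * l)); apply: cvgM => //; exact: cvg_cst.
  by apply/funext => N; rewrite /series /= mulr_sumr.
Qed.

Lemma egf_cvg b t : geo_bnd b -> pseries (fun k => b k / k`!%:R) t @ \oo --> egf b t.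
Proof. exact: egf_cvgP. Qed.

Lemma is_derive_egf b t : geo_bnd b -> is_derive t 1 (egf b) (egf (fun k => b k.+1) t).
Proof.
move=> gb.
have E c : pseries_diffs (fun k => c k / k`!%:R) = (fun k => c k.+1 / k`!%:R).
  apply/funext => k; rewrite /pseries_diffs factS natrM invfM mulrCA.
  by rewrite mulVKf// pnatr_eq0.
have g1 := geo_bnd_shift gb; have g2 := geo_bnd_shift g1.
have := @pseries_snd_diffs R (fun k => b k / k`!%:R) (`|t| + 1) t.
rewrite !E; apply; try exact: egf_cvgP.
by rewrite [ltRHS]ger0_norm ?ltrDl// addr_ge0.
Qed.

Lemma egf0 b : egf b 0 = b 0%N.
Proof.
apply: lim_near_cst => //; exists 1%N => // -[//|N] _.
rewrite /pseries /series /= big_nat_recl// big1 ?addr0; last first.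
  by move=> k _; rewrite exprS mul0r mulr0.
by rewrite expr0 mulr1 fact0 divr1.
Qed.

Lemma egfD b c t : geo_bnd b -> geo_bnd c ->
  egf (fun k => b k + c k) t = egf b t + egf c t.
Proof.
move=> gb gc; apply: cvg_lim => //.
rewrite (_ : pseries _ _ = fun N => pseries (fun k => b k / k`!%:R) t N +
   pseries (fun k => c k / k`!%:R) t N).
  by apply: cvgD; exact: egf_cvg.
apply/funext => N; rewrite /pseries /series /= -big_split/=.
by apply: eq_bigr => k _; rewrite mulrDl mulrDl.
Qed.

Lemma egfZ l b t : geo_bnd b -> egf (fun k => l * b k) t = l * egf b t.
Proof.
move=> gb; apply: cvg_lim => //.
rewrite (_ : pseries _ _ = fun N => l * pseries (fun k => b k / k`!%:R) t N).
  by apply: cvgM; [exact: cvg_cst|exact: egf_cvg].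
apply/funext => N; rewrite /pseries /series /= mulr_sumr.
by apply: eq_bigr => k _; rewrite !mulrA.
Qed.

End Egf.

Section Trunc.
Context {R : realType}.
Context (a w : int -> R) (aM wM : R).
Context (a_bd : forall n, `|a n| <= aM) (w_bd : forall n, `|w n| <= wM).
Implicit Types (x y : int -> R).
Let J := Japp a w.

(** Real and imaginary parts of (-iJ)^k x, since -iJ(p + i q) = Jq - i Jp. *)
Definition taylor_iter (a w x : int -> R) k : (int -> R) * (int -> R) :=
  iter k (fun p => (Japp a w p.2, - Japp a w p.1)) (x, 0).

Lemma Japp0 : J 0 = 0.
Proof. by apply/funext => m; rewrite /J /Japp !mulr0 !addr0. Qed.

Lemma taylor_iterS x k : taylor_iter a w x k.+1 = (J (taylor_iter a w x k).2, - J (taylor_iter a w x k).1).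
Proof. by []. Qed.

Lemma taylor_iterJ x k : taylor_iter a w (J x) k = (J (taylor_iter a w x k).1, J (taylor_iter a w x k).2).
Proof.
elim: k => [|k IH]; first by rewrite /= Japp0.
by rewrite !taylor_iterS IH /= /J JappN.
Qed.

Lemma taylor_iterD x y k : taylor_iter a w (x + y) k =
  ((taylor_iter a w x k).1 + (taylor_iter a w y k).1, (taylor_iter a w x k).2 + (taylor_iter a w y k).2).
Proof.
elim: k => [|k IH]; first by rewrite /= addr0.
by rewrite !taylor_iterS IH /= /J !JappD opprD.
Qed.

Lemma taylor_iterZ c x k : taylor_iter a w (c *: x) k =
  (c *: (taylor_iter a w x k).1, c *: (taylor_iter a w x k).2).
Proof.
elim: k => [|k IH]; first by rewrite /= scaler0.
by rewrite !taylor_iterS IH /= /J !JappZ scalerN.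
Qed.

Definition sbnd x := exists D, forall m, `|x m| <= D.

(** For bounded coefficients [J] has supremum norm at most 2 aM + wM, which gives geometric growth
    of the iterates without any appeal to l2. *)
Lemma taylor_iter_bnd x m : sbnd x ->
  geo_bnd (fun k => (taylor_iter a w x k).1 m) /\ geo_bnd (fun k => (taylor_iter a w x k).2 m).
Proof.
move=> [D xD].
have D0 : 0 <= D by apply: le_trans (xD 0).
have aM0 : 0 <= aM by apply: le_trans (a_bd 0).
have wM0 : 0 <= wM by apply: le_trans (w_bd 0).
pose C := aM + aM + wM.
have C0 : 0 <= C by rewrite !addr_ge0.
have JB y B : 0 <= B -> (forall m, `|y m| <= B) -> forall m, `|J y m| <= C * B.
  move=> B0 yB k; rewrite /J /Japp /C !mulrDl.
  apply: le_trans (ler_normD _ _) _; apply: lerD.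
    apply: le_trans (ler_normD _ _) _; apply: lerD.
  - by rewrite normrM ler_pM.
  - by rewrite normrM ler_pM.
  - by rewrite normrM ler_pM.
have H k : forall m, `|(taylor_iter a w x k).1 m| <= D * C ^+ k /\
   `|(taylor_iter a w x k).2 m| <= D * C ^+ k.
  elim: k => [|k IH] j; first by rewrite /= mulr1 normr0.
  rewrite taylor_iterS /= normrN exprS mulrCA.
  by split; apply: JB => [|i]; rewrite ?mulr_ge0 ?exprn_ge0//; case: (IH i).
by split; exists D, C; split=> // k; case: (H k m).
Qed.

(* exp(-itJ) x = ucos t + i usin t, coordinatewise as power series in t. *)
Definition ucos (a w x : int -> R) t m := egf (fun k => (taylor_iter a w x k).1 m) t.
Definition usin (a w x : int -> R) t m := egf (fun k => (taylor_iter a w x k).2 m) t.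

Lemma egf_Japp (b : nat -> int -> R) t m : (forall m, geo_bnd (fun k => b k m)) ->
  egf (fun k => J (b k) m) t = J (fun m => egf (fun k => b k m) t) m.
Proof.
move=> gb; rewrite /J /Japp.
have gZ c k : geo_bnd (fun i => c * b i k).
  have [D [C [D0 C0 H]]] := gb k.
  exists (`|c| * D), C; split => // [|i]; first by rewrite mulr_ge0.
  by rewrite normrM -mulrA ler_wpM2l.
have gD c c' k k' : geo_bnd (fun i => c * b i k + c' * b i k').
  have [D [C [D0 C0 H]]] := gZ c k; have [D' [C' [D'0 C'0 H']]] := gZ c' k'.
  exists (D + D'), (Num.max C C'); split => [||i].
  - exact: addr_ge0.
  - by rewrite le_max C0.
  - apply: le_trans (ler_normD _ _) _; rewrite mulrDl lerD//.
      by apply: le_trans (H i) _; rewrite ler_wpM2l// lerXn2r ?nnegrE ?le_max ?C0 ?lexx.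
    by apply: le_trans (H' i) _; rewrite ler_wpM2l// lerXn2r ?nnegrE ?le_max ?C'0 ?lexx ?orbT.
by rewrite !egfD// !egfZ.
Qed.

Lemma ucos_sol x : sbnd x -> coord_sol a w (ucos a w x) (usin a w x).
Proof.
move=> xb t m; have g i := taylor_iter_bnd i xb; split.
  rewrite -/J -[J _ m](egf_Japp t m (fun i => proj2 (g i))).
  exact: is_derive_egf (proj1 (g m)).
have gJ : geo_bnd (fun k => J (taylor_iter a w x k).1 m).
  have [D [C [D0 C0 H]]] := geo_bnd_shift (proj2 (g m)).
  by exists D, C; split=> // k; have := H k; rewrite taylor_iterS /= normrN.
rewrite -/J -[J _ m](egf_Japp t m (fun i => proj1 (g i))) -mulN1r -egfZ//.
apply: is_derive_eq (is_derive_egf t (proj2 (g m))) _.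
by congr egf; apply/funext => k; rewrite taylor_iterS mulN1r.
Qed.

Lemma sbnd_Japp x : sbnd x -> sbnd (J x).
Proof.
move=> [D xD]; exists (aM * D + aM * D + wM * D) => m; rewrite /J /Japp.
apply: le_trans (ler_normD _ _) _; apply: lerD.
  apply: le_trans (ler_normD _ _) _; apply: lerD.
- by rewrite normrM ler_pM.
- by rewrite normrM ler_pM.
- by rewrite normrM ler_pM.
Qed.

Lemma ucosJ x t : sbnd x -> ucos a w (J x) t = J (ucos a w x t).
Proof.
move=> xb; apply/funext => m; rewrite /ucos -egf_Japp.
  by congr egf; apply/funext => k; rewrite taylor_iterJ.
by move=> i; case: (taylor_iter_bnd i xb).
Qed.

Lemma usinJ x t : sbnd x -> usin a w (J x) t = J (usin a w x t).
Proof.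
move=> xb; apply/funext => m; rewrite /usin -egf_Japp.
  by congr egf; apply/funext => k; rewrite taylor_iterJ.
by move=> i; case: (taylor_iter_bnd i xb).
Qed.

Lemma ucosD x y t m : sbnd x -> sbnd y ->
  ucos a w (x + y) t m = ucos a w x t m + ucos a w y t m.
Proof.
move=> xb yb; rewrite /ucos -egfD.
- by congr egf; apply/funext => k; rewrite taylor_iterD.
- by case: (taylor_iter_bnd m xb).
- by case: (taylor_iter_bnd m yb).
Qed.

Lemma usinD x y t m : sbnd x -> sbnd y ->
  usin a w (x + y) t m = usin a w x t m + usin a w y t m.
Proof.
move=> xb yb; rewrite /usin -egfD.
- by congr egf; apply/funext => k; rewrite taylor_iterD.
- by case: (taylor_iter_bnd m xb).
- by case: (taylor_iter_bnd m yb).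
Qed.

Lemma ucosZ c x t m : sbnd x -> ucos a w (c *: x) t m = c * ucos a w x t m.
Proof.
move=> xb; rewrite /ucos -egfZ.
  by congr egf; apply/funext => k; rewrite taylor_iterZ.
by case: (taylor_iter_bnd m xb).
Qed.

Lemma usinZ c x t m : sbnd x -> usin a w (c *: x) t m = c * usin a w x t m.
Proof.
move=> xb; rewrite /usin -egfZ.
  by congr egf; apply/funext => k; rewrite taylor_iterZ.
by case: (taylor_iter_bnd m xb).
Qed.

Lemma ucos0 x : ucos a w x 0 = x.
Proof. by apply/funext => m; rewrite /ucos egf0. Qed.

Lemma usin0 x : usin a w x 0 = 0.
Proof. by apply/funext => m; rewrite /usin egf0. Qed.

End Trunc.

Section VecMvt.
Context {R : realType}.

(* The scalar mean value theorem is applied to the pairing with the increment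
   itself. *)
Lemma vec_mvt (g dg : R -> int -> R) L B (s t : R) :
  (forall (x : R) m, is_derive x (1 : R) (fun x => g x m) (dg x m)) ->
  (forall x, Num.min s t <= x <= Num.max s t -> wsum (sq (dg x)) L <= B) ->
  wsum (sq (fun m => g t m - g s m)) L <= B * (t - s) ^+ 2.
Proof.
move=> H HB.
wlog st : s t HB / s <= t.
  move=> W; have [/W|ts] := leP s t; first exact.
  rewrite (_ : wsum _ L = wsum (sq (fun m => g s m - g t m)) L).
    rewrite -[(t - s) ^+ 2]sqrrN opprB; apply: W => [x|]; last exact: ltW.
    by rewrite minC maxC; exact: HB.
  by apply: eq_wsum => m; rewrite /sq -sqrrN opprB.
pose z m := g t m - g s m.
have D (x : R) : is_derive x (1 : R) (fun x => wsum (fun m => z m * g x m) L)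
    (wsum (fun m => z m * dg x m) L).
  by apply: is_derive_wsum => m; apply: is_derive_eq (is_deriveZ (z m) (H x m)) _.
have [c cst E] := is_derive_mvt st D.
have h1 : wsum (sq z) L = wsum (fun m => z m * dg c m) L * (t - s).
  by rewrite -E -wsumB; apply: eq_wsum => m; rewrite /sq /z; ring.
have h2 : wsum (fun m => z m * dg c m) L * (t - s) <=
    2^-1 * (wsum (sq z) L + (t - s) ^+ 2 * wsum (sq (dg c)) L).
  rewrite -wsumZ -wsumD -wsumZ mulrC -wsumZ; apply: ler_wsum => m.
  rewrite /sq; have := sqr_ge0 (z m - (t - s) * dg c m); lra.
have h3 : wsum (sq (dg c)) L <= B by apply: HB; rewrite min_l ?max_r.
have h4 : (t - s) ^+ 2 * wsum (sq (dg c)) L <= (t - s) ^+ 2 * B.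
  by rewrite ler_wpM2l ?sqr_ge0.
rewrite -h1 in h2; rewrite -/z; lra.
Qed.

End VecMvt.

(** * Finite truncations and their uniform estimates *)

Section Truncation.
Context {R : realType}.
Context (a w : int -> R) (aM : R) (a_bd : forall n, `|a n| <= aM).
Implicit Types (x y : int -> R) (N L : nat).

(* The truncated operator only links sites inside the window
   [-(N+1), N], hence conserves the energy in that window. *)
Definition atr (N : nat) k := if (- Posz N.+1 <= k) && (k < Posz N) then a k else 0.
Definition wtr (w : int -> R) (N : nat) k :=
  if (- Posz N.+1 <= k) && (k <= Posz N) then w k else 0.

Lemma atr_bd N n : `|atr N n| <= aM.
Proof.
rewrite /atr; case: ifP => // _.
by rewrite normr0; apply: le_trans (a_bd 0).
Qed.

(** This bound may grow with [N]; it only serves convergence of the power series. The estimates that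
    survive the limit come from energy conservation. *)
Lemma wtr_bd N n : `|wtr w N n| <= wsum (fun m => `|w m|) N.+1.
Proof.
rewrite /wtr; case: ifP => [h|_]; last by rewrite normr0 wsum_ge0.
by apply: (@wsum_mem _ (fun m => `|w m|)) => //; lia.
Qed.

Definition Jtr N := Japp (atr N) (wtr w N).
Definition utr N x := ucos (atr N) (wtr w N) x.
Definition vtr N x := usin (atr N) (wtr w N) x.

Lemma utr_sol N x : sbnd x -> coord_sol (atr N) (wtr w N) (utr N x) (vtr N x).
Proof. exact: ucos_sol (atr_bd N) (wtr_bd N) _. Qed.

Lemma sbnd_Jtr N x : sbnd x -> sbnd (Jtr N x).
Proof. exact: sbnd_Japp (atr_bd N) (wtr_bd N) _. Qed.

(** The truncated weight vanishes on both edges leaving the window, at [Posz N] and [Negz N.+1], so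
    the boundary Wronskians are zero and conservation is exact. *)
Lemma utr_energy N x t : sbnd x ->
  wsum (energy_at (utr N x) (vtr N x) t) N.+1 = wsum (sq x) N.+1.
Proof.
move=> xb; have S := utr_sol N xb.
have D (s : R) : is_derive s (1 : R)
    (fun s => wsum (energy_at (utr N x) (vtr N x) s) N.+1) 0.
  apply: is_derive_eq (is_derive_energy (s : R) N S) _.
  rewrite /wronsk /atr (_ : _ && _ = false); last by lia.
  by rewrite (_ : (_ <= Negz N.+1) && _ = false) ?mul0r ?subrr ?mulr0//; lia.
have E : wsum (energy_at (utr N x) (vtr N x) 0) N.+1 = wsum (sq x) N.+1.
  apply: eq_wsum => m; rewrite /energy_at /utr /vtr ucos0 usin0 /sq.
  by rewrite [X in _ + X]expr0n addr0.
rewrite -E; exact: is_derive_0_is_cst.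
Qed.

Lemma utr_le N x t : sbnd x -> wsum (sq (utr N x t)) N.+1 <= wsum (sq x) N.+1.
Proof.
move=> xb; rewrite -(utr_energy N t xb); apply: ler_wsum => m.
by rewrite /energy_at lerDl sq_ge0.
Qed.

Lemma vtr_le N x t : sbnd x -> wsum (sq (vtr N x t)) N.+1 <= wsum (sq x) N.+1.
Proof.
move=> xb; rewrite -(utr_energy N t xb); apply: ler_wsum => m.
by rewrite /energy_at lerDr sq_ge0.
Qed.

Lemma utrJ N x t : sbnd x -> utr N (Jtr N x) t = Jtr N (utr N x t).
Proof. exact: ucosJ (atr_bd N) (wtr_bd N) _ _. Qed.

Lemma vtrJ N x t : sbnd x -> vtr N (Jtr N x) t = Jtr N (vtr N x t).
Proof. exact: usinJ (atr_bd N) (wtr_bd N) _ _. Qed.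

(** A Lipschitz derivative gives a remainder of order h^2, that is h^4 for the squared norm:
    [vec_mvt] is applied to [g] minus its tangent at [t]. *)
Lemma second_order_bound (g dg : R -> int -> R) L K t h :
  (forall (x : R) m, is_derive x (1 : R) (fun y : R => g y m) (dg x m)) ->
  (forall s, wsum (sq (fun m => dg s m - dg t m)) L <= K * (s - t) ^+ 2) ->
  wsum (sq (fun m => g (t + h) m - g t m - h * dg t m)) L <= K * h ^+ 4.
Proof.
move=> H HK.
have K0 : 0 <= K.
  by have := HK (t + 1); rewrite addrAC subrr add0r expr1n mulr1; apply: le_trans;
    apply: wsum_ge0 => m; exact: sq_ge0.
have := @vec_mvt _ (fun s m => g s m - (s - t) * dg t m) (fun s m => dg s m - dg t m)
  L (K * h ^+ 2) t (t + h).
rewrite (_ : t + h - t = h); last by ring.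
rewrite -mulrA -exprD => M; apply: le_trans (M _ _).
- rewrite le_eqVlt; apply/orP; left; apply/eqP; apply: eq_wsum => m.
  by rewrite /sq subrr mul0r subr0; congr (_ ^+ 2); ring.
- move=> x m; apply: (is_deriveB (H x m)).
  rewrite (_ : (fun _ => _) = (dg t m) *: (fun s : R => s - t)); last first.
    by apply/funext => s; rewrite /GRing.scale /= mulrC.
  have D : is_derive x (1 : R) (fun s : R => s - t) (1 - 0).
    exact: (is_deriveB (is_derive_id x (1 : R)) (is_derive_cst t x (1 : R))).
  apply: is_derive_eq (is_deriveZ (dg t m) D) _.
  by rewrite subr0 /GRing.scale /= mulr1.
- move=> s hs; apply: le_trans (HK s) _; rewrite ler_wpM2l//.
  rewrite -[(s - t) ^+ 2]real_normK ?num_real// -[h ^+ 2]real_normK ?num_real//.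
  rewrite lerXn2r ?nnegrE//.
  move: hs; case: (leP 0 h) => h0.
    rewrite min_l ?max_r ?lerDl// => /andP[h1 h2].
    by rewrite (ger0_norm h0) ger0_norm ?subr_ge0// lerBlDl.
  have ht : t + h <= t by rewrite gerDl ltW.
  rewrite min_r ?max_l// => /andP[h1 h2].
  rewrite (ltr0_norm h0) ler0_norm ?subr_le0//; lra.
Qed.

(** [J] commutes with the evolution and the evolution does not increase the window norm, so the
    derivative has Lipschitz constant |J J x|. *)
Lemma utr_taylor N x t h : sbnd x ->
  wsum (sq (fun m => utr N x (t + h) m - utr N x t m - h * Jtr N (vtr N x t) m)) N.+1
  <= wsum (sq (Jtr N (Jtr N x))) N.+1 * h ^+ 4 /\
  wsum (sq (fun m => vtr N x (t + h) m - vtr N x t m - h * (- Jtr N (utr N x t) m))) N.+1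
  <= wsum (sq (Jtr N (Jtr N x))) N.+1 * h ^+ 4.
Proof.
move=> xb; have xb1 := sbnd_Jtr N xb; have xb2 := sbnd_Jtr N xb1.
have S := utr_sol N xb; have S1 := utr_sol N xb1.
split.
  apply: (@second_order_bound (utr N x) (fun t => Jtr N (vtr N x t))) => [s m|s].
    by case: (S s m).
  apply: (@vec_mvt _ (fun t => Jtr N (vtr N x t)) (fun t m => - Jtr N (utr N (Jtr N x) t) m)).
    by move=> y m; have [_] := S1 y m; under eq_fun do rewrite vtrJ//.
  move=> y _; rewrite (_ : wsum _ _ = wsum (sq (utr N (Jtr N (Jtr N x)) y)) N.+1).
    exact: utr_le.
  by apply: eq_wsum => m; rewrite /sq sqrrN !utrJ//.
apply: (@second_order_bound (vtr N x) (fun t m => - Jtr N (utr N x t) m)) => [s m|s].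
  by case: (S s m).
apply: (@vec_mvt _ (fun t m => - Jtr N (utr N x t) m) (fun t m => - Jtr N (vtr N (Jtr N x) t) m)).
  move=> y m; have [+ _] := S1 y m; under eq_fun do rewrite utrJ//.
  exact: is_deriveN.
move=> y _; rewrite (_ : wsum _ _ = wsum (sq (vtr N (Jtr N (Jtr N x)) y)) N.+1).
  exact: vtr_le.
by apply: eq_wsum => m; rewrite /sq sqrrN !vtrJ//.
Qed.

End Truncation.

(** * The limit of the truncated dynamics *)

Section Existence.
Context {R : realType}.
Context (a w : int -> R) (aM : R) (a_bd : forall n, `|a n| <= aM).
Implicit Types (x y f : int -> R) (N L : nat).
Local Notation J := (Japp a w).

(** The clauses are window inequalities or coordinate identities, so that they pass to limits. The
    quartic clause is the quantitative form of l2 differentiability; the last one says that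
    exp(-itJ) J delta_n = J exp(-itJ) delta_n, expanded over the neighbours of n. *)
Definition nice_sol (u v : int -> R -> int -> R) : Prop :=
  [/\ forall n, u n 0 = delta n /\ v n 0 = 0,
      forall n t L, wsum (energy_at (u n) (v n) t) L <= 1,
      forall n, exists C, forall t L,
        wsum (sq (J (u n t))) L <= C /\ wsum (sq (J (v n t))) L <= C,
      forall n, exists C, forall t h L,
        wsum (sq (fun m => u n (t + h) m - u n t m - h * J (v n t) m)) L <= C * h ^+ 4 /\
        wsum (sq (fun m => v n (t + h) m - v n t m - h * (- J (u n t) m))) L <= C * h ^+ 4 &
      forall n t,
        J (u n t) = a n *: u (n + 1) t + a (n - 1) *: u (n - 1) t + w n *: u n t /\
        J (v n t) = a n *: v (n + 1) t + a (n - 1) *: v (n - 1) t + w n *: v n t].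

Lemma Japp_delta n :
  J (delta n) = a n *: delta (n + 1) + a (n - 1) *: delta (n - 1) + w n *: delta n.
Proof.
apply/funext => k; rewrite /Japp /delta !fctE /GRing.scale /=.
rewrite (_ : (k + 1 == n) = (k == n - 1)); last by lia.
rewrite (_ : (k - 1 == n) = (k == n + 1)); last by lia.
have E (f : int -> R) i : f k * (k == i)%:R = f i * (k == i)%:R.
  by case: eqVneq => [->|_]; rewrite ?mulr0.
rewrite (E a) (E w) (E (fun k => a (k - 1))).
by rewrite addrK; ring.
Qed.

Lemma l2_Jdelta n : l2 (J (delta n)).
Proof. by rewrite Japp_delta; do 2 (apply: l2D; last exact: l2Z); exact: l2Z. Qed.

Lemma l2_JJdelta n : l2 (J (J (delta n))).
Proof.
rewrite Japp_delta !JappD !JappZ.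
by apply: l2D; [apply: l2D|]; apply: l2Z; exact: l2_Jdelta.
Qed.

Lemma Jtr_eq N f : (forall k, (N <= `|k|)%N -> f k = 0) -> Jtr a w N f = J f.
Proof.
move=> f0; apply/funext => k; rewrite /Jtr /Japp.
have Z (c d : R) m : ((`|m| < N)%N -> c = d) -> c * f m = d * f m.
  by have [mN|/f0 ->] := ltnP `|m| N; [move=> ->|rewrite !mulr0].
congr (_ + _ + _); apply: Z => h; rewrite /atr /wtr; case: ifP => //; lia.
Qed.

Lemma Jtr_delta N n : (`|n| < N)%N -> Jtr a w N (delta n) = J (delta n).
Proof.
move=> nN; apply: Jtr_eq => k kN; rewrite /delta.
by case: eqP => // kn; move: kN; rewrite kn leqNgt nN.
Qed.

Lemma Jtr_Jdelta N n : (`|n|.+1 < N)%N ->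
  Jtr a w N (Jtr a w N (delta n)) = J (J (delta n)).
Proof.
move=> nN; rewrite Jtr_delta; last exact: ltnW.
apply: Jtr_eq => k kN; rewrite Japp_delta /delta !fctE /GRing.scale /=.
rewrite (_ : (k == _) = false); last by lia.
rewrite (_ : (k == _) = false); last by lia.
rewrite (_ : (k == _) = false); last by lia.
by rewrite !mulr0 !addr0.
Qed.

Lemma sbnd_delta n : sbnd (@delta R n).
Proof. by exists 1 => m; rewrite /delta; case: (_ == _); rewrite ?normr1 ?normr0. Qed.

Lemma wsum_sq_delta n L : wsum (sq (@delta R n)) L <= 1.
Proof. by rewrite sq_delta wsum_delta; case: ifP => // _; exact: ler01. Qed.

Local Notation un N n := (utr a w N (delta n)).
Local Notation vn N n := (vtr a w N (delta n)).

Lemma un_energy N n t L : (L <= N.+1)%N -> wsum (energy_at (un N n) (vn N n) t) L <= 1.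
Proof.
move=> LN; apply: le_trans (wsum_sq_delta n N.+1).
rewrite -(utr_energy w a_bd N t (sbnd_delta n)); apply: wsum_nd => // m.
exact: energy_ge0.
Qed.

Lemma un_vn_le1 N n t m : (`|m| <= N)%N -> `|un N n t m| <= 1 /\ `|vn N n t m| <= 1.
Proof.
move=> mN; have h : energy_at (un N n) (vn N n) t m <= 1.
  apply: le_trans (un_energy n t (leqnn N.+1)).
  by apply: wsum_mem => [k|]; [exact: energy_ge0|lia].
have := sqr_ge0 (un N n t m); have := sqr_ge0 (vn N n t m) => h1 h2.
rewrite /energy_at /sq in h.
by split; apply: sqr_le_norm => //; rewrite expr1n; lra.
Qed.

Lemma cvg_sq {I : Type} {F : set_system I} {FF : ProperFilter F}
    (g : I -> int -> R) f m :
  g i m @[i --> F] --> f m -> sq (g i) m @[i --> F] --> sq f m.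
Proof. by move=> h; exact: (cvgM h h). Qed.

Section Along.
Context (U : set_system nat) (UU : UltraFilter U) (Uoo : \oo `<=` U).

Lemma Ularge (K : nat) : U [set N | (K <= N)%N].
Proof. by apply: Uoo; exists K. Qed.

Definition ulim n t m := lim (un N n t m @[N --> U]).
Definition vlim n t m := lim (vn N n t m @[N --> U]).

Lemma ulim_cvg n t m : un N n t m @[N --> U] --> ulim n t m.
Proof.
apply: (ultra_cvg_near (C := 1)); apply: filterS (Ularge `|m|) => N /= mN.
by case: (un_vn_le1 n t mN).
Qed.

Lemma vlim_cvg n t m : vn N n t m @[N --> U] --> vlim n t m.
Proof.
apply: (ultra_cvg_near (C := 1)); apply: filterS (Ularge `|m|) => N /= mN.
by case: (un_vn_le1 n t mN).
Qed.

Lemma Jtr_cvg (g : nat -> int -> R) f m : (forall k, g N k @[N --> U] --> f k) ->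
  Jtr a w N (g N) m @[N --> U] --> J f m.
Proof.
move=> gf.
have ca k : atr a N k @[N --> U] --> a k.
  apply: cvg_near_cst; apply: filterS (Ularge `|k|.+1) => N /= kN.
  by rewrite /atr; case: ifP => //; lia.
have cw k : wtr w N k @[N --> U] --> w k.
  apply: cvg_near_cst; apply: filterS (Ularge `|k|.+1) => N /= kN.
  by rewrite /wtr; case: ifP => //; lia.
by rewrite /Jtr /Japp; apply: cvgD; [apply: cvgD|]; apply: cvgM.
Qed.

Lemma wsum_sq_cvgU (g : nat -> int -> R) f L C :
  (forall k, g N k @[N --> U] --> f k) ->
  U [set N | wsum (sq (g N)) L <= C] -> wsum (sq f) L <= C.
Proof.
move=> gf gC.
have c : wsum (sq (g N)) L @[N --> U] --> wsum (sq f) L.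
  by apply: wsum_cvg => m; exact: cvg_sq.
exact: (cvgr_to_le c).
Qed.

(** Each clause holds for the truncated orbit once [N] is large compared with [L] and [n], and
    involves only finitely many coordinates, so it survives the limit along [U]. *)
Lemma nice_lim : nice_sol ulim vlim.
Proof.
have mono f L N : (L <= N.+1)%N -> wsum (sq f) L <= wsum (sq f) N.+1.
  by move=> LN; apply: wsum_nd => // m; exact: sq_ge0.
split.
- move=> n; split; apply/funext => m; apply: lim_near_cst => //; apply: nearW => N.
    by rewrite /utr ucos0.
  by rewrite /vtr usin0.
- move=> n t L.
  have c : wsum (energy_at (un N n) (vn N n) t) L @[N --> U] --> wsum (energy_at (ulim n) (vlim n) t) L.
    apply: wsum_cvg => m; rewrite /energy_at; apply: cvgD.
      by apply: cvg_sq; exact: ulim_cvg.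
    by apply: cvg_sq; exact: vlim_cvg.
  apply: (cvgr_to_le c); apply: filterS (Ularge L) => N /= LN.
  by apply: un_energy; exact: leqW.
(* [delta n] has finite support, so for large [N] the truncated operator agrees with [J] on it and
   the bound does not depend on [N]. *)
- move=> n; exists (dot (J (delta n)) (J (delta n))) => t L; split.
    apply: (wsum_sq_cvgU (g := fun N => Jtr a w N (un N n t))).
      by move=> k; apply: Jtr_cvg => j; exact: ulim_cvg.
    apply: filterS (filterI (Ularge L) (Ularge `|n|.+1)) => N /= [LN nN].
    apply: le_trans (mono _ _ _ (leqW LN)) _.
    rewrite -(utrJ w a_bd N t (sbnd_delta n)).
    apply: le_trans (utr_le w a_bd N t (sbnd_Jtr w a_bd N (sbnd_delta n))) _.
    by rewrite Jtr_delta//; exact: wsum_le_dot (l2_Jdelta n).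
  apply: (wsum_sq_cvgU (g := fun N => Jtr a w N (vn N n t))).
    by move=> k; apply: Jtr_cvg => j; exact: vlim_cvg.
  apply: filterS (filterI (Ularge L) (Ularge `|n|.+1)) => N /= [LN nN].
  apply: le_trans (mono _ _ _ (leqW LN)) _.
  rewrite -(vtrJ w a_bd N t (sbnd_delta n)).
  apply: le_trans (vtr_le w a_bd N t (sbnd_Jtr w a_bd N (sbnd_delta n))) _.
  by rewrite Jtr_delta//; exact: wsum_le_dot (l2_Jdelta n).
- move=> n; exists (dot (J (J (delta n))) (J (J (delta n)))) => t h L; split.
    apply: (wsum_sq_cvgU (g := fun N m => un N n (t + h) m - un N n t m - h * Jtr a w N (vn N n t) m)).
      move=> k; apply: cvgB; first by apply: cvgB; exact: ulim_cvg.
      apply: cvgM; first exact: cvg_cst.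
      by apply: Jtr_cvg => j; exact: vlim_cvg.
    apply: filterS (filterI (Ularge L) (Ularge `|n|.+2)) => N /= [LN nN].
    apply: le_trans (mono _ _ _ (leqW LN)) _.
    have [+ _] := utr_taylor w a_bd N t h (sbnd_delta n).
    move=> /le_trans; apply; rewrite Jtr_Jdelta// ler_wpM2r ?exprn_even_ge0//.
    exact: wsum_le_dot (l2_JJdelta n).
  apply: (wsum_sq_cvgU (g := fun N m => vn N n (t + h) m - vn N n t m - h * (- Jtr a w N (un N n t) m))).
    move=> k; apply: cvgB; first by apply: cvgB; exact: vlim_cvg.
    apply: cvgM; first exact: cvg_cst.
    by apply: cvgN; apply: Jtr_cvg => j; exact: ulim_cvg.
  apply: filterS (filterI (Ularge L) (Ularge `|n|.+2)) => N /= [LN nN].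
  apply: le_trans (mono _ _ _ (leqW LN)) _.
  have [_] := utr_taylor w a_bd N t h (sbnd_delta n).
  move=> /le_trans; apply; rewrite Jtr_Jdelta// ler_wpM2r ?exprn_even_ge0//.
  exact: wsum_le_dot (l2_JJdelta n).
- move=> n t; have sd k := sbnd_delta k.
  have sZ c k : sbnd (c *: @delta R k).
    have [D hD] := sd k; exists (`|c| * D) => m.
    by rewrite normrM ler_wpM2l.
  have sA x y : sbnd x -> sbnd y -> sbnd (x + y).
    move=> [D hD] [E hE]; exists (D + E) => m.
    by apply: le_trans (ler_normD _ _) _; rewrite lerD.
  split; apply/funext => m.
    have c1 : Jtr a w N (un N n t) m @[N --> U] --> J (ulim n t) m.
      by apply: Jtr_cvg => k; exact: ulim_cvg.
    rewrite -(cvg_lim _ c1)//; apply: cvg_lim => //.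
    have c2 : a n * un N (n + 1) t m + a (n - 1) * un N (n - 1) t m + w n * un N n t m
       @[N --> U] --> a n * ulim (n + 1) t m + a (n - 1) * ulim (n - 1) t m + w n * ulim n t m.
      by apply: cvgD; [apply: cvgD|];
        (apply: cvgM; [exact: cvg_cst|exact: ulim_cvg]).
    move: c2; apply: cvg_trans; apply: near_eq_cvg.
    apply: filterS (Ularge `|n|.+1) => N /= nN.
    rewrite -(utrJ w a_bd N t (sd n)) Jtr_delta// Japp_delta /utr.
    rewrite (ucosD (atr_bd a_bd N) (wtr_bd w N))//; last exact: sA.
    rewrite (ucosD (atr_bd a_bd N) (wtr_bd w N))//.
    by rewrite !(ucosZ (atr_bd a_bd N) (wtr_bd w N)).
  have c1 : Jtr a w N (vn N n t) m @[N --> U] --> J (vlim n t) m.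
    by apply: Jtr_cvg => k; exact: vlim_cvg.
  rewrite -(cvg_lim _ c1)//; apply: cvg_lim => //.
  have c2 : a n * vn N (n + 1) t m + a (n - 1) * vn N (n - 1) t m + w n * vn N n t m
     @[N --> U] --> a n * vlim (n + 1) t m + a (n - 1) * vlim (n - 1) t m + w n * vlim n t m.
    by apply: cvgD; [apply: cvgD|];
      (apply: cvgM; [exact: cvg_cst|exact: vlim_cvg]).
  move: c2; apply: cvg_trans; apply: near_eq_cvg.
  apply: filterS (Ularge `|n|.+1) => N /= nN.
  rewrite -(vtrJ w a_bd N t (sd n)) Jtr_delta// Japp_delta /vtr.
  rewrite (usinD (atr_bd a_bd N) (wtr_bd w N))//; last exact: sA.
  rewrite (usinD (atr_bd a_bd N) (wtr_bd w N))//.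
  by rewrite !(usinZ (atr_bd a_bd N) (wtr_bd w N)).
Qed.

End Along.
End Existence.

(** * Identification of the amplitude and convergence of truncations *)

Section NiceSol.
Context {R : realType}.
Context (a w : int -> R) (aM : R) (a_bd : forall n, `|a n| <= aM).
Local Notation J := (Japp a w).

Section Given.
Context (u v : int -> R -> int -> R) (uv : nice_sol a w u v).

Lemma nice_l2 n t : [/\ l2 (u n t), l2 (v n t), l2 (J (u n t)) & l2 (J (v n t))].
Proof.
case: uv => _ h1 h2 _ _; have [C hC] := h2 n.
split; [exists 1 => L|exists 1 => L|exists C => L|exists C => L].
- apply: le_trans (h1 n t L); apply: ler_wsum => m.
  by rewrite /energy_at lerDl sq_ge0.
- apply: le_trans (h1 n t L); apply: ler_wsum => m.
  by rewrite /energy_at lerDr sq_ge0.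
- by case: (hC t L).
- by case: (hC t L).
Qed.

Lemma quotient_of_taylor (f g : int -> R) (h C e : R) : 0 <= C -> 0 < e ->
  0 < `|h| < Num.min 1 (e / (C + 1)) ->
  (forall L, wsum (sq (fun m => f m - h * g m)) L <= C * h ^+ 4) ->
  (l2n2 (fun m => f m / h - g m)%R < e%:E)%E.
Proof.
move=> C0 e0; rewrite lt_min => /andP[h0 /andP[h1 he]] H.
have hn0 : h != 0 by rewrite -normr_gt0.
apply: (@le_lt_trans _ _ (C * h ^+ 2)%:E).
  apply: l2n2_le => L.
  rewrite (_ : wsum _ L = h ^- 2 * wsum (sq (fun m => f m - h * g m)) L); last first.
    by rewrite -wsumZ; apply: eq_wsum => m; rewrite /sq; field.
  rewrite (_ : C * h ^+ 2 = h ^- 2 * (C * h ^+ 4)); last by field.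
  by rewrite ler_wpM2l ?H// invr_ge0 sqr_ge0.
rewrite lte_fin -real_normK ?num_real//.
move: he; rewrite ltr_pdivlMr ?ltr_wpDl// => he.
apply: le_lt_trans he; rewrite expr2 mulrCA ler_wpM2l//.
by rewrite mulrC (le_trans (ler_piMl C0 (ltW h1)))// lerDl.
Qed.

Lemma nice_schrod n : schrod_sol a w n (u n) (v n).
Proof.
case: (uv) => h0 _ _ h3 _; have [C hC] := h3 n; have [u0 v0] := h0 n.
have C0 : 0 <= C.
  by have [+ _] := hC 0 1 0%N; rewrite wsum0 expr1n mulr1.
have e1 (e : R) : 0 < e -> 0 < Num.min 1 (e / (C + 1)).
  by move=> e0; rewrite lt_min ltr01 divr_gt0// ltr_wpDl.
split=> //.
- by move=> t; have [? ? ? ?] := nice_l2 n t; split; apply/in_l2P.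
- move=> t e e0; exists (Num.min 1 (e / (C + 1))); first exact: e1.
  move=> h hh; apply: (@quotient_of_taylor (fun k => u n (t + h) k - u n t k) _ h C) => // L.
  by case: (hC t h L).
- move=> t e e0; exists (Num.min 1 (e / (C + 1))); first exact: e1.
  move=> h hh; have := @quotient_of_taylor (fun k => v n (t + h) k - v n t k)
    (fun k => - J (u n t) k) h C e C0 e0 hh.
  rewrite (_ : (fun m => _ / h - - _) = (fun k : int =>
    (v n (t + h) k - v n t k) / h + J (u n t) k)).
    by apply=> L; case: (hC t h L).
  by apply/funext => k; rewrite opprK.
Qed.

(** Existence makes [xget] return a solution, and uniqueness identifies it with the constructed
    one. *)
Lemma evol_amp_nice m n t :
  evol_amp a w m n t = Num.sqrt (u n t m ^+ 2 + v n t m ^+ 2).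
Proof.
rewrite /evol_amp; set P := [set _ | _].
have : P (xget (fun _ _ => 0, fun _ _ => 0) P).
  by apply: xgetPex; exists (u n, v n); exact: nice_schrod.
by move=> /schrod_unique - /(_ _ a_bd _ _ (nice_schrod n)) [-> ->].
Qed.

End Given.

(** Every ultrafilter limit of the truncations is a solution, hence the same one by uniqueness;
    [cvg_ultra] then gives convergence of the sequence itself, as measurability in [w] requires. *)
Lemma utr_cvg u v n t m : nice_sol a w u v ->
  utr a w N (delta n) t m @[N --> \oo] --> u n t m /\
  vtr a w N (delta n) t m @[N --> \oo] --> v n t m.
Proof.
move=> uv; split; apply: cvg_ultra => U UU Uoo.
  have [<- _] := schrod_unique a_bd (nice_schrod (nice_lim w a_bd UU Uoo) n) (nice_schrod uv n).
  exact: ulim_cvg.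
have [_ <-] := schrod_unique a_bd (nice_schrod (nice_lim w a_bd UU Uoo) n) (nice_schrod uv n).
exact: vlim_cvg.
Qed.

Lemma nice_exists : exists u v, nice_sol a w u v.
Proof.
have [U [UU Uoo]] := @ultra_noo.
by exists (ulim a w U), (vlim a w U); exact: nice_lim.
Qed.

End NiceSol.

(** * Time averages *)

Section MeanL2.
Context {R : realType}.
Context (M : (R -> R) -> R)
  (MD : forall f g, bnd f -> bnd g -> M (fun t => f t + g t) = M f + M g)
  (MZ : forall c f, bnd f -> M (fun t => c * f t) = c * M f)
  (Mle : forall f C, bnd f -> (forall t, f t <= C) -> M f <= C).
Implicit Types (f g : R -> int -> R) (X Y : R -> R) (x y z : int -> R).

Lemma mean0 : M (fun=> 0) = 0.
Proof.
have b0 : bnd (fun _ : R => 0 : R) by exists 0 => t; rewrite normr0.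
by have := MZ 0 b0; rewrite !mul0r.
Qed.

Lemma meanB (f g : R -> R) : bnd f -> bnd g -> M (fun t => f t - g t) = M f - M g.
Proof.
move=> bf bg; rewrite -mulN1r -MZ// -MD//; last exact: bndZ.
by congr M; apply/funext => t; rewrite mulN1r.
Qed.

Lemma mean_ge (f : R -> R) C : bnd f -> (forall t, C <= f t) -> C <= M f.
Proof.
move=> bf fC; rewrite -lerN2 -mulN1r -MZ//; apply: Mle => [|t]; first exact: bndZ.
by rewrite mulN1r lerN2.
Qed.

Lemma mean_abs (f : R -> R) C : (forall t, `|f t| <= C) -> `|M f| <= C.
Proof.
move=> fC; have bf : bnd f by exists C.
rewrite ler_norml mean_ge// ?Mle// => t; have := fC t; rewrite ler_norml => /andP[] //.
Qed.

Lemma mean_wsum (F : int -> R -> R) L : (forall m, bnd (F m)) ->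
  bnd (fun t => wsum (fun m => F m t) L) /\
  M (fun t => wsum (fun m => F m t) L) = wsum (fun m => M (F m)) L.
Proof.
move=> bF; elim: L => [|L [bI IH]].
  rewrite wsum0; under eq_fun do rewrite wsum0.
  by split; [exists 0 => t; rewrite normr0|exact: mean0].
rewrite wsumS -IH; under eq_fun do rewrite wsumS.
by split; [apply: bndD => //; exact: bndD|rewrite MD ?MD//; exact: bndD].
Qed.

Lemma bnd_coord (h : R -> int -> R) E : (forall t L, wsum (sq (h t)) L <= E) ->
  forall m, bnd (fun t => h t m).
Proof.
move=> hE m; exists (1 + E) => t.
have h1 : h t m ^+ 2 <= E.
  apply: le_trans (hE t (`|m|.+1)%N).
  by apply: (@wsum_mem _ (sq (h t))) => [k|]; [exact: sq_ge0|lia].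
move: h1; rewrite -real_normK ?num_real//.
by have := sqr_ge0 (`|h t m| - 1); nra.
Qed.

Section Pair.
Context (f g : R -> int -> R) (X Y : R -> R) (E B : R)
  (B0 : 0 <= B)
  (fE : forall t L, wsum (sq (f t)) L <= E)
  (gE : forall t L, wsum (sq (g t)) L <= E)
  (XB : forall t, `|X t| <= B) (YB : forall t, `|Y t| <= B).

Definition mpair m := M (fun t => f t m * X t + g t m * Y t).

Lemma mE_ge0 : 0 <= E.
Proof. by have := fE 0 0%N; rewrite wsum0. Qed.

Lemma bndX : bnd X. Proof. by exists B. Qed.
Lemma bndY : bnd Y. Proof. by exists B. Qed.

Lemma bnd_pair m : bnd (fun t => f t m * X t + g t m * Y t).
Proof.
by apply: bndD; apply: bndM; [exact: bnd_coord|exact: bndX|exact: bnd_coord|exact: bndY].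
Qed.

(* Tested against itself, the averaged vector is controlled by the norms of
   the averaged family. *)
Lemma mpair_bound L : wsum (sq mpair) L <= 4 * B ^+ 2 * E.
Proof.
set z := mpair.
have bF m : bnd (fun t => z m * (f t m * X t + g t m * Y t)).
  by apply: bndZ; exact: bnd_pair.
have [bW MW] := mean_wsum L bF.
have e1 : wsum (sq z) L = M (fun t => wsum (fun m => z m * (f t m * X t + g t m * Y t)) L).
  rewrite MW; apply: eq_wsum => m; rewrite MZ; first by rewrite /sq expr2.
  exact: bnd_pair.
have e2 : wsum (sq z) L <= 2^-1 * wsum (sq z) L + 2 * B ^+ 2 * E.
  rewrite {1}e1; apply: Mle => // t.
  have hX : X t ^+ 2 <= B ^+ 2.
    by rewrite -real_normK ?num_real// lerXn2r ?nnegrE.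
  have hY : Y t ^+ 2 <= B ^+ 2.
    by rewrite -real_normK ?num_real// lerXn2r ?nnegrE.
  apply: (@le_trans _ _ (wsum (fun m => 2^-1 * sq z m +
     (X t ^+ 2 * sq (f t) m + Y t ^+ 2 * sq (g t) m)) L)).
    apply: ler_wsum => m; rewrite /sq.
    have := sqr_ge0 (2^-1 * z m - X t * f t m).
    have := sqr_ge0 (2^-1 * z m - Y t * g t m); lra.
  rewrite !wsumD !wsumZ lerD// (_ : 2 * _ * E = B ^+ 2 * E + B ^+ 2 * E); last by ring.
  by rewrite lerD// ler_pM ?sqr_ge0// wsum_ge0// => m; exact: sq_ge0.
lra.
Qed.

Lemma l2_mpair : l2 mpair.
Proof. by exists (4 * B ^+ 2 * E) => L; exact: mpair_bound. Qed.

Lemma bnd_dot (h : R -> int -> R) y : (forall t L, wsum (sq (h t)) L <= E) -> l2 y ->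
  forall t, `|dot y (h t)| <= Num.sqrt (dot y y) * Num.sqrt E.
Proof.
move=> hE ly t; have [lh dh] := l2_bound (hE t).
apply: dot_norm => //; rewrite ?sqrtr_ge0// sqr_sqrtr//; first exact: dot_ge0.
exact: mE_ge0.
Qed.

(** The mean is only finitely additive. The exchange with the infinite sum holds because cutting [y]
    to a window costs an error uniform in t. *)
Lemma dot_mpair y : l2 y ->
  dot y mpair = M (fun t => dot y (f t) * X t + dot y (g t) * Y t).
Proof.
move=> ly; have lf t := proj1 (l2_bound (fE t)); have lg t := proj1 (l2_bound (gE t)).
have bf : bnd (fun t => dot y (f t)) by eexists; exact: bnd_dot.
have bg : bnd (fun t => dot y (g t)) by eexists; exact: bnd_dot.
have bP : bnd (fun t => dot y (f t) * X t + dot y (g t) * Y t).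
  by apply: bndD; apply: bndM => //; [exact: bndX|exact: bndY].
set r := M _.
rewrite -[RHS]/r; apply: cvg_lim => //; apply/cvgrPdist_le => e e0.
(* Each pairing is cut with error e/(2 (B + 1)), half from [eta] and half from the tail of [y];
   multiplication by X or Y, bounded by [B], leaves at most e/2. *)
pose eta := e / (4 * (B + 1) * (E + 1)).
have B1 : 0 < B + 1 by rewrite ltr_wpDl.
have E0 := mE_ge0; have E1 : 0 < E + 1 by rewrite ltr_wpDl.
have eta0 : 0 < eta by rewrite divr_gt0// !mulr_gt0.
have : (fun L => eta^-1 * (dot y y - wsum (sq y) L)) @ \oo -->
     eta^-1 * (dot y y - dot y y).
  by apply: cvgM; [exact: cvg_cst|apply: cvgB; [exact: cvg_cst| exact: dot_cvg]].
rewrite subrr mulr0 => /cvgr_le /(_ (e / (4 * (B + 1)))) [|L0 _ hL].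
  by rewrite divr_gt0// mulr_gt0.
exists L0 => // L /= LL0.
have bF m : bnd (fun t => y m * (f t m * X t + g t m * Y t)).
  by apply: bndZ; exact: bnd_pair.
have [bW MW] := mean_wsum L bF.
have -> : wsum (fun m => y m * mpair m) L =
   M (fun t => wsum (fun m => y m * (f t m * X t + g t m * Y t)) L).
  by rewrite MW; apply: eq_wsum => m; rewrite MZ//; exact: bnd_pair.
rewrite /r -meanB//; apply: mean_abs => t.
have T (h : R -> int -> R) : (forall t L, wsum (sq (h t)) L <= E) ->
    `|dot y (h t) - wsum (fun m => y m * h t m) L| <= e / (2 * (B + 1)).
  move=> hE; have [lh dh] := l2_bound (hE t).
  rewrite dotC (_ : wsum _ _ = wsum (fun m => h t m * y m) L); last first.
    by apply: eq_wsum => m; rewrite mulrC.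
  apply: le_trans (dot_tail L lh ly eta0) _.
  have -> : e / (2 * (B + 1)) = e / (4 * (B + 1)) + e / (4 * (B + 1)).
    by field; rewrite gt_eqF.
  rewrite lerD ?hL//.
  apply: (@le_trans _ _ (eta * (E + 1))).
    by rewrite ler_pM2l// (le_trans dh)// lerDl.
  by rewrite /eta [leLHS](_ : _ = e / (4 * (B + 1)))//; field; rewrite !gt_eqF.
have -> : wsum (fun m => y m * (f t m * X t + g t m * Y t)) L =
   X t * wsum (fun m => y m * f t m) L + Y t * wsum (fun m => y m * g t m) L.
  by rewrite -!wsumZ -wsumD; apply: eq_wsum => m; ring.
rewrite (_ : _ - _ = (dot y (f t) - wsum (fun m => y m * f t m) L) * X t +
  (dot y (g t) - wsum (fun m => y m * g t m) L) * Y t); last by ring.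
have Q (p q : R) : `|p| <= e / (2 * (B + 1)) -> `|q| <= B -> `|p * q| <= e / 2.
  move=> pe qB; rewrite normrM; apply: (@le_trans _ _ (e / (2 * (B + 1)) * (B + 1))).
    by rewrite ler_pM// (le_trans qB)// lerDl.
  by rewrite [leLHS](_ : _ = e / 2)//; field; rewrite gt_eqF.
apply: le_trans (ler_normD _ _) _; rewrite (splitr e); apply: lerD; (apply: Q; [exact: T|by []]).
Qed.

End Pair.

End MeanL2.

(** * The span of the eigenvectors *)

Section PointPart.
Context {R : realType}.
Context (a w : int -> R).
Local Notation J := (Japp a w).

(** Orthogonality to all eigenvectors serves as the definition, so no spectral measure is
    involved. *)
Definition cont_part (x : int -> R) :=
  l2 x /\ forall phi, eigvec a w phi -> dot x phi = 0.

Lemma eigvec_l2 phi : eigvec a w phi -> l2 phi.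
Proof. by case=> /in_l2P. Qed.

Lemma eigvecP phi E : l2 phi -> phi <> 0 -> J phi = E *: phi -> eigvec a w phi.
Proof.
move=> lp p0 JE; split; first exact/in_l2P.
  apply: contrapT => h; apply: p0; apply/funext => n; apply/eqP/negPn/negP => hn.
  by apply: h; exists n.
by exists E => n; rewrite JE.
Qed.

Lemma eigvec_J phi : eigvec a w phi -> exists E, J phi = E *: phi.
Proof. by case=> _ _ [E hE]; exists E; apply/funext => n; rewrite hE. Qed.

Lemma cont_partD x y : cont_part x -> cont_part y -> cont_part (x + y).
Proof.
move=> [lx hx] [ly hy]; split; first exact: l2D.
move=> p ep; have lp := eigvec_l2 ep.
by rewrite dotDl// hx// hy// addr0.
Qed.

Lemma cont_partZ c x : cont_part x -> cont_part (c *: x).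
Proof.
move=> [lx hx]; split; first exact: l2Z.
by move=> p ep; rewrite dotZl ?hx ?mulr0//; exact: eigvec_l2.
Qed.


Inductive espan : (int -> R) -> Prop :=
| espan0 : espan 0
| espanS c phi f : eigvec a w phi -> espan f -> espan (c *: phi + f).

Lemma espan_l2 f : espan f -> l2 f.
Proof.
elim=> [|c phi g ep _ lg]; first exact: l20.
by apply: l2D => //; apply: l2Z; exact: eigvec_l2.
Qed.

Lemma espanD f g : espan f -> espan g -> espan (f + g).
Proof.
move=> ef eg; elim: ef => [|c phi h ep _ IH]; first by rewrite add0r.
by rewrite -addrA; exact: espanS.
Qed.

Lemma espanZ k f : espan f -> espan (k *: f).
Proof.
elim=> [|c phi h ep _ IH]; first by rewrite scaler0; exact: espan0.
by rewrite scalerDr scalerA; exact: espanS.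
Qed.

Lemma espan1 phi : eigvec a w phi -> espan phi.
Proof.
move=> ep; rewrite -[phi]addr0 -[phi]scale1r; apply: espanS => //.
exact: espan0.
Qed.

Lemma espan_seq f : espan f -> exists s : seq (R * (int -> R)),
  (forall p, p \in s -> eigvec a w p.2) /\
  f = fun k => \sum_(p <- s) p.1 * p.2 k.
Proof.
elim=> [|c phi g ep _ [s [es ->]]].
  by exists [::]; split=> //; apply/funext => k; rewrite big_nil.
exists ((c, phi) :: s); split.
  by move=> p; rewrite inE => /orP[/eqP ->|/es].
by apply/funext => k; rewrite big_cons.
Qed.

Definition near_espan y :=
  forall e, 0 < e -> exists2 s, espan s & dot (y - s) (y - s) < e.

Lemma espan_orth x s : cont_part x -> espan s -> dot x s = 0.
Proof.
move=> [lx hx]; elim=> [|c phi f ep ef IH]; first by rewrite dotC dot0l.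
have lp := eigvec_l2 ep; have lf := espan_l2 ef.
rewrite dotDr//; last exact: l2Z.
by rewrite dotZr// hx// IH mulr0 addr0.
Qed.

Lemma near_espan_orth x y : cont_part x -> l2 y -> near_espan y -> dot x y = 0.
Proof.
move=> hx ly cy; have lx := proj1 hx.
apply/eqP; rewrite -sqrf_eq0 eq_le sqr_ge0 andbT.
apply/ler_addgt0Pr => e e0; rewrite add0r.
have x1 : 0 < dot x x + 1 by rewrite ltr_wpDl// dot_ge0.
have [s es hse] := cy _ (divr_gt0 e0 x1); have ls := espan_l2 es.
have <- : dot x (y - s) = dot x y by rewrite dotBr// (espan_orth hx es) subr0.
have lys := l2B ly ls.
apply: le_trans (dot_CS lx lys) _.
move/ltW: hse; rewrite ler_pdivlMr// mulrC; apply: le_trans.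
by rewrite ler_wpM2r ?dot_ge0// lerDl.
Qed.

Lemma cont_part_proj y : l2 y -> exists x, cont_part x /\ near_espan (y - x).
Proof.
move=> ly.
have [x [lx hx cx]] := projection espan_l2 espan0 espanD espanZ ly.
by exists x; split=> //; split=> // p ep; apply: hx; exact: espan1.
Qed.

(* Finite combinations of eigenvectors evolve by the explicit phases
   exp(-iE(t - t0)). *)
Lemma espan_evolve (t0 : R) s : espan s -> exists p q : R -> int -> R,
  [/\ coord_sol a w p q, p t0 = s /\ q t0 = 0,
      forall t, espan (p t) /\ espan (q t) &
      exists C, forall t L, wsum (energy_at p q t) L <= C].
Proof.
elim=> [|c phi f ep ef [p [q [S [p0 q0] eS [C hC]]]]].
  exists (fun=> 0), (fun=> 0); split => //.
  - move=> t m; rewrite /Japp !mulr0 !addr0 oppr0.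
    by split; exact: is_derive_cst.
  - by move=> t; split; exact: espan0.
  - exists 0 => t L; rewrite (_ : wsum _ L = wsum (fun=> 0 * 0) L).
      by rewrite wsumZ mul0r.
    by apply: eq_wsum => m; rewrite /energy_at /sq !expr0n addr0 mul0r.
have [E JE] := eigvec_J ep; have lp := eigvec_l2 ep.
pose A t := E * (t - t0).
have dA (t : R) : is_derive t (1 : R) A E.
  have D : is_derive t (1 : R) (fun s : R => s - t0) (1 - 0).
    exact: (is_deriveB (is_derive_id t (1 : R)) (is_derive_cst t0 t (1 : R))).
  apply: is_derive_eq (is_deriveZ E D) _.
  by rewrite subr0 /GRing.scale /= mulr1.
have dc (t : R) : is_derive t (1 : R) (cos \o A) (- sin (A t) * E).
  exact: (is_derive1_comp (is_derive_cos (A t)) (dA t)).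
have ds (t : R) : is_derive t (1 : R) (sin \o A) (cos (A t) * E).
  exact: (is_derive1_comp (is_derive_sin (A t)) (dA t)).
exists (fun t => (c * cos (A t)) *: phi + p t), (fun t => (- (c * sin (A t))) *: phi + q t).
have A0 : A t0 = 0 by rewrite /A subrr mulr0.
split.
- move=> t m; have [hp hq] := S t m; rewrite !JappD !JappZ JE.
  split.
    rewrite (_ : (fun t => _) = (c * phi m) *: (cos \o A) + (p^~ m)).
      apply: is_derive_eq (is_deriveD (is_deriveZ (c * phi m) (dc t)) hp) _.
      by rewrite !fctE /GRing.scale /=; ring.
    by apply/funext => r; rewrite !fctE /GRing.scale /=; ring.
  rewrite (_ : (fun t => _) = (- (c * phi m)) *: (sin \o A) + (q^~ m)).
    apply: is_derive_eq (is_deriveD (is_deriveZ (- (c * phi m)) (ds t)) hq) _.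
    by rewrite !fctE /GRing.scale /=; ring.
  by apply/funext => r; rewrite !fctE /GRing.scale /=; ring.
- by rewrite A0 cos0 sin0 p0 q0 mulr1 mulr0 oppr0 scale0r addr0.
- by move=> t; have [? ?] := eS t; split; exact: espanS.
- exists (4 * (c ^+ 2 * dot phi phi) + 2 * C) => t L.
  apply: (@le_trans _ _ (wsum (fun m => 4 * (c ^+ 2 * sq phi m) + 2 * energy_at p q t m) L)).
    apply: ler_wsum => m; rewrite /energy_at /sq.
    have K (x y k : R) : k ^+ 2 <= 1 -> ((c * k) * x + y) ^+ 2 <= 2 * (c ^+ 2 * x ^+ 2) + 2 * y ^+ 2.
      move=> k1; have h := sqr_ge0 ((c * k) * x - y).
      have h2 : k ^+ 2 * (c ^+ 2 * x ^+ 2) <= c ^+ 2 * x ^+ 2.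
        by rewrite ler_piMl// mulr_ge0 ?sqr_ge0.
      by nra.
    have c2 := cos2Dsin2 (A t).
    have hc : cos (A t) ^+ 2 <= 1 by rewrite -c2 lerDl sqr_ge0.
    have hs : (- sin (A t)) ^+ 2 <= 1 by rewrite sqrrN -c2 lerDr sqr_ge0.
    have := K (phi m) (p t m) _ hc; have := K (phi m) (q t m) _ hs.
    rewrite !fctE /GRing.scale /= mulrN; lra.
  rewrite wsumD !wsumZ; apply: lerD; last by rewrite ler_pM2l.
  rewrite ler_pM2l//; apply: ler_wpM2l; first exact: sqr_ge0.
  exact: wsum_le_dot.
Qed.

End PointPart.

(** * Orbits with uniformly small tails *)

Section Core.
Context {R : realType}.
Context (a w : int -> R) (aM : R) (a_bd : forall n, `|a n| <= aM).
Local Notation J := (Japp a w).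
Local Notation cont_part := (cont_part a w).

Context (M : (R -> R) -> R)
  (MD : forall f g, bnd f -> bnd g -> M (fun t => f t + g t) = M f + M g)
  (MZ : forall c f, bnd f -> M (fun t => c * f t) = c * M f)
  (Mle : forall f C, bnd f -> (forall t, f t <= C) -> M f <= C)
  (Mker : forall F G, taylor2 F G -> M G = 0).
Context (u v : R -> int -> R) (s : int -> R) (S C : R)
  (uvs : forall t m, sq (u t) m + sq (v t) m <= s m)
  (sS : forall L, wsum s L <= S)
  (JuC : forall t L, wsum (sq (J (u t))) L <= C)
  (JvC : forall t L, wsum (sq (J (v t))) L <= C)
  (u_taylor : forall t h L,
     wsum (sq (fun m => u (t + h) m - u t m - h * J (v t) m)) L <= C * h ^+ 4)
  (v_taylor : forall t h L,
     wsum (sq (fun m => v (t + h) m - v t m - h * (- J (u t) m))) L <= C * h ^+ 4)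
  (uv_sol : coord_sol a w u v).

(** [X x] and [Y x] are the real and imaginary parts of the pairing of psi_t with the real vector
    x. *)
Let X x t := dot x (u t).
Let Y x t := dot x (v t).

Lemma s_ge0 m : 0 <= s m.
Proof. by apply: le_trans (uvs 0 m); rewrite addr_ge0 ?sq_ge0. Qed.

Lemma u_window t L : wsum (sq (u t)) L <= S.
Proof.
apply: le_trans (sS L); apply: ler_wsum => m; apply: le_trans (uvs t m).
by rewrite lerDl sq_ge0.
Qed.

Lemma v_window t L : wsum (sq (v t)) L <= S.
Proof.
apply: le_trans (sS L); apply: ler_wsum => m; apply: le_trans (uvs t m).
by rewrite lerDr sq_ge0.
Qed.

Lemma l2u t : l2 (u t). Proof. by exists S => L; exact: u_window. Qed.
Lemma l2v t : l2 (v t). Proof. by exists S => L; exact: v_window. Qed.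
Lemma l2Ju t : l2 (J (u t)). Proof. by exists C => L; exact: JuC. Qed.
Lemma l2Jv t : l2 (J (v t)). Proof. by exists C => L; exact: JvC. Qed.
Hint Resolve l2u l2v l2Ju l2Jv : core.

Lemma S_ge0 : 0 <= S. Proof. by have := sS 0%N; rewrite wsum0. Qed.
Lemma C_ge0 : 0 <= C. Proof. by have := JuC 0 0%N; rewrite wsum0. Qed.

Definition XB x := Num.sqrt (dot x x) * Num.sqrt S.

Lemma XB_ge0 x : 0 <= XB x.
Proof. by rewrite mulr_ge0 ?sqrtr_ge0. Qed.

Lemma X_bound x t : l2 x -> `|X x t| <= XB x.
Proof. by move=> lx; exact: (bnd_dot u_window u_window lx t). Qed.

Lemma Y_bound x t : l2 x -> `|Y x t| <= XB x.
Proof. by move=> lx; exact: (bnd_dot v_window v_window lx t). Qed.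

Lemma X_taylor x : l2 x -> taylor2 (X x) (fun t => dot x (J (v t))).
Proof.
move=> lx; split.
- by exists (XB x) => t; exact: X_bound.
- by eexists => t; exact: (bnd_dot JvC JvC lx t).
exists (Num.sqrt (dot x x) * Num.sqrt C) => t h _.
have [lr rC] := l2_bound (u_taylor t h).
rewrite /X -dotBr// -dotZr// -dotBr//; try exact: l2B; try exact: l2Z.
rewrite -mulrA; apply: dot_norm => //; rewrite ?sqrtr_ge0//.
- by rewrite mulr_ge0 ?sqrtr_ge0 ?sqr_ge0.
- by rewrite sqr_sqrtr// dot_ge0.
- by rewrite exprMn sqr_sqrtr ?C_ge0// -exprM.
Qed.

Lemma Y_taylor x : l2 x -> taylor2 (Y x) (fun t => - dot x (J (u t))).
Proof.
move=> lx; split.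
- by exists (XB x) => t; exact: Y_bound.
- by eexists => t; rewrite normrN; exact: (bnd_dot JuC JuC lx t).
exists (Num.sqrt (dot x x) * Num.sqrt C) => t h _.
have [lr rC] := l2_bound (v_taylor t h).
rewrite /Y (_ : dot x (v (t + h)) - _ - _ = dot x (v (t + h) - v t - h *: (- J (u t)))).
  rewrite -mulrA; apply: dot_norm => //; rewrite ?sqrtr_ge0//.
  - by rewrite mulr_ge0 ?sqrtr_ge0 ?sqr_ge0.
  - by rewrite sqr_sqrtr// dot_ge0.
  - by rewrite exprMn sqr_sqrtr ?C_ge0// -exprM.
have lN : l2 (- J (u t)) by exact: l2N.
rewrite !dotBr//; try exact: l2B; try exact: l2Z.
by rewrite !dotZr// (dotC x (- _)) dotNl// (dotC _ x).
Qed.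

(* The time average of the rank-one operators |psi_t><psi_t|, psi_t = u t + i v t
   (its real part): compact because the tails of psi_t are uniformly small. *)
Definition Kop x m := M (fun t => u t m * X x t + v t m * Y x t).

Lemma l2_Kop x : l2 x -> l2 (Kop x).
Proof.
move=> lx; apply: (l2_mpair MD MZ Mle (XB_ge0 x) u_window v_window) => t;
  [exact: X_bound|exact: Y_bound].
Qed.

Lemma dot_Kop x y : l2 x -> l2 y ->
  dot y (Kop x) = M (fun t => X y t * X x t + Y y t * Y x t).
Proof.
move=> lx ly; apply: (dot_mpair MD MZ Mle (XB_ge0 x) u_window v_window) => // t;
  [exact: X_bound|exact: Y_bound].
Qed.

Lemma Kop_sym x y : l2 x -> l2 y -> dot (Kop x) y = dot x (Kop y).
Proof.
move=> lx ly; rewrite dotC !dot_Kop//; congr M.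
by apply/funext => t; rewrite mulrC [X in _ + X]mulrC.
Qed.

Lemma bndXx x : l2 x -> bnd (X x). Proof. by exists (XB x) => t; exact: X_bound. Qed.
Lemma bndYx x : l2 x -> bnd (Y x). Proof. by exists (XB x) => t; exact: Y_bound. Qed.
Lemma bndu m : bnd (fun t => u t m). Proof. exact: (bnd_coord u_window m). Qed.
Lemma bndv m : bnd (fun t => v t m). Proof. exact: (bnd_coord v_window m). Qed.

Lemma bnd_uXvY x m : l2 x -> bnd (fun t => u t m * X x t + v t m * Y x t).
Proof.
by move=> lx; apply: bndD; apply: bndM;
  [exact: bndu|exact: bndXx|exact: bndv|exact: bndYx].
Qed.

Lemma bnd_form x : l2 x -> bnd (fun t => X x t * X x t + Y x t * Y x t).
Proof.
move=> lx; have bX := bndXx lx; have bY := bndYx lx.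
exact: (bndD (bndM bX bX) (bndM bY bY)).
Qed.

Lemma KopD x y : l2 x -> l2 y -> Kop (x + y) = Kop x + Kop y.
Proof.
move=> lx ly; apply/funext => m; rewrite /Kop -[RHS]MD; try exact: bnd_uXvY.
by congr M; apply/funext => t; rewrite /X /Y !dotDl//; ring.
Qed.

Lemma KopZ c x : l2 x -> Kop (c *: x) = c *: Kop x.
Proof.
move=> lx; apply/funext => m; rewrite /Kop -[RHS]MZ; try exact: bnd_uXvY.
by congr M; apply/funext => t; rewrite /X /Y !dotZl//; ring.
Qed.

Lemma KopB x y : l2 x -> l2 y -> Kop (x - y) = Kop x - Kop y.
Proof.
move=> lx ly; rewrite -[in LHS]scaleN1r KopD//; last exact: l2Z.
by rewrite KopZ// scaleN1r.
Qed.

(** [J] applied under the mean. Since J psi_t is bounded in l2, this shows that [Kop] maps l2 into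
    the domain of [J], with a norm bound. *)
Definition JKop x := mpair M (fun t => J (u t)) (fun t => J (v t)) (X x) (Y x).

Lemma J_Kop x : l2 x -> J (Kop x) = JKop x.
Proof.
move=> lx; apply/funext => m; rewrite /Japp /Kop /JKop /mpair.
rewrite -!MZ; try exact: bnd_uXvY.
have b c k : bnd (fun t => c * (u t k * X x t + v t k * Y x t)).
  by apply: bndZ; exact: bnd_uXvY.
rewrite -!MD; try exact: b; try by apply: bndD; exact: b.
by congr M; apply/funext => t; rewrite /Japp; ring.
Qed.

Lemma l2_JKop x : l2 x -> l2 (JKop x) /\ dot (JKop x) (JKop x) <= 4 * XB x ^+ 2 * C.
Proof.
move=> lx; apply: l2_bound => L.
by apply: (mpair_bound MD MZ Mle (XB_ge0 x) JuC JvC) => t;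
  [exact: X_bound|exact: Y_bound].
Qed.

(* J and K commute: the difference of the two kernels is the time derivative
   of a bounded quantity, which has mean zero. *)
Lemma Kop_J x : l2 x -> l2 (J x) -> Kop (J x) = J (Kop x).
Proof.
move=> lx lJx; rewrite J_Kop//; apply/funext => m.
apply/eqP; rewrite -subr_eq0; apply/eqP.
have bJ : bnd (fun t => J (u t) m * X x t + J (v t) m * Y x t).
  by apply: bndD; apply: bndM;
    [exact: (bnd_coord JuC m)|exact: bndXx|exact: (bnd_coord JvC m)|exact: bndYx].
rewrite /Kop /JKop /mpair -(meanB MD MZ)//; last exact: bnd_uXvY.
have lm : l2 (@delta R m) by exact: l2_delta.
(* The bounded quantity is v_m X - u_m Y, the imaginary part of the kernel whose real part defines
   [Kop]; its derivative is the integrand of K J - J K, after [J] has been moved by symmetry. *)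
have T := taylor2B (taylor2M (Y_taylor lm) (X_taylor lx))
  (taylor2M (X_taylor lm) (Y_taylor lx)).
rewrite -(Mker T); congr M; apply/funext => t.
rewrite /X /Y !dot_delta (Japp_sym a_bd lx (l2u t))// (Japp_sym a_bd lx (l2v t))//.
by ring.
Qed.

Lemma s_tail (e : R) : 0 < e -> exists L, forall t,
  dot (u t) (u t) - wsum (sq (u t)) L <= e /\ dot (v t) (v t) - wsum (sq (v t)) L <= e.
Proof.
move=> e0.
have c : cvgn (wsum s).
  apply: nondecreasing_is_cvgn; last by exists S => _ [L _ <-].
  by move=> L L' LL'; apply: wsum_nd => //; exact: s_ge0.
have : (fun L => limn (wsum s) - wsum s L) @ \oo --> limn (wsum s) - limn (wsum s).
  by apply: cvgB => //; exact: cvg_cst.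
rewrite subrr => /cvgr_le /(_ e e0) [L _ /(_ L (leqnn L)) /= hL].
exists L => t.
have K (f : R -> int -> R) : (forall m, sq (f t) m <= s m) -> l2 (f t) ->
    dot (f t) (f t) - wsum (sq (f t)) L <= e.
  move=> fs lf; apply: le_trans hL.
  have c1 : (fun L' => wsum (sq (f t)) L' - wsum (sq (f t)) L) @ \oo -->
      dot (f t) (f t) - wsum (sq (f t)) L.
    by apply: cvgB; [exact: dot_cvg|exact: cvg_cst].
  apply: (cvgr_to_le c1); exists L => // L' /= LL'.
  apply: (@le_trans _ _ (wsum s L' - wsum s L)); last first.
    rewrite lerD2r; apply: nondecreasing_cvgn_le => //.
    by move=> L1 L2 L12; apply: wsum_nd => //; exact: s_ge0.
  rewrite -subr_ge0 (_ : _ - _ = wsum (fun m => s m - sq (f t) m) L' -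
    wsum (fun m => s m - sq (f t) m) L); last by rewrite !wsumB; ring.
  by rewrite subr_ge0; apply: wsum_nd => // m; rewrite subr_ge0.
split; apply: K => // m; apply: le_trans (uvs t m).
  by rewrite lerDl sq_ge0.
by rewrite lerDr sq_ge0.
Qed.

(* Because the tails of u t and v t are uniformly small in t, weak convergence
   of x_ i entails convergence of X (x_ i) and Y (x_ i) uniformly in t. *)
Lemma unif_small {I : Type} {F : set_system I} {FF : ProperFilter F}
    (z : I -> int -> R) (D e : R) :
  0 < e -> (forall i, l2 (z i)) -> (forall i, dot (z i) (z i) <= D) ->
  (forall m, z i m @[i --> F] --> 0) ->
  \forall i \near F, forall t, `|X (z i) t| <= e /\ `|Y (z i) t| <= e.
Proof.
move=> e0 lz zD z0.
have D0 : 0 <= D.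
  have [i _] := filter_ex (filterT : F setT).
  by apply: le_trans (zD i); exact: dot_ge0.
have D1 : 0 < D + 1 by rewrite ltr_wpDl.
pose eta := e / (4 * (D + 1)).
have eta0 : 0 < eta by rewrite divr_gt0// mulr_gt0.
have [L hL] := @s_tail (eta * (e / 4)) (mulr_gt0 eta0 (divr_gt0 e0 (ltr0n _ 4))).
have S1 : 0 < S + 1 by rewrite ltr_wpDl// S_ge0.
have c : wsum (fun m => `|z i m| * (1 + S)) L @[i --> F] --> wsum (fun m => 0 * (1 + S)) L.
  apply: wsum_cvg => m; apply: cvgM; last exact: cvg_cst.
  by rewrite -(normr0 R); apply: cvg_norm.
rewrite (_ : wsum (fun _ => 0 * _) L = 0) in c; last by rewrite wsumZ mul0r.
have e2 : 0 < e / 2 by rewrite divr_gt0.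
move/cvgr_le : c => /(_ _ e2); apply: filterS => i hi t.
have K (f : R -> int -> R) : l2 (f t) -> wsum (sq (f t)) L <= S ->
    dot (f t) (f t) - wsum (sq (f t)) L <= eta * (e / 4) ->
    (forall m, `|f t m| <= 1 + S) -> `|dot (z i) (f t)| <= e.
  move=> lf _ fT fS; have := dot_tail L (lz i) lf eta0.
  have h1 : eta * dot (z i) (z i) <= e / 4.
    apply: (@le_trans _ _ (eta * (D + 1))).
      by rewrite ler_pM2l// (le_trans (zD i))// lerDl.
    by rewrite /eta [leLHS](_ : _ = e / 4)//; field; rewrite gt_eqF.
  have h2 : eta^-1 * (dot (f t) (f t) - wsum (sq (f t)) L) <= e / 4.
    by rewrite mulrC ler_pdivrMr// mulrC.
  have h3 : `|wsum (fun m => z i m * f t m) L| <= e / 2.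
    apply: le_trans hi; rewrite /wsum (le_trans (ler_norm_sum _ _ _))//.
    apply: ler_sum => k _; rewrite (le_trans (ler_normD _ _))//.
    by rewrite !normrM lerD// ler_wpM2l.
  move=> h4; rewrite -[dot _ _](subrK (wsum (fun m => z i m * f t m) L)).
  apply: le_trans (ler_normD _ _) _; lra.
have B1 (r : R) : r ^+ 2 <= S -> `|r| <= 1 + S.
  rewrite -real_normK ?num_real// => h.
  by have := sqr_ge0 (`|r| - 1); nra.
have [hu hv] := hL t.
split; apply: K => //; try exact: u_window; try exact: v_window; move=> m; apply: B1.
  apply: le_trans (u_window t (`|m|.+1)%N).
  by apply: (@wsum_mem _ (sq (u t))) => [k|]; [exact: sq_ge0|lia].
apply: le_trans (v_window t (`|m|.+1)%N).
by apply: (@wsum_mem _ (sq (v t))) => [k|]; [exact: sq_ge0|lia].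
Qed.

(** For an eigenvector p, commutation makes K p zero or again an eigenvector with the same
    eigenvalue; symmetry of K moves it onto p. *)
Lemma cont_part_Kop x : cont_part x -> cont_part (Kop x).
Proof.
move=> [lx hx]; split; first exact: l2_Kop.
move=> p ep; have lp := eigvec_l2 ep; have [E JE] := eigvec_J ep.
rewrite Kop_sym//; apply: contrapT => d0.
apply: (d0); apply: hx; apply: (eigvecP (E := E)); first exact: l2_Kop.
  by move=> K0; apply: (d0); rewrite K0 dotC dot0l.
by rewrite -Kop_J ?JE// ?KopZ//; exact: l2Z.
Qed.

Lemma Kop_form_small z e : l2 z -> 0 <= e -> (forall t, `|X z t| <= e /\ `|Y z t| <= e) ->
  dot (Kop z) z <= 2 * e ^+ 2.
Proof.
move=> lz e0 h; rewrite dotC dot_Kop//; apply: Mle.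
  exact: bnd_form.
move=> t; have [h1 h2] := h t.
have K (r : R) : `|r| <= e -> r * r <= e ^+ 2.
  by move=> re; rewrite -expr2 -real_normK ?num_real// lerXn2r ?nnegrE.
by have := K _ h1; have := K _ h2; lra.
Qed.

Lemma bnd_norm_le (x : int -> R) : l2 x -> dot x x <= 1 -> XB x <= Num.sqrt S.
Proof.
move=> lx x1; rewrite /XB ler_piMl ?sqrtr_ge0//.
by rewrite -[leRHS]sqrtr1 ler_wsqrtr.
Qed.

Section WeakK.
Context {I : Type} {F : set_system I} {FF : ProperFilter F}
  (x_ : I -> int -> R) (x : int -> R)
  (lx_ : forall i, l2 (x_ i)) (nx_ : forall i, dot (x_ i) (x_ i) <= 1)
  (xc : forall m, x_ i m @[i --> F] --> x m).

Lemma weak_l2 : l2 x. Proof. by have [] := l2_fatou xc lx_ nx_. Qed.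

Lemma weak_unif (e : R) : 0 < e ->
  \forall i \near F, forall t, `|X (x_ i - x) t| <= e /\ `|Y (x_ i - x) t| <= e.
Proof.
move=> e0; have [lx nx] := l2_fatou xc lx_ nx_.
apply: (@unif_small _ _ _ _ 4) => // [i|i|m].
- exact: l2B.
- rewrite dotBB//.
  have := dot_ge0 (l2D (lx_ i) lx); rewrite dotDD//.
  have := nx_ i; lra.
- by rewrite -(subrr (x m)); apply: cvgB => //; exact: cvg_cst.
Qed.

(** Compactness of [Kop] in the form needed here: its quadratic form vanishes along weakly null
    bounded families, because the pairings with psi_t are small uniformly in t. *)
Lemma weak_q : dot (Kop (x_ i - x)) (x_ i - x) @[i --> F] --> 0.
Proof.
have lx := weak_l2; apply/cvgrPdist_le => e e0.
pose d := Num.min 1 (e / 2).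
have d0 : 0 < d by rewrite lt_min ltr01 divr_gt0.
apply: filterS (weak_unif d0) => i hi.
have ld := l2B (lx_ i) lx.
have h1 := Kop_form_small ld (ltW d0) hi.
have h2 : 0 <= dot (Kop (x_ i - x)) (x_ i - x).
  rewrite dotC dot_Kop//; apply: (mean_ge MZ Mle).
    exact: bnd_form.
  by move=> t; rewrite addr_ge0// -expr2 sqr_ge0.
have h3 : d <= 1 by rewrite ge_min lexx.
have h4 : d <= e / 2 by rewrite ge_min lexx orbT.
rewrite sub0r normrN ger0_norm//; nra.
Qed.

Lemma weak_Kop m : Kop (x_ i) m @[i --> F] --> Kop x m.
Proof.
have lx := weak_l2; apply/cvgrPdist_le => e e0.
have bu1 (t : R) : `|u t m| <= 1 + S /\ `|v t m| <= 1 + S.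
  have K (f : int -> R) : wsum (sq f) (`|m|.+1)%N <= S -> `|f m| <= 1 + S.
    move=> fS; have : f m ^+ 2 <= S.
      apply: le_trans fS.
      by apply: (@wsum_mem _ (sq f)) => [k|]; [exact: sq_ge0|lia].
    rewrite -real_normK ?num_real// => h.
    by have := sqr_ge0 (`|f m| - 1); nra.
  by split; apply: K; [exact: u_window|exact: v_window].
have S1 : 0 < 1 + S by rewrite ltr_pwDl// S_ge0.
pose d := e / (2 * (1 + S)).
have d0 : 0 < d by rewrite divr_gt0// mulr_gt0.
apply: filterS (weak_unif d0) => i hi.
have ld := l2B (lx_ i) lx.
rewrite distrC (_ : Kop (x_ i) m - Kop x m = Kop (x_ i - x) m); last by rewrite KopB.
apply: (mean_abs MZ Mle) => t; have [h1 h2] := hi t; have [h3 h4] := bu1 t.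
have Ed : e = (1 + S) * d + (1 + S) * d by rewrite /d; field; rewrite gt_eqF.
apply: le_trans (ler_normD _ _) _; rewrite !normrM [leRHS]Ed.
by rewrite lerD// ler_pM.
Qed.

Lemma weak_cont_part : (forall i, cont_part (x_ i)) -> cont_part x.
Proof.
move=> cx; split; first exact: weak_l2.
move=> p ep; have lp := eigvec_l2 ep.
have c : dot (x_ i) p @[i --> F] --> dot x p.
  exact: (@weak_cvg _ _ F FF x_ x 1 xc lx_ nx_ p lp).
rewrite -(cvg_lim _ c)//; apply: lim_near_cst => //; apply: nearW => i.
by case: (cx i) => _; exact.
Qed.

End WeakK.

(* Otherwise a top eigenspace of K inside cont_part, which is J-invariant and
   strongly compact, would contain an eigenvector of J. *)
Lemma mean_cont_zero x1 : cont_part x1 -> dot (Kop x1) x1 <= 0.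
Proof.
move=> cx1; rewrite leNgt; apply/negP => q1.
have cl x : cont_part x -> l2 x by case.
have [x0 [lam [c0 x0n lam0 Kx0]]] : exists y lam,
    [/\ cont_part y, y <> 0, 0 < lam & Kop y = lam *: y].
  apply: (@eigen_max _ cont_part Kop x1);
    [exact: cl|exact: cont_partD|exact: cont_partZ|exact: cont_part_Kop| | | | |
     exact: cx1|exact: q1].
  - by move=> x y /cl lx /cl ly; exact: KopD.
  - by move=> c x /cl; exact: KopZ.
  - by move=> x y /cl lx /cl ly; exact: Kop_sym.
  move=> U x_ x UU cx nx xc; have lx_ i := cl _ (cx i).
  have [lx _] := l2_fatou xc lx_ nx.
  split; first exact: (weak_cont_part lx_ nx xc cx).
  have lK := l2_Kop lx.
  (* Expanding the form about the weak limit leaves a term killed by compactness and a term linear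
     in [x_ i]. *)
  rewrite (_ : (fun i => _) = fun i => dot (Kop (x_ i - x)) (x_ i - x) +
     2 * dot (x_ i) (Kop x) - dot (Kop x) x); last first.
    apply/funext => i; have l1 := lx_ i; have lN : l2 (- x) by exact: l2N.
    rewrite KopB//.
    have lKi := l2_Kop l1; have lKN : l2 (- Kop x) by exact: l2N.
    rewrite dotDl//; last exact: l2D.
    rewrite dotNl//; last exact: l2B.
    by rewrite !dotBr// (Kop_sym l1 lx) (dotC (Kop x) (x_ i)); ring.
  rewrite [X in _ --> X](_ : _ = 0 + 2 * dot x (Kop x) - dot (Kop x) x); last first.
    by rewrite (dotC x); ring.
  apply: cvgB; last exact: cvg_cst.
  apply: cvgD; first exact: weak_q.
  by apply: cvgM; [exact: cvg_cst|exact: weak_cvg].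
pose V x := cont_part x /\ Kop x = lam *: x.
have lx0 := cl _ c0.
have lam_neq0 : lam != 0 by rewrite gt_eqF.
(* On the eigenspace [J] is a multiple of J K, hence everywhere defined and bounded there. *)
have JV x : V x -> J x = lam^-1 *: JKop x.
  by move=> [/cl lx Kx]; rewrite -J_Kop// Kx JappZ scalerA mulVf// scale1r.
have lJV x : V x -> l2 (J x).
  by move=> Vx; rewrite JV//; apply: l2Z; have [/cl/l2_JKop[]] := Vx.
have VJ x : V x -> V (J x).
  move=> Vx; have [cx Kx] := Vx; have lx := cl _ cx; have lJ := lJV _ Vx.
  split; last by rewrite Kop_J// Kx JappZ.
  split => // p ep; have lp := eigvec_l2 ep; have [E JE] := eigvec_J ep.
  rewrite (Japp_sym a_bd lx lp lJ) JE; last exact: l2Z.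
  by case: cx => _ h; rewrite dotZr// h// mulr0.
have VD x y : V x -> V y -> V (x + y).
  move=> [cx Kx] [cy Ky]; split; first exact: cont_partD.
  by rewrite KopD ?Kx ?Ky ?scalerDr//; exact: cl.
have VZ c x : V x -> V (c *: x).
  move=> [cx Kx]; split; first exact: cont_partZ.
  by rewrite KopZ ?Kx//; [rewrite !scalerA mulrC|exact: cl].
have Vx0 : V x0 by [].
have dx0 : 0 < dot x0 x0.
  by rewrite ltNge; apply/negP => /(dot_eq0 lx0).
(* [eigen_max] needs a vector with positive form; this shift of [J] makes the form equal to 1 at
   [x0] and leaves eigenvectors unchanged. *)
pose c := (1 - dot (J x0) x0) / dot x0 x0.
pose A x := J x + c *: x.
have Vl x : V x -> l2 x by move=> [/cl].
have [y [mu [Vy y0 _ Ay]]] : exists y mu, [/\ V y, y <> 0, 0 < mu & A y = mu *: y].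
  apply: (@eigen_max _ V A x0); [exact: Vl|exact: VD|exact: VZ| | | | | |exact: Vx0|].
  - by move=> x Vx; apply: VD; [exact: VJ|exact: VZ].
  - by move=> x y Vx Vy; rewrite /A JappD scalerDr addrACA.
  - by move=> k x Vx; rewrite /A JappZ [RHS]scalerDr !scalerA (mulrC c).
  - move=> x y Vx Vy; rewrite /A.
    have lx := Vl _ Vx; have ly := Vl _ Vy; have lJx := lJV _ Vx; have lJy := lJV _ Vy.
    have lcx := l2Z c lx; have lcy := l2Z c ly.
    by rewrite dotDl// dotDr// dotZl// dotZr// (Japp_sym a_bd).
  - move=> U x_ x UU Vx_ nx xc; have lx_ i := Vl _ (Vx_ i).
    have [lx _] := l2_fatou xc lx_ nx.
    have cx : cont_part x by apply: (weak_cont_part lx_ nx xc) => i; case: (Vx_ i).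
    have Vx : V x.
      split=> //; apply/funext => m.
      have c1 : Kop (x_ i) m @[i --> U] --> Kop x m by apply: weak_Kop.
      rewrite -(cvg_lim _ c1)//; apply: cvg_lim => //.
      rewrite (_ : (fun i => Kop (x_ i) m) = fun i => lam * x_ i m); last first.
        by apply/funext => i; case: (Vx_ i) => _ ->.
      by apply: cvgM; [exact: cvg_cst|exact: xc].
    split=> //.
    have lA z : V z -> l2 (A z) by move=> Vz; apply: l2D; [exact: lJV|exact/l2Z/Vl].
    pose D := lam^-1 ^+ 2 * (4 * S * C).
    have JD z : V z -> dot z z <= 1 -> dot (J z) (J z) <= D.
      move=> Vz nz; rewrite JV// dotZZ; last by have [/cl/l2_JKop[]] := Vz.
      have [_ h] := l2_JKop (Vl _ Vz); rewrite ler_wpM2l ?sqr_ge0//.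
      apply: le_trans h _; rewrite ler_wpM2r ?C_ge0// ler_wpM2l//.
      rewrite -[leRHS](sqr_sqrtr S_ge0) lerXn2r ?nnegrE ?XB_ge0 ?sqrtr_ge0//.
      by apply: bnd_norm_le => //; exact: Vl.
    pose B := 2 * D + 2 * c ^+ 2.
    have AB z : V z -> dot z z <= 1 -> dot (A z) (A z) <= B.
      move=> Vz nz; have lz := Vl _ Vz; have lJz := lJV _ Vz; have lcz := l2Z c lz.
      have := dot_ge0 (l2B lJz lcz); rewrite dotBB// /A dotDD// dotZZ//.
      have := JD _ Vz nz.
      have : c ^+ 2 * dot z z <= c ^+ 2 by rewrite ler_piMr ?sqr_ge0.
      rewrite /B; lra.
    have AC m : A (x_ i) m @[i --> U] --> A x m.
      rewrite /A /Japp; apply: cvgD; last by apply: cvgM; [exact: cvg_cst|exact: xc].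
      by apply: cvgD; [apply: cvgD|]; (apply: cvgM; [exact: cvg_cst|exact: xc]).
    have w1 : dot (A (x_ i)) x @[i --> U] --> dot (A x) x.
      exact: (@weak_cvg _ _ U _ (fun i => A (x_ i)) _ _ AC
        (fun i => lA _ (Vx_ i)) (fun i => AB _ (Vx_ i) (nx i)) _ lx).
    rewrite (_ : (fun i => _) = fun i => dot (A (x_ i)) x + dot (A (x_ i)) (x_ i - x)); last first.
      apply/funext => i; have l1 := lx_ i; have l3 := lA _ (Vx_ i).
      by rewrite dotBr//; ring.
    rewrite -[X in _ --> X]addr0; apply: cvgD => //.
    (* On the eigenspace the form of K is [lam] times the squared norm, so the compactness of K
       upgrades weak convergence to norm convergence. *)
    have strong : dot (x_ i - x) (x_ i - x) @[i --> U] --> 0.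
      rewrite (_ : (fun i => _) = fun i => lam^-1 * dot (Kop (x_ i - x)) (x_ i - x)); last first.
        apply/funext => i; have VB : V (x_ i - x).
          by rewrite -scaleN1r; apply: VD => //; exact: VZ.
        case: VB => cB ->; have lB := cl _ cB.
        by rewrite dotZl// mulrA mulVf// mul1r.
      by rewrite -(mulr0 lam^-1); apply: cvgM; [exact: cvg_cst|exact: weak_q].
    have B0 : 0 <= B by apply: le_trans (AB _ (Vx_ 0%N) (nx 0%N)); apply: dot_ge0; exact: lA.
    apply/cvgrPdist_le => e e0.
    pose d := e / (B + 1).
    have B1 : 0 < B + 1 by rewrite ltr_wpDl.
    have d0 : 0 < d by rewrite divr_gt0.
    have dd : 0 < d ^+ 2 by rewrite exprn_gt0.
    move/cvgr_le : strong => /(_ _ dd); apply: filterS => i hi.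
    rewrite sub0r normrN (_ : e = (B + 1) * d); last by rewrite /d; field; rewrite gt_eqF.
    have l1 := lx_ i; apply: dot_norm; rewrite ?(ltW B1) ?(ltW d0)//.
    - exact: lA.
    - exact: l2B.
    - apply: le_trans (AB _ (Vx_ i) (nx i)) _; nra.
  - rewrite /A dotDl ?dotZl//; first by rewrite /c mulfVK ?gt_eqF// addrC subrK.
    exact: lJV.
    exact: l2Z.
have [[ly hy] _] := Vy.
have ey : eigvec a w y.
  apply: (eigvecP (E := mu - c)) => //.
  by apply/eqP; rewrite scalerBl -Ay /A addrK.
by apply: y0; apply: dot_eq0 => //; rewrite hy.
Qed.

(** Cauchy-Schwarz for the mean, through AM-GM with weight [eta]: the coordinate is at most eta S +
    Q/eta, where Q is the mean of X^2 + Y^2, nonpositive by [mean_cont_zero]. The upper bound alone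
    serves the trace estimate that follows. *)
Lemma Kop_cont_le0 x m : cont_part x -> Kop x m <= 0.
Proof.
move=> cx; have [lx _] := cx; have := mean_cont_zero cx; rewrite dotC dot_Kop//.
set Q := M _ => Q0.
apply/ler_addgt0Pr => e e0; rewrite add0r.
have S1 : 0 < S + 1 by rewrite ltr_wpDl// S_ge0.
pose eta := e / (S + 1).
have eta0 : 0 < eta by rewrite divr_gt0.
have bQ : bnd (fun t => X x t * X x t + Y x t * Y x t).
  exact: bnd_form.
have : M (fun t => u t m * X x t + v t m * Y x t -
    eta^-1 * (X x t * X x t + Y x t * Y x t)) <= eta * S.
  apply: Mle => [|t]; first by apply: bndB; [exact: bnd_uXvY|exact: bndZ].
  have sm : s m <= S.
    apply: le_trans (sS (`|m|.+1)%N); apply: wsum_mem => [k|]; first exact: s_ge0.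
    by lia.
  have := le_trans (uvs t m) sm; rewrite /sq => h.
  have K (p q : R) : p * q <= eta * p ^+ 2 + eta^-1 * (q * q).
    have ee : eta^-1 * eta = 1 by rewrite mulVf// gt_eqF.
    have h1 : 0 <= eta^-1 * (eta * p - q) ^+ 2 by rewrite mulr_ge0 ?sqr_ge0// invr_ge0 ltW.
    have h2 : 0 <= eta^-1 * (eta * p) ^+ 2 by rewrite mulr_ge0 ?sqr_ge0// invr_ge0 ltW.
    have h3 : 0 <= eta^-1 * q ^+ 2 by rewrite mulr_ge0 ?sqr_ge0// invr_ge0 ltW.
    have E1 : eta^-1 * (eta * p - q) ^+ 2 =
      (eta^-1 * eta) * eta * p ^+ 2 - 2 * (eta^-1 * eta) * p * q + eta^-1 * q ^+ 2 by ring.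
    have E2 : eta^-1 * (eta * p) ^+ 2 = (eta^-1 * eta) * eta * p ^+ 2 by ring.
    rewrite E1 ee in h1; rewrite E2 ee in h2; nra.
  have := K (u t m) (X x t); have := K (v t m) (Y x t).
  have : eta * (u t m ^+ 2 + v t m ^+ 2) <= eta * S by rewrite ler_pM2l.
  lra.
rewrite (meanB MD MZ)//; [|exact: bnd_uXvY|exact: bndZ].
rewrite MZ// -/(Kop x m) -/Q lerBlDr => h; apply: le_trans h _.
have h1 : eta^-1 * Q <= 0 by rewrite pmulr_rle0// invr_gt0.
have h2 : eta * S <= e.
  by rewrite /eta mulrAC ler_pdivrMr// ler_pM2l// lerDl.
lra.
Qed.

(* The squared distance of psi_t to the span of the eigenvectors has mean zero,
   being a trace of K against the projection onto cont_part. *)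
Lemma exists_close e : 0 < e -> exists t0 s1 s2, [/\ espan a w s1, espan a w s2,
  dot (u t0 - s1) (u t0 - s1) < e & dot (v t0 - s2) (v t0 - s2) < e].
Proof.
move=> e0.
have /choice[pu hpu] t := cont_part_proj a w (l2u t).
have /choice[pv hpv] t := cont_part_proj a w (l2v t).
(* [xd m] is P delta_m for the projection P onto [cont_part]. By symmetry of P, (P psi)_m is the
   pairing of P delta_m with psi, and |P psi|^2 that of P psi with psi; summing over m exhibits the
   trace. *)
have /choice[xd hxd] m := cont_part_proj a w (@l2_delta R m).
have lxd m : l2 (xd m) by case: (hxd m) => -[].
have coord (f g : R -> int -> R) t : l2 (g t) -> cont_part (f t) ->
    near_espan a w (g t - f t) -> (forall m, f t m = dot (xd m) (g t)) /\
    dot (f t) (f t) = dot (f t) (g t).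
  move=> lg cf nf; have lf := proj1 cf; have lgf := l2B lg lf; split=> [m|].
    have [cm nm] := hxd m; have lm := lxd m.
    have := near_espan_orth cf (l2B (@l2_delta R m) lm) nm.
    rewrite dotBr// dot_deltar => /eqP; rewrite subr_eq0 => /eqP ->.
    have := near_espan_orth cm lgf nf; rewrite dotBr// => /eqP.
    by rewrite subr_eq0 => /eqP ->; rewrite dotC.
  have := near_espan_orth cf lgf nf; rewrite dotBr// => /eqP.
  by rewrite subr_eq0 => /eqP ->.
(* If |P psi_t|^2 were at least e/4 for all t, the window sums would be at least half of it minus
   two errors of 2 e/64, that is e/16, contradicting a nonpositive mean. *)
have [L hL] := s_tail (divr_gt0 e0 (ltr0n _ 64)).
have bG m : bnd (fun t => u t m * X (xd m) t + v t m * Y (xd m) t) by exact: bnd_uXvY.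
have [bW MW] := mean_wsum MD MZ L bG.
have MG : M (fun t => wsum (fun m => u t m * X (xd m) t + v t m * Y (xd m) t) L) <= 0.
  rewrite MW -[leRHS](_ : wsum (fun=> 0 * 0) L = 0); last by rewrite wsumZ mul0r.
  by apply: ler_wsum => m; rewrite mul0r; apply: Kop_cont_le0; case: (hxd m).
have [t ht] : exists t, dot (pu t) (pu t) + dot (pv t) (pv t) < e / 4.
  apply: contrapT => nt; move: MG; apply/negP; rewrite -ltNge.
  apply: (@lt_le_trans _ _ (e / 16)); first by rewrite divr_gt0.
  apply: (mean_ge MZ Mle) => // t.
  have et : e / 4 <= dot (pu t) (pu t) + dot (pv t) (pv t).
    by rewrite leNgt; apply/negP => h; apply: nt; exists t.
  have [cu nu] := hpu t; have [cv nv] := hpv t.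
  have [Eu qu] := coord _ _ t (l2u t) cu nu.
  have [Ev qv] := coord _ _ t (l2v t) cv nv.
  have [hLu hLv] := hL t.
  have h2 : 0 < 2^-1 :> R by rewrite invr_gt0.
  have Tu := dot_tail L (proj1 cu) (l2u t) h2.
  have Tv := dot_tail L (proj1 cv) (l2v t) h2.
  rewrite -qu invrK in Tu; rewrite -qv invrK in Tv.
  have -> : wsum (fun m => u t m * X (xd m) t + v t m * Y (xd m) t) L =
    wsum (fun m => pu t m * u t m) L + wsum (fun m => pv t m * v t m) L.
    by rewrite -wsumD; apply: eq_wsum => m; rewrite Eu Ev /X /Y; ring.
  move: Tu Tv; rewrite !ler_norml => /andP[_ Tu] /andP[_ Tv]; lra.
have e4 : 0 < e / 4 by rewrite divr_gt0.
have [[cu nu] [cv nv]] := (hpu t, hpv t).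
have [s1 es1 h1] := nu _ e4; have [s2 es2 h2] := nv _ e4.
have fin (f g r : int -> R) : l2 f -> l2 g -> l2 r -> dot g g < e / 4 ->
    dot (f - g - r) (f - g - r) < e / 4 -> dot (f - r) (f - r) < e.
  move=> lf lg lr hg; have lfgr := l2B (l2B lf lg) lr.
  have -> : f - r = (f - g - r) + g by rewrite addrAC subrK.
  move: (f - g - r) lfgr => k lk hk.
  have := dot_ge0 (l2B lk lg); rewrite dotBB// dotDD//; lra.
exists t, s1, s2; have du := dot_ge0 (proj1 cu); have dv := dot_ge0 (proj1 cv).
split=> //.
  by apply: fin h1 => //; [exact: (proj1 cu)|exact: espan_l2 es1|lra].
by apply: fin h2 => //; [exact: (proj1 cv)|exact: espan_l2 es2|lra].
Qed.

(* The distance of psi_t to an evolving combination of eigenvectors is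
   conserved, so closeness at one time gives closeness at all times. *)
Lemma cont_part_orth x t : cont_part x -> dot x (u t) = 0 /\ dot x (v t) = 0.
Proof.
move=> cx; have lx := proj1 cx.
suff H e : 0 < e -> dot x (u t) ^+ 2 <= e /\ dot x (v t) ^+ 2 <= e.
  by split; apply/eqP; rewrite -sqrf_eq0 eq_le sqr_ge0 andbT;
    apply/ler_addgt0Pr => e /H[]; rewrite add0r.
move=> e0; have x1 : 0 < dot x x + 1 by rewrite ltr_wpDl// dot_ge0.
(* The two components give initial energy at most 2d, and Cauchy-Schwarz against [x] turns this into
   at most e. *)
pose d := e / (2 * (dot x x + 1)).
have d0 : 0 < d by rewrite divr_gt0// mulr_gt0.
have [t0 [s1 [s2 [es1 es2 h1 h2]]]] := exists_close d0.
have [p1 [q1 [S1 [p10 q10] e1 [C1 hC1]]]] := espan_evolve t0 es1.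
have [p2 [q2 [S2 [p20 q20] e2 [C2 hC2]]]] := espan_evolve t0 es2.
(* The evolution of s1 + i s2: (p1 + i q1) + i (p2 + i q2). *)
pose su t := p1 t - q2 t; pose sv t := q1 t + p2 t.
pose P t := u t - su t; pose Q t := v t - sv t.
have SPQ : coord_sol a w P Q.
  move=> r m; have [a1 b1] := uv_sol r m; have [a2 b2] := S1 r m; have [a3 b3] := S2 r m.
  split.
    rewrite (_ : Japp a w (Q r) m = J (v r) m - (J (q1 r) m - - J (p2 r) m)).
      exact: (is_deriveB a1 (is_deriveB a2 b3)).
    by rewrite /Q /sv JappB JappD !fctE; ring.
  rewrite (_ : - Japp a w (P r) m = - J (u r) m - (- J (p1 r) m + J (q2 r) m)).
    exact: (is_deriveB b1 (is_deriveD b2 a3)).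
  by rewrite /P /su !JappB !fctE; ring.
have esu r : espan a w (su r).
  by rewrite /su -scaleN1r; apply: espanD; [|apply: espanZ]; [case: (e1 r)|case: (e2 r)].
have esv r : espan a w (sv r) by apply: espanD; [case: (e1 r)|case: (e2 r)].
have bd r L : wsum (energy_at P Q r) L <= 2 * S + (4 * C1 + 4 * C2).
  apply: (@le_trans _ _ (wsum (fun m => 2 * s m + (4 * energy_at p1 q1 r m + 4 * energy_at p2 q2 r m)) L)).
    apply: ler_wsum => m; have := uvs r m; rewrite /energy_at /sq /P /Q /su /sv !fctE.
    have := sqr_ge0 (u r m + (p1 r m - q2 r m)).
    have := sqr_ge0 (v r m + (q1 r m + p2 r m)).
    have := sqr_ge0 (p1 r m + q2 r m); have := sqr_ge0 (q1 r m - p2 r m).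
    nra.
  rewrite !wsumD !wsumZ; have := sS L; have := hC1 r L; have := hC2 r L; lra.
have init L : wsum (energy_at P Q t0) L <= 2 * d.
  rewrite /energy_at wsumD /P /Q /su /sv p10 q10 p20 q20 subr0 add0r.
  have l1 := l2B (l2u t0) (espan_l2 es1); have l2' := l2B (l2v t0) (espan_l2 es2).
  have := wsum_le_dot L l1; have := wsum_le_dot L l2'; lra.
have fin := energy_le a_bd SPQ (fun r L _ => bd r L) init (t := t).
have K (f g : int -> R) : l2 f -> espan a w g -> (forall L, wsum (sq (f - g)) L <= 2 * d) ->
    dot x f ^+ 2 <= e.
  move=> lf eg hfg; have lg := espan_l2 eg; have lfg := l2B lf lg.
  have [_ dfg] := l2_bound hfg.
  have <- : dot x (f - g) = dot x f by rewrite dotBr// (espan_orth cx eg) subr0.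
  apply: le_trans (dot_CS lx lfg) _.
  apply: (@le_trans _ _ ((dot x x + 1) * (2 * d))).
    by rewrite ler_pM// ?dot_ge0// lerDl.
  by rewrite /d [leLHS](_ : _ = e)//; field; rewrite gt_eqF.
split; [apply: (K _ (su t)) => // L|apply: (K _ (sv t)) => // L];
  apply: le_trans (fin L); apply: ler_wsum => m; rewrite /energy_at.
  by rewrite lerDl sq_ge0.
by rewrite lerDr sq_ge0.
Qed.

End Core.

(** * Pure point spectrum for a fixed potential *)

Section Deterministic.
Context {R : realType}.
Context (a w : int -> R) (aM : R) (a_bd : forall n, `|a n| <= aM).
Context (dlt : R) (dlt_gt0 : 0 < dlt) (a_ge : forall n, dlt <= a n).
Context (u v : int -> R -> int -> R) (uv : nice_sol a w u v).
Local Notation J := (Japp a w).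

Definition summable_sol n := exists s S,
  (forall t m, sq (u n t) m + sq (v n t) m <= s m) /\ forall L, wsum s L <= S.

Lemma a_neq0 n : a n != 0.
Proof. by rewrite gt_eqF// (lt_le_trans dlt_gt0). Qed.

Definition orth_sol x n := forall t, dot x (u n t) = 0 /\ dot x (v n t) = 0.

Lemma summable_orth x n : cont_part a w x -> summable_sol n -> orth_sol x n.
Proof.
move=> cx [s [S [hs hS]]] t.
case: (uv) => h0 _ h2 h3 _; have [C hC] := h2 n; have [D hD] := h3 n.
have [M [MD MZ Mle Mker]] := @mean_exists R.
have C1 t' L : wsum (sq (J (u n t'))) L <= Num.max C D.
  by rewrite le_max (proj1 (hC t' L)).
have C2 t' L : wsum (sq (J (v n t'))) L <= Num.max C D.
  by rewrite le_max (proj2 (hC t' L)).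
have h4 (h : R) : 0 <= h ^+ 4 by rewrite exprn_even_ge0.
have C3 t' h L : wsum (sq (fun m => u n (t' + h) m - u n t' m - h * J (v n t') m)) L
    <= Num.max C D * h ^+ 4.
  apply: le_trans (proj1 (hD t' h L)) _.
  by rewrite ler_wpM2r// le_max lexx orbT.
have C4 t' h L : wsum (sq (fun m => v n (t' + h) m - v n t' m - h * (- J (u n t') m))) L
    <= Num.max C D * h ^+ 4.
  apply: le_trans (proj2 (hD t' h L)) _.
  by rewrite ler_wpM2r// le_max lexx orbT.
exact: (cont_part_orth a_bd MD MZ Mle Mker hs hS C1 C2 C3 C4
  (schrod_coord (nice_schrod uv n)) t cx).
Qed.

(** [x] is not known to lie in the domain of [J], so [J] cannot be moved onto it. Instead the
    vanishing pairing with the orbit is differentiated in time, using the quartic remainder. *)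
Lemma orth_J x n t : l2 x -> orth_sol x n ->
  dot x (J (u n t)) = 0 /\ dot x (J (v n t)) = 0.
Proof.
move=> lx ox; case: (uv) => _ _ _ h3 _; have [C hC] := h3 n.
have [l1 l2' l3 l4] := nice_l2 uv n t.
have C0 : 0 <= C by have [+ _] := hC 0 1 0%N; rewrite wsum0 expr1n mulr1.
have small (p : R) : (forall h, 0 < h -> (h * p) ^+ 2 <= dot x x * (C * h ^+ 4)) -> p = 0.
  move=> H; apply/eqP; rewrite -sqrf_eq0 eq_le sqr_ge0 andbT.
  have D0 : 0 <= dot x x * C by rewrite mulr_ge0// dot_ge0.
  apply/ler_addgt0Pr => e e0; rewrite add0r.
  have D1 : 0 < dot x x * C + 1 by rewrite ltr_wpDl.
  pose h := Num.min 1 (e / (dot x x * C + 1)).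
  have h0 : 0 < h by rewrite lt_min ltr01 divr_gt0.
  have h1 : h <= 1 by rewrite ge_min lexx.
  have he : h * (dot x x * C + 1) <= e.
    by rewrite -ler_pdivlMr// ge_min lexx orbT.
  have hh : 0 < h ^+ 2 by rewrite exprn_gt0.
  have := H h h0; rewrite exprMn (_ : _ * (C * _) = h ^+ 2 * (dot x x * C * h ^+ 2)); last by ring.
  rewrite ler_pM2l// => /le_trans; apply.
  apply: le_trans he; rewrite expr2 mulrCA ler_pM2l// mulrC.
  rewrite (@le_trans _ _ (dot x x * C))//; first by rewrite ler_piMl// ltW.
  by rewrite lerDl.
split; apply: small => h h0.
  have [lr rC] := l2_bound (fun L => proj2 (hC t h L)).
  have [_ l5 _ _] := nice_l2 uv n (t + h).
  have lN : l2 (- J (u n t)) by exact: l2N.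
  have := dot_CS lx lr.
  rewrite [X in dot x X](_ : _ = v n (t + h) - v n t + h *: J (u n t)); last first.
    by apply/funext => m; rewrite !fctE /GRing.scale /=; ring.
  rewrite dotDr//; [|exact: l2B|exact: l2Z].
  rewrite dotBr// dotZr// (proj2 (ox _)) (proj2 (ox _)) subrr add0r.
  by move/le_trans; apply; rewrite ler_wpM2l ?dot_ge0.
have [lr rC] := l2_bound (fun L => proj1 (hC t h L)).
have [l5 _ _ _] := nice_l2 uv n (t + h).
have := dot_CS lx lr.
rewrite [X in dot x X](_ : _ = u n (t + h) - u n t - h *: J (v n t)); last first.
  by apply/funext => m; rewrite !fctE /GRing.scale /=; ring.
rewrite dotBr//; [|exact: l2B|exact: l2Z].
rewrite dotBr// dotZr// (proj1 (ox _)) (proj1 (ox _)) subrr sub0r sqrrN.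
by move/le_trans; apply; rewrite ler_wpM2l ?dot_ge0.
Qed.

(* J acts on the initial site of the solutions as a three-term recurrence with
   nonzero off-diagonal coefficients. *)
Lemma orth_step x n k l : l2 x -> orth_sol x n -> orth_sol x k ->
  (k = n + 1 /\ l = n - 1) \/ (k = n - 1 /\ l = n + 1) -> orth_sol x l.
Proof.
move=> lx hn hk kl t; have [j1 j2] := orth_J t lx hn.
case: (uv) => _ _ _ _ h4; have [e1 e2] := h4 n t.
have L i := nice_l2 uv i t.
have [z1 z2] := hn t; have [z3 z4] := hk t.
have K (f1 f2 f3 g : int -> R) c1 c2 c3 : l2 f1 -> l2 f2 -> l2 f3 ->
    g = c1 *: f1 + c2 *: f2 + c3 *: f3 -> dot x g = c1 * dot x f1 + c2 * dot x f2 + c3 * dot x f3.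
  move=> l1 l2' l3 ->; rewrite !dotDr ?dotZr//; try exact: l2Z.
  by apply: l2D; exact: l2Z.
have [a1 b1 _ _] := L (n + 1); have [a2 b2 _ _] := L (n - 1); have [a3 b3 _ _] := L n.
have := K _ _ _ _ _ _ _ a1 a2 a3 e1; have := K _ _ _ _ _ _ _ b1 b2 b3 e2.
rewrite j1 j2 z1 z2 !mulr0 !addr0 => E2 E1.
case: kl => -[kE lE]; subst k l.
  rewrite z3 mulr0 add0r in E1; rewrite z4 mulr0 add0r in E2.
  split; apply/eqP; [move/esym/eqP: E1|move/esym/eqP: E2];
    by rewrite mulf_eq0 (negbTE (a_neq0 _)).
rewrite z3 mulr0 addr0 in E1; rewrite z4 mulr0 addr0 in E2.
by split; apply/eqP; [move/esym/eqP: E1|move/esym/eqP: E2];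
  rewrite mulf_eq0 (negbTE (a_neq0 _)).
Qed.

Lemma orth_all x : l2 x -> orth_sol x 0 -> orth_sol x 1 -> forall n, orth_sol x n.
Proof.
move=> lx o0 o1.
have P (k : nat) : orth_sol x (Posz k) /\ orth_sol x (Posz k.+1).
  elim: k => [|k [h1 h2]]; first by split.
  by split=> //; apply: (orth_step lx h2 h1); right; split; lia.
have Q (k : nat) : orth_sol x (- Posz k) /\ orth_sol x (1 - Posz k).
  elim: k => [|k [h1 h2]]; first by rewrite oppr0 subr0.
  split; last by rewrite (_ : 1 - Posz k.+1 = - Posz k) //; lia.
  by apply: (orth_step lx h1 h2); left; split; lia.
by case=> k; [case: (P k)|rewrite NegzE; case: (Q k.+1)].
Qed.

(** At time 0 the orbits are the basis vectors, so orthogonality to all of them kills every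
    coordinate. *)
Lemma cont_part_eq0 x : summable_sol 0 -> summable_sol 1 -> cont_part a w x -> x = 0.
Proof.
move=> s0 s1 cx; have lx := proj1 cx.
have H := orth_all lx (summable_orth cx s0) (summable_orth cx s1).
apply/funext => n; have [h _] := H n 0.
case: (uv) => h0 _ _ _ _; have [u0 _] := h0 n.
by rewrite u0 dot_deltar in h.
Qed.

Lemma pure_point_summable : summable_sol 0 -> summable_sol 1 -> pure_point a w.
Proof.
move=> s0 s1 psi /in_l2P lpsi e e0.
have [x [cx nx]] := cont_part_proj a w lpsi.
rewrite (cont_part_eq0 s0 s1 cx) subr0 in nx.
have [f ef hf] := nx _ e0; have [s [es fE]] := espan_seq ef.
exists s; split=> //.
have lf := espan_l2 ef.
rewrite (_ : (fun k => _) = psi - f); last by rewrite fE.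
by rewrite l2n2_dot ?lte_fin//; exact: l2B.
Qed.

End Deterministic.

(** * Measurability and the almost sure statement *)

Section Zeta.
Context {R : realType}.

(** Telescoping against 2/sqrt(k): for s = sqrt(k) and r = sqrt(k+1), 2/s - 2/r = 2/(s r (r + s)) >=
    1/r^3, because r^2 - s^2 = 1 and s <= r. *)
Lemma sum_inv_sqrt3_le L :
  \sum_(0 <= k < L.+1) (Num.sqrt (k.+1%:R : R) ^+ 3)^-1 <= 3 - 2 / Num.sqrt (L.+1%:R : R).
Proof.
elim: L => [|L IH].
  rewrite big_nat1 sqrtr1 expr1n invr1; lra.
rewrite big_nat_recr//=; apply: le_trans (lerD IH (lexx _)) _.
set s := Num.sqrt (L.+1%:R); set r := Num.sqrt (L.+2%:R).
have s0 : 0 < s by rewrite sqrtr_gt0 ltr0n.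
have r0 : 0 < r by rewrite sqrtr_gt0 ltr0n.
have sr : s <= r by rewrite ler_wsqrtr// ler_nat.
have E : r ^+ 2 = s ^+ 2 + 1 by rewrite !sqr_sqrtr// -[L.+2%:R]natr1.
suff : (r ^+ 3)^-1 <= 2 / s - 2 / r by lra.
have -> : 2 / s - 2 / r = 2 / (s * r * (r + s)).
  rewrite [LHS](_ : _ = 2 * (r ^+ 2 - s ^+ 2) / (s * r * (r + s))).
    by rewrite E addrAC subrr add0r mulr1.
  field; rewrite !gt_eqF//; exact: addr_gt0.
have p0 : 0 < s * r * (r + s) by rewrite !mulr_gt0// addr_gt0.
rewrite ler_pdivlMr// mulrC ler_pdivrMr ?exprn_gt0//.
rewrite (_ : s * r * (r + s) = r * (s * (r + s))); last by ring.
rewrite (_ : 2 * r ^+ 3 = r * (r * (r + r))); last by ring.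
by rewrite ler_pM2l// ler_pM// ?lerD// ?ltW// addr_gt0.
Qed.

Lemma powR_le_inv_sqrt3 (x tau : R) : 1 <= x -> 3 / 2 < tau ->
  x `^ (- tau) <= (Num.sqrt x ^+ 3)^-1.
Proof.
move=> x1 ht; have x0 : 0 <= x by apply: le_trans x1.
rewrite powRN lef_pV2 ?posrE ?powR_gt0 ?exprn_gt0 ?sqrtr_gt0 ?(lt_le_trans _ x1)//.
rewrite -powR12_sqrt// -powR_mulrn ?powR_ge0// -powRrM ler_powR//.
by rewrite mulrC ltW.
Qed.

End Zeta.

(** * Measurability in the potential and almost sure summability *)

Section Measurability.
Context {R : realType}.
Context (a : int -> R) (aM : R) (a_bd : forall n, `|a n| <= aM).
Local Notation Om := (@Omega R).

Lemma measurable_coord (n : int) : measurable_fun [set: Om] (fun w : Om => w n : R).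
Proof.
move=> _ B mB; rewrite setTI; apply: sub_sigma_algebra.
by exists n, B.
Qed.

Lemma measurable_wtr N (n : int) : measurable_fun [set: Om] (fun w : Om => wtr w N n : R).
Proof.
rewrite /wtr; case: (_ && _); [exact: measurable_coord|exact: measurable_cst].
Qed.

Lemma measurable_Japp_tr N (f : Om -> int -> R) :
  (forall m, measurable_fun [set: Om] (fun w => f w m)) ->
  forall m, measurable_fun [set: Om] (fun w : Om => Japp (atr a N) (wtr w N) (f w) m).
Proof.
move=> mf m; rewrite /Japp.
apply: measurable_funD; first apply: measurable_funD.
- by apply: measurable_funM; [exact: measurable_cst|exact: mf].
- by apply: measurable_funM; [exact: measurable_cst|exact: mf].
- by apply: measurable_funM; [exact: measurable_wtr|exact: mf].
Qed.

Lemma measurable_taylor_iter N x k : forall m,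
  measurable_fun [set: Om] (fun w : Om => (taylor_iter (atr a N) (wtr w N) x k).1 m) /\
  measurable_fun [set: Om] (fun w : Om => (taylor_iter (atr a N) (wtr w N) x k).2 m).
Proof.
elim: k => [|k IH] m; first by split; exact: measurable_cst.
split.
  apply: (@measurable_Japp_tr N (fun w => (taylor_iter (atr a N) (wtr w N) x k).2)) => j.
  by case: (IH j).
rewrite (_ : (fun w : Om => _) = \- (fun w : Om =>
   Japp (atr a N) (wtr w N) (taylor_iter (atr a N) (wtr w N) x k).1 m))//.
apply: measurableT_comp => //.
by apply: (@measurable_Japp_tr N (fun w => (taylor_iter (atr a N) (wtr w N) x k).1)) => j; case: (IH j).
Qed.

Lemma measurable_egf (b : Om -> nat -> R) t : (forall w, geo_bnd (b w)) ->
  (forall k, measurable_fun [set: Om] (fun w => b w k)) ->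
  measurable_fun [set: Om] (fun w => egf (b w) t).
Proof.
move=> gb mb.
apply: (measurable_fun_cvg (h := fun N w => pseries (fun k => b w k / k`!%:R) t N)).
  move=> N; rewrite /pseries /series /=; apply: measurable_sum => k.
  by apply: measurable_funM; [apply: measurable_funM => //; exact: measurable_cst|exact: measurable_cst].
by move=> w _; exact: egf_cvg.
Qed.

Lemma measurable_utr N n t m :
  measurable_fun [set: Om] (fun w : Om => utr a w N (delta n) t m) /\
  measurable_fun [set: Om] (fun w : Om => vtr a w N (delta n) t m).
Proof.
split; apply: measurable_egf.
- move=> w; exact: (proj1 (taylor_iter_bnd (atr_bd a_bd N) (wtr_bd w N) m (sbnd_delta n))).
- by move=> k; case: (measurable_taylor_iter N (delta n) k m).
- move=> w; exact: (proj2 (taylor_iter_bnd (atr_bd a_bd N) (wtr_bd w N) m (sbnd_delta n))).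
- by move=> k; case: (measurable_taylor_iter N (delta n) k m).
Qed.

(** The chosen solution gives no direct access to measurability; it is a pointwise limit of
    truncated power series, whose coefficients are polynomials in finitely many [w n]. *)
Lemma measurable_evol_amp m n t :
  measurable_fun [set: Om] (fun w : Om => evol_amp a w m n t).
Proof.
apply: (measurable_fun_cvg (h := fun N (w : Om) =>
   Num.sqrt (utr a w N (delta n) t m ^+ 2 + vtr a w N (delta n) t m ^+ 2))).
  move=> N; have [mu mv] := measurable_utr N n t m.
  apply: (measurableT_comp (continuous_measurable_fun (@sqrt_continuous R))).
  by apply: measurable_funD; apply: measurable_funX.
move=> w _; have [u [v uv]] := nice_exists w a_bd.
rewrite (evol_amp_nice a_bd uv).
have [cu cv] := utr_cvg a_bd n t m uv.
have c : utr a w N (delta n) t m ^+ 2 + vtr a w N (delta n) t m ^+ 2 @[N --> \oo] -->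
   u n t m ^+ 2 + v n t m ^+ 2 by apply: cvgD; apply: cvgM.
exact: (continuous_cvg _ (@sqrt_continuous R _) c).
Qed.

Lemma evol_amp_ge0 (w : int -> R) m n t : 0 <= evol_amp a w m n t.
Proof. exact: sqrtr_ge0. Qed.

Lemma evol_amp_le1 (w : int -> R) m n t : evol_amp a w m n t <= 1.
Proof.
have [u [v uv]] := nice_exists w a_bd; rewrite (evol_amp_nice a_bd uv).
rewrite -[leRHS]sqrtr1 ler_wsqrtr//; case: uv => _ h _ _ _.
apply: le_trans (h n t (`|m|.+1)%N).
apply: (@wsum_mem _ (energy_at (u n) (v n) t)) => [k|]; first exact: energy_ge0.
by lia.
Qed.

Lemma evol_amp_continuous (w : int -> R) m n : continuous (evol_amp a w m n).
Proof.
have [u [v uv]] := nice_exists w a_bd.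
have -> : evol_amp a w m n = fun t => Num.sqrt (u n t m ^+ 2 + v n t m ^+ 2).
  by apply/funext => t; exact: evol_amp_nice.
have S := schrod_coord (nice_schrod uv n).
move=> t; have [[du _] [dv _]] := S t m.
have cu : u n s m @[s --> t] --> u n t m.
  by apply: differentiable_continuous; apply/derivable1_diffP.
have cv : v n s m @[s --> t] --> v n t m.
  by apply: differentiable_continuous; apply/derivable1_diffP.
have c : u n s m ^+ 2 + v n s m ^+ 2 @[s --> t] --> u n t m ^+ 2 + v n t m ^+ 2.
  by apply: cvgD; apply: cvgM.
exact: (continuous_cvg _ (@sqrt_continuous R _) c).
Qed.

Definition sup_amp m n (w : int -> R) : \bar R :=
  ereal_sup [set (evol_amp a w m n t)%:E | t in [set: R]].

(** An enumeration of the rationals; codes that decode to nothing are sent to 0. *)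
Definition ratn (k : nat) : R := ratr (odflt 0%Q (unpickle k)).

(** Continuity in t reduces the supremum to rational times, so that it becomes a countable one and
    hence measurable in [w]. *)
Lemma sup_ampE m n w :
  sup_amp m n w = esups (fun k => (evol_amp a w m n (ratn k))%:E) 0%N.
Proof.
apply/eqP; rewrite eq_le; apply/andP; split; last first.
  apply: le_ereal_sup => _ [k _ <-]; by exists (ratn k).
apply: ge_ereal_sup => _ [t _ <-].
apply/lee_addgt0Pr => e e0.
have := @evol_amp_continuous w m n t.
move/cvgrPdist_le => /(_ e e0) /nbhs_ballP[d /= d0 hd].
have [q hq] : exists q : rat, ratr q \in `]t - d, t + d[.
  by apply: rat_in_itvoo; lra.
have /hd h : ball t d (ratr q).
  by rewrite /ball /= distrC ltr_distl; move: hq; rewrite in_itv.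
apply: (@le_trans _ _ ((evol_amp a w m n (ratr q))%:E + e%:E)%E).
  by rewrite -EFinD lee_fin; move: h; rewrite /= ler_norml => /andP[_]; lra.
rewrite leeD2r//; apply: ereal_sup_ubound; exists (pickle q) => //=.
by rewrite /ratn pickleK.
Qed.

Lemma measurable_sup_amp m n : measurable_fun [set: Om] (sup_amp m n : Om -> \bar R).
Proof.
rewrite (_ : sup_amp m n = fun w => esups (fun k => (evol_amp a w m n (ratn k))%:E) 0%N).
  apply: measurable_fun_esups => k; apply/measurable_EFinP.
  exact: measurable_evol_amp.
by apply/funext => w; exact: sup_ampE.
Qed.

Lemma sup_amp_ge0 m n w : (0 <= sup_amp m n w)%E.
Proof.
apply: le_trans (_ : (evol_amp a w m n 0)%:E <= _)%E.
  by rewrite lee_fin evol_amp_ge0.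
by apply: ereal_sup_ubound; exists 0.
Qed.

Lemma sup_amp_fin m n w : sup_amp m n w = (fine (sup_amp m n w))%:E.
Proof.
rewrite fineK// ge0_fin_numE ?sup_amp_ge0//.
apply: le_lt_trans (ltry 1); apply: ge_ereal_sup => _ [t _ <-].
by rewrite lee_fin evol_amp_le1.
Qed.

Lemma evol_amp_sup m n w t : evol_amp a w m n t <= fine (sup_amp m n w).
Proof. by rewrite -lee_fin -sup_amp_fin; apply: ereal_sup_ubound; exists t. Qed.

Lemma ae_summable (mu : probability Om R) (C tau : R) n : 0 < C -> 3 / 2 < tau ->
  (forall m : int, m != 0 ->
     (avg_sup_amp mu a m n <= (C * (`|m|%:~R : R) `^ (- tau))%:E)%E) ->
  {ae mu, forall w : Om, forall u v, nice_sol a w u v -> summable_sol u v n}.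
Proof.
move=> C0 ht decay.
(* The sites k+1 and -(k+1) are paired; site 0, on which the decay hypothesis is silent, is left
   out. *)
pose H (k : nat) (w : Om) := (sup_amp (Posz k.+1) n w + sup_amp (Negz k) n w)%E.
have mH k : measurable_fun [set: Om] (H k).
  by apply: emeasurable_funD; exact: measurable_sup_amp.
have H0 k w : (0 <= H k w)%E by rewrite adde_ge0 ?sup_amp_ge0.
have iH k : (\int[mu]_(w in [set: Om]) H k w <=
    (2 * C * (Num.sqrt (k.+1%:R : R) ^+ 3)^-1)%:E)%E.
  have P : C * (k.+1%:R : R) `^ (- tau) <= C * (Num.sqrt (k.+1%:R : R) ^+ 3)^-1.
    by rewrite ler_pM2l//; apply: powR_le_inv_sqrt3 => //; rewrite ler1n.
  rewrite ge0_integralD//; try exact: measurable_sup_amp;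
    try by move=> w _; exact: sup_amp_ge0.
  apply: (@le_trans _ _ ((C * (k.+1%:R : R) `^ (- tau))%:E + (C * (k.+1%:R : R) `^ (- tau))%:E)%E).
    apply: leeD.
      by apply: le_trans (decay (Posz k.+1) isT) _.
    by apply: le_trans (decay (Negz k) isT) _.
  by rewrite -EFinD lee_fin; lra.
pose f (w : Om) := (\sum_(0 <= k <oo) H k w)%E.
have mf : measurable_fun [set: Om] f.
  by apply: ge0_emeasurable_sum => // k w _ _; exact: H0.
(* Each [H k] contributes at most 2 C (k+1)^(-3/2), and these powers sum to at most 3. *)
have if_ : (\int[mu]_(w in [set: Om]) f w <= (6 * C)%:E)%E.
  rewrite integral_nneseries//; apply: lime_le.
    apply: is_cvg_nneseries => k _ _; apply: integral_ge0 => w _; exact: H0.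
  apply: nearW => L.
  apply: (@le_trans _ _ (\sum_(0 <= k < L) (2 * C * (Num.sqrt (k.+1%:R : R) ^+ 3)^-1)%:E)%E).
    by apply: lee_sum => k _; exact: iH.
  rewrite sumEFin lee_fin -mulr_sumr (_ : 6 * C = 2 * C * 3); last by ring.
  rewrite ler_pM2l ?mulr_gt0//; case: L => [|L]; first by rewrite big_nil.
  apply: le_trans (sum_inv_sqrt3_le L) _.
  by rewrite gerBl divr_ge0// sqrtr_ge0.
have : mu.-integrable [set: Om] f.
  apply/integrableP; split => //.
  rewrite (eq_integral f); last first.
    by move=> w _; rewrite gee0_abs//; apply: nneseries_ge0 => k _ _; exact: H0.
  exact: le_lt_trans if_ (ltry _).
(* The envelope is the supremal amplitude itself; the 1 added to its total pays for site 0. *)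
move/(integrable_ae measurableT); apply: filterS => w /(_ I) fw u v uv.
exists (fun m => fine (sup_amp m n w)), (1 + fine (f w)); split.
  move=> t m; apply: le_trans (evol_amp_sup m n w t).
  have E : sq (u n t) m + sq (v n t) m = evol_amp a w m n t ^+ 2.
    by rewrite (evol_amp_nice a_bd uv) sqr_sqrtr// addr_ge0 ?sqr_ge0.
  (* An amplitude is at most 1, so its square is at most itself. *)
  by rewrite E expr2 ler_piMr ?evol_amp_ge0 ?evol_amp_le1.
pose s m := fine (sup_amp m n w); rewrite -/s.
have s0 m : 0 <= s m by rewrite fine_ge0// sup_amp_ge0.
have s1 m : s m <= 1.
  rewrite -lee_fin -sup_amp_fin; apply: ge_ereal_sup => _ [t _ <-].
  by rewrite lee_fin evol_amp_le1.
have part L : \sum_(0 <= k < L) (s (Posz k.+1) + s (Negz k)) <= fine (f w).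
  rewrite -lee_fin fineK// -sumEFin.
  apply: le_trans (nneseries_lim_ge L _); last by move=> k _ _; exact: H0.
  by apply: lee_sum => k _; rewrite /H EFinD -!sup_amp_fin.
move=> L; apply: le_trans (lerD (lexx 1) (part L)).
(* [wsum] pairs k with -(k+1), whereas [H] pairs k+1 with -(k+1): the two differ by the sites 0 and
   L. *)
apply: (@le_trans _ _ (s 0 + \sum_(0 <= k < L) (s (Posz k.+1) + s (Negz k)) - s (Posz L))).
  elim: L => [|L IH]; first by rewrite wsum0 big_nil addr0 subrr.
  by rewrite wsumS big_nat_recr//=; lra.
have := s1 0; have := s0 (Posz L); lra.
Qed.

End Measurability.

Theorem theorem2p6 (R : realType) (r : R -> R) (d c a : int -> R)
  (r_ge0 : forall x, 0 <= r x)
  (r_bdd : exists M : R, forall x, r x <= M)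
  (r_meas : measurable_fun [set: R] r)
  (r_cpt : exists K : R, forall x, K < `|x| -> r x = 0)
  (r_int1 : (\int[@lebesgue_measure R]_(x in [set: R]) (r x)%:E = 1)%E)
  (d_gt0 : forall n, 0 < d n)
  (c_bdd : exists M : R, forall n, `|c n| <= M)
  (a_bdd : exists M : R, forall n, `|a n| <= M)
  (dlt : R) (dlt_gt0 : 0 < dlt) (a_ge : forall n, dlt <= a n)
  (mu : probability (@Omega R) R)
  (mu_prod : is_product_law r d c mu)
  (decay : exists (C tau : R), [/\ 0 < C, 3 / 2 < tau &
     forall m : int, m != 0 -> forall n : int, (n == 0) || (n == 1) ->
       (avg_sup_amp mu a m n <= (C * (`|m|%:~R : R) `^ (- tau))%:E)%E]) :
  {ae mu, forall w : @Omega R, pure_point a w}.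
Proof.
have [aM a_bd] := a_bdd; have [C [tau [C0 ht hd]]] := decay.
have h0 := ae_summable a_bd C0 ht (fun m m0 => hd m m0 0 isT).
have h1 := ae_summable a_bd C0 ht (fun m m0 => hd m m0 1 isT).
apply: filterS2 h0 h1 => w w0 w1.
have [u [v uv]] := nice_exists w a_bd.
exact: (pure_point_summable a_bd dlt_gt0 a_ge uv (w0 _ _ uv) (w1 _ _ uv)).
Qed.
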